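(* Let $\beta>1$, let $x_0,y_0\in[0,1]$ be fixed, and let $f,g:[0,1]\to(0,\infty)$ be two positive continuous functions such that $f(x)\ge g(y)$ for all $x,y\in[0,1]$. Let $$E(T_\beta,f,g)=\left\{(x,y)\in[0,1]^2:\ |T_\beta^n x-x_0|<e^{-S_nf(x)}\ \text{ and }\ |T_\beta^n y-y_0|<e^{-S_ng(y)}\ \text{ for infinitely many } n\in\mathbb{N}\right\}.$$ Then $$\dim_{\mathrm H}E(T_\beta,f,g)=\min\{s_1,s_2\},$$ where $$s_1=\inf\{s\ge 0:\ P(f-s(\log\beta+f))+P(-g)\le 0\},$$ $$s_2=\inf\{s\ge 0:\ P(-s(\log\beta+g))+\log\beta\le 0\}.$$
   Context: For $\beta>1$, the map $T_\beta:[0,1]\to[0,1]$ is $T_\beta x=\beta x-\lfloor\beta x\rfloor$. For a function $h$ on $[0,1]$, $S_nh(x)=\sum_{j=0}^{n-1}h(T_\beta^jx)$ is the Birkhoff sum. $\dim_{\mathrm H}$ denotes Hausdorff dimension. Digits and cylinders: for $x\in[0,1)$ and $n\ge1$ put $\epsilon_n(x,\beta)=\lfloor\beta T_\beta^{n-1}x\rfloor$. A finite word $(\epsilon_1,\dots,\epsilon_n)$ is admissible (with respect to $\beta$) if there is $x\in[0,1)$ with $\epsilon_j(x,\beta)=\epsilon_j$ for $1\le j\le n$; $\Sigma_\beta^n$ is the set of all admissible words of length $n$. For $(\epsilon_1,\dots,\epsilon_n)\in\Sigma_\beta^n$ the $n$-th order cylinder is $I_n(\epsilon_1,\dots,\epsilon_n)=\{x\in[0,1):\epsilon_j(x,\beta)=\epsilon_j,\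 1\le j\le n\}$. Pressure: for a continuous function $h:[0,1]\to\mathbb{R}$, $$P(h)=P(h,T_\beta)=\lim_{n\to\infty}\frac1n\log\sum_{(\epsilon_1,\dots,\epsilon_n)\in\Sigma_\beta^n}\ \sup_{y\in I_n(\epsilon_1,\dots,\epsilon_n)}e^{S_nh(y)}.$$ *)

(* Defs.v *)
From HB Require Import structures.
From mathcomp Require Export all_boot all_order all_algebra.
From mathcomp Require Export all_classical all_reals all_analysis.
Export Order.TTheory GRing.Theory Num.Theory.
Export numFieldNormedType.Exports.

Set Implicit Arguments.
Unset Strict Implicit.
Unset Printing Implicit Defensive.

Local Open Scope classical_set_scope.
Local Open Scope ring_scope.

(* The norm of the library on a product such as R * R is the maximum norm. It is
   equivalent to the Euclidean one, hence gives the same Hausdorff dimension. *)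
Section hausdorff_dimension.
Context {R : realType} {T : normedModType R}.
Implicit Types (A U : set T) (s delta : R).
Local Open Scope ereal_scope.

Definition diam U : \bar R :=
  ereal_sup [set (`|p.1 - p.2|%R)%:E | p in U `*` U].

(* (diam U)^s, where the empty set contributes 0 for every s, and a single
   point contributes 1 for s = 0 since 0 `^ 0 = 1. *)
Definition hausdorff_gauge s U : \bar R :=
  if pselect (U = set0) then 0 else poweR (diam U) s.

Definition hausdorff_premeasure s delta A : \bar R :=
  ereal_inf [set \sum_(0 <= i <oo) hausdorff_gauge s (U i) | U in
    [set U : (set T)^nat |
      A `<=` \bigcup_i U i /\ forall i, diam (U i) <= delta%:E]].

Definition hausdorff_measure s A : \bar R :=
  ereal_sup [set hausdorff_premeasure s delta A | delta in
    [set delta | (0 < delta)%R]].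

Definition hausdorff_dim A : \bar R :=
  ereal_inf [set s%:E | s in
    [set s | (0 <= s)%R /\ hausdorff_measure s A = 0]].

End hausdorff_dimension.

(* A function on [0, 1] is represented by a function R -> R of which only the
   values on [0, 1] matter; beta_map maps [0, 1] into [0, 1). *)
Section beta_dynamics.
Context {R : realType}.
Implicit Types (beta x : R) (h : R -> R).

Definition beta_map beta x : R := beta * x - (Num.floor (beta * x))%:~R.

Definition birkhoff beta n h x : R :=
  \sum_(0 <= j < n) h (iter j (beta_map beta) x).

(* Meaningful for n >= 1. *)
Definition digit beta n x : int :=
  Num.floor (beta * iter n.-1 (beta_map beta) x).

Definition cylinder beta n (w : n.-tuple int) : set R :=
  [set x | (x \in `[0, 1[) /\ forall j : 'I_n, digit beta j.+1 x = tnth w j].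

Definition admissible beta (n : nat) : set (n.-tuple int) :=
  [set w | exists x, (x \in `[0, 1[) /\
     forall j : 'I_n, digit beta j.+1 x = tnth w j].

Arguments admissible beta n : clear implicits.

(* For beta > 1 there are finitely many admissible words of length n, so that
   the sum over the set of words is a genuine finite sum; for h continuous on
   [0, 1] the suprema are finite and the limit exists by subadditivity. *)
Definition pressure beta h : R :=
  limn (fun n : nat => n%:R^-1 *
    ln (\sum_(w \in admissible beta n)
          sup [set expR (birkhoff beta n h y) | y in cylinder beta w])).

Definition shrinking_set beta (x0 y0 : R) (f g : R -> R) : set (R * R) :=
  [set z | [/\ z.1 \in `[0, 1], z.2 \in `[0, 1] &
    infinite_set [set n : nat |
      `|iter n (beta_map beta) z.1 - x0| < expR (- birkhoff beta n f z.1) /\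
      `|iter n (beta_map beta) z.2 - y0| < expR (- birkhoff beta n g z.2)]]].

Definition s1 beta (f g : R -> R) : \bar R :=
  ereal_inf [set s%:E | s in [set s : R | 0 <= s /\
    pressure beta (fun x => f x - s * (ln beta + f x))
      + pressure beta (fun x => - g x) <= 0]].

Definition s2 beta (g : R -> R) : \bar R :=
  ereal_inf [set s%:E | s in [set s : R | 0 <= s /\
    pressure beta (fun x => - (s * (ln beta + g x))) + ln beta <= 0]].

End beta_dynamics.

(* Main.v *)
(* Full cylinders.  A cylinder of order n is full when T^n maps it onto [0, 1).
   Lowering the last nonzero digit of a word by one and keeping its trailing
   zeros gives a full word, the orbit moves by a summable amount, and at most
   n + 1 words have the same image.  Hence P(h) is the exponential growth rate
   of the sum of exp(S_n h) over full cylinders only.  The inverse branches on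
   full cylinders are similarities of ratio beta^-n which can be composed
   freely, and every point of [0, 1] is within (n + 1) beta^-n of a full
   cylinder of order n.

   Upper bound.  At time n the set is covered by rectangles of sides
   beta^-n exp(-S_n f) and beta^-n exp(-S_n g), one for each pair of words; the
   first side is the smaller one.  Covering each rectangle by squares of the
   smaller side gives s_1; a single square of the larger side gives s_2.

   Lower bound.  Let s < min(s_1, s_2), and put (A, B) = (s - 1, 1) if s >= 1
   and (A, B) = (0, s) if s < 1.  As f >= g, only the corresponding one of the
   two pressure conditions matters.  By pigeonhole there are a block length N
   and families U, V of full words of length N on which S_N f is about N a and
   S_N g is about N b, with log(#U #V) > N (s log beta + A a + B b).  Take
   products of k blocks from U and from V, followed by a full word close to x_0,
   resp. close to y_0; the second one is shorter and is completed by all full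
   words.  Concatenating such stages gives a product of two Cantor sets inside
   the limsup set, on which the uniform mass of a ball of radius r is O(r^s).
   The mass distribution principle is used in a purely combinatorial form: a
   countable cover is reduced to a finite one by Koenig's lemma, and then
   the nodes of a sufficiently deep generation are counted. *)
Require Import Defs.
From mathcomp Require Import ring lra.

Set Implicit Arguments.
Unset Strict Implicit.
Unset Printing Implicit Defensive.

Local Open Scope classical_set_scope.
Local Open Scope ring_scope.

(** * Full cylinders of the beta-transformation *)

Section full_cylinders.
Context {R : realType} (beta : R) (beta_gt1 : 1 < beta).
Local Notation T := (beta_map beta).
Implicit Types (x y z c d h : R) (n m i j : nat).

Lemma beta_gt0 : 0 < beta.
Proof. exact: lt_trans beta_gt1. Qed.

Lemma pow_gt0 n : 0 < beta ^+ n.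
Proof. exact/exprn_gt0/beta_gt0. Qed.

Lemma powV_gt0 n : 0 < beta ^- n.
Proof. by rewrite invr_gt0 pow_gt0. Qed.

Lemma powVK n : beta ^- n * beta ^+ n = 1.
Proof. by rewrite mulVf // gt_eqF ?pow_gt0. Qed.

Lemma powVD n m : beta ^- (n + m) = beta ^- n * beta ^- m.
Proof. by rewrite exprD invfM. Qed.

Lemma powVS n : beta ^- n = beta * beta ^- n.+1.
Proof. by rewrite exprS invfM mulrA divff ?mul1r // gt_eqF ?beta_gt0. Qed.

Lemma powV_le1 n : beta ^- n <= 1.
Proof. by rewrite invf_le1 ?pow_gt0// exprn_ege1 // ltW. Qed.

Lemma beta_map_ge0 x : 0 <= T x.
Proof. by rewrite subr_ge0 ge_floor. Qed.

Lemma beta_map_lt1 x : T x < 1.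
Proof. by rewrite ltrBlDr addrC -[X in _ + X]/(1%:~R) -intrD floorD1_gt. Qed.

Lemma iter_beta_map_ge0 n x : 0 <= x -> 0 <= iter n T x.
Proof. by case: n => // n _; rewrite iterS beta_map_ge0. Qed.

Lemma iter_beta_map_lt1 n x : x < 1 -> iter n T x < 1.
Proof. by case: n => // n _; rewrite iterS beta_map_lt1. Qed.

Lemma iter_beta_map_itv n x : 0 <= x <= 1 -> 0 <= iter n T x <= 1.
Proof.
case: n => // n _; rewrite iterS beta_map_ge0 /=.
exact/ltW/beta_map_lt1.
Qed.

Lemma beta_map_le x : 0 <= x -> T x <= beta * x.
Proof.
move=> x0; rewrite lerBlDr lerDl ler0z floor_ge0.
by rewrite mulr_ge0 // ltW // beta_gt0.
Qed.

Lemma iter_beta_map_le n x : 0 <= x -> iter n T x <= beta ^+ n * x.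
Proof.
move=> x0; elim: n => [|n IHn]; first by rewrite mul1r.
rewrite iterS exprS -mulrA (le_trans (beta_map_le (iter_beta_map_ge0 n x0))) //.
by rewrite ler_pM2l ?beta_gt0.
Qed.

Lemma beta_mapE x (k : int) : k%:~R <= beta * x < k%:~R + 1 ->
  Num.floor (beta * x) = k /\ T x = beta * x - k%:~R.
Proof.
move=> /andP[kx xk]; suff fl : Num.floor (beta * x) = k by rewrite /beta_map fl.
by apply: floor_def; rewrite kx intrD.
Qed.

Lemma beta_map0 : T 0 = 0.
Proof. by rewrite (beta_mapE (k := 0) _).2 ?mulr0 ?subr0 // lexx add0r ltr01. Qed.

Lemma iter_beta_map0 n : iter n T 0 = 0.
Proof. by elim: n => // n IHn; rewrite iterS IHn beta_map0. Qed.

(* The points below x in the n-cylinder of x are those within T^n x / beta^n,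
   cylinders being closed on the left. *)
Lemma iter_beta_map_below n x z : 0 <= x -> 0 <= x - z ->
    (x - z) * beta ^+ n <= iter n T x ->
  forall i, (i <= n)%N -> iter i T z = iter i T x - (x - z) * beta ^+ i /\
    ((i < n)%N ->
      Num.floor (beta * iter i T z) = Num.floor (beta * iter i T x)).
Proof.
elim: n x z => [|n IHn] x z x0 zx; first by move=> _ [|//] _; rewrite mulr1; split => //=; ring.
rewrite iterSr => H.
have zT : (x - z) * beta <= T x.
  have := le_trans H (iter_beta_map_le n (beta_map_ge0 x)).
  by rewrite exprS mulrA [leRHS]mulrC ler_pM2r ?pow_gt0.
have [fl Tz] : Num.floor (beta * z) = Num.floor (beta * x) /\
    T z = beta * z - (Num.floor (beta * x))%:~R.
  apply: beta_mapE; apply/andP; split.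
    by move: zT; rewrite /beta_map; lra.
  have := beta_map_lt1 x; have := mulr_ge0 zx (ltW beta_gt0).
  rewrite /beta_map; lra.
have TxTz : T x - T z = (x - z) * beta by rewrite Tz /beta_map; ring.
have dT : 0 <= T x - T z by rewrite TxTz mulr_ge0 // ltW // beta_gt0.
case=> [|i]; first by rewrite mulr1 => _; split => //=; ring.
have H' : (T x - T z) * beta ^+ n <= iter n T (T x).
  by rewrite TxTz -mulrA -exprS.
rewrite ltnS => /(IHn _ _ (beta_map_ge0 x) dT H') [e1 e2].
by rewrite !iterSr exprS mulrA -TxTz; split.
Qed.

(* The left end points c of the full cylinders of order n: T^n maps
   [c, c + beta^-n) affinely onto [0, 1). *)
Definition full n c := [/\ 0 <= c, c + beta ^- n <= 1, iter n T c = 0 &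
  forall h, 0 <= h -> h < beta ^- n -> forall i, (i <= n)%N ->
    iter i T (c + h) = iter i T c + h * beta ^+ i].

Lemma full_itv n c : full n c -> 0 <= c < 1.
Proof. by case=> -> cn _ _ /=; apply: lt_le_trans cn; rewrite ltrDl powV_gt0. Qed.

Lemma full0 : full 0 0.
Proof.
split => // [|h h0 h1 i]; first by rewrite add0r expr0 invr1.
by rewrite leqn0 => /eqP-> /=; rewrite mulr1.
Qed.

Lemma full1 : full 1 0.
Proof.
split => [//|||h h0 h1]; first by rewrite add0r powV_le1.
  exact: iter_beta_map0.
case=> [_|[_|//]]; first by rewrite mulr1.
rewrite /= beta_map0 !add0r (beta_mapE (k := 0) _).2 ?subr0 1?mulrC //.
by rewrite mulr_ge0 ?(ltW beta_gt0) //= [ltRHS]add0r -ltr_pdivlMr ?beta_gt0 // mul1r.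
Qed.

(** The map sending [t] to [c + t * beta ^- n] inverts T^n on the full cylinder of [c], so it
    carries the full cylinder of [d] onto a full cylinder of order [n + m]. This is concatenation of
    words, written on left end points. *)
Lemma full_comp n m c d : full n c -> full m d ->
  full (n + m) (c + d * beta ^- n).
Proof.
move=> fc fd; have [c0 cn Tc hc] := fc; have [d0 dm Td hd] := fd.
have /andP[_ d1] := full_itv fd.
have dn h : 0 <= h -> h < beta ^- (n + m) -> 0 <= d * beta ^- n + h /\
    d * beta ^- n + h < beta ^- n.
  move=> h0 hnm; split; first by rewrite addr_ge0 // mulr_ge0 // ltW // powV_gt0.
  apply: lt_le_trans (_ : (d + beta ^- m) * beta ^- n <= _).
    by rewrite mulrDl ltrD2l mulrC -powVD.
  by rewrite ler_piMl // ltW // powV_gt0.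
have Tn h : 0 <= h -> h < beta ^- (n + m) ->
    iter n T (c + d * beta ^- n + h) = d + h * beta ^+ n.
  move=> h0 hnm; have [dn0 dn1] := dn h h0 hnm.
  by rewrite -addrA hc // Tc add0r mulrDl -mulrA powVK mulr1.
have nm0 : 0 < beta ^- (n + m) by exact: powV_gt0.
have Tn0 : iter n T (c + d * beta ^- n) = d.
  by rewrite -[X in iter _ _ X]addr0 Tn // mul0r addr0.
split.
- by rewrite addr_ge0 // mulr_ge0 // ltW // powV_gt0.
- apply: le_trans cn; rewrite -addrA lerD2l powVD [X in _ + X]mulrC -mulrDl.
  by rewrite ler_piMl // ltW // powV_gt0.
- by rewrite addnC iterD Tn0.
move=> h h0 hnm i inm; have [dn0 dn1] := dn h h0 hnm.
have [i_n|n_i] := leqP i n.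
  rewrite -addrA !hc //; first by ring.
    by rewrite mulr_ge0 // ltW // powV_gt0.
  by rewrite -[ltRHS]mul1r ltr_pM2r // powV_gt0.
have ->: i = ((i - n) + n)%N by rewrite subnK // ltnW.
rewrite !iterD Tn // Tn0 hd ?mulr_ge0 ?(ltW (pow_gt0 _)) //.
- by rewrite -mulrA -exprD addnC.
- rewrite -(@ltr_pM2l _ (beta ^- n)) ?powV_gt0// -powVD.
  by rewrite mulrC -mulrA divff ?mulr1 // gt_eqF // pow_gt0.
- by rewrite leq_subLR.
Qed.

Lemma full_zero n : full n 0.
Proof.
elim: n => [|n IHn]; first exact: full0.
by have := full_comp full1 IHn; rewrite mul0r addr0.
Qed.

(** Appending [m - n] zeros to a full word keeps it full and does not move the left end point. *)
Lemma full_ext n m c : (n <= m)%N -> full n c -> full m c.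
Proof.
move=> nm fc; have := full_comp fc (full_zero (m - n)).
by rewrite mul0r addr0 subnKC.
Qed.

Lemma full_iter n m c d : full n c -> 0 <= d < 1 ->
  iter (m + n) T (c + d * beta ^- n) = iter m T d.
Proof.
move=> [_ _ Tc hc] /andP[d0 d1].
rewrite iterD hc ?Tc //; first by rewrite add0r -mulrA powVK mulr1.
  by rewrite mulr_ge0 // ltW // powV_gt0.
by rewrite -[ltRHS]mul1r ltr_pM2r // powV_gt0.
Qed.

(** If [d] were inside the cylinder of [c], the affine formula would give T^n d = (d - c) beta^n,
    which is nonzero, whereas a left end point is sent to 0. *)
Lemma full_sep n c d : full n c -> full n d -> c < d -> c + beta ^- n <= d.
Proof.
move=> [c0 _ Tc hc] [_ _ Td _] cd; rewrite leNgt; apply/negP => dc.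
have : iter n T (c + (d - c)) = (d - c) * beta ^+ n.
  by rewrite hc ?Tc ?add0r //; lra.
rewrite addrC subrK Td => /esym/eqP; rewrite mulf_eq0 (gt_eqF (pow_gt0 n)) orbF.
by rewrite subr_eq0 gt_eqF.
Qed.

(* c is obtained by lowering the last nonzero digit of x by one; j is the
   position of this digit, or 0 when the first n digits vanish. *)
Lemma full_near_orbit n x : 0 <= x <= 1 -> exists c j, [/\ (j <= n)%N, full j c,
  x = c + (0 < j)%:R * beta ^- j + iter n T x * beta ^- n &
  \sum_(0 <= i < n) `|iter i T x - iter i T c| <= 3 / (beta - 1)].
Proof.
move=> x01; have /andP[x0 x1] := x01.
have b1 : 0 < beta - 1 by rewrite subr_gt0.
(* The bound is strengthened so that it survives a zero digit: then T^(n+1) x = beta T^n x, and the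
   new term T^n x is exactly the increase of the right-hand side. After a nonzero digit the sum is a
   fresh geometric series, bounded by (1 + T^(n+1) x) / (beta - 1). *)
suff [c [j [jn fc xE sumE]]] : exists c j, [/\ (j <= n)%N, full j c,
  x = c + (0 < j)%:R * beta ^- j + iter n T x * beta ^- n &
  \sum_(0 <= i < n) `|iter i T x - iter i T c| <= (2 + iter n T x) / (beta - 1)].
  exists c, j; split => //; apply: le_trans sumE _; rewrite ler_pM2r ?invr_gt0 //.
  have /andP[_] := iter_beta_map_itv n x01; lra.
elim: n => [|n [c [j [jn fc xE sumE]]]].
  exists 0, 0%N; split => //; first exact: full0.
    by rewrite mul0r addr0 add0r expr0 invr1 mulr1.
  by rewrite big_nil /= divr_ge0 ?(ltW b1) //; lra.
have t0 := iter_beta_map_ge0 n x0; have t0' := iter_beta_map_ge0 n.+1 x0.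
set d := Num.floor (beta * iter n T x).
have d_ge0 : 0 <= d by rewrite floor_ge0 mulr_ge0 // ltW // beta_gt0.
have tE : iter n.+1 T x = beta * iter n T x - d%:~R by [].
have [d0|d1] : d = 0 \/ 1 <= d by case: (d) d_ge0 => -[|k] // _; [left | right].
  have {}tE : iter n.+1 T x = beta * iter n T x by rewrite tE d0 subr0.
  exists c, j; split => //; first exact: leqW.
    by rewrite {1}xE tE (powVS n); ring.
  rewrite big_nat_recr //= (_ : iter n T c = 0) ?subr0.
    rewrite ger0_norm // (le_trans (lerD sumE (lexx _))) // -iterS tE.
    by rewrite ler_pdivlMr // mulrDl -mulrA mulVf ?gt_eqF //; lra.
  by case: fc => _ _ fc _; rewrite -(subnK jn) iterD fc iter_beta_map0.
move: (iter n.+1 T x) t0' tE => t t0' tE.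
(* Going down by [t * beta ^- n.+1] reaches the left end of the cylinder of [x]; one further step of
   [beta ^- n.+1] lowers its last digit from [d] to [d - 1], and every value in [0, 1) is then
   attained. *)
pose c' := x - (t + 1) * beta ^- n.+1.
have d1' : 1 <= d%:~R :> R by rewrite ler1z.
have below h : 0 <= h -> h < beta ^- n.+1 -> forall i, (i <= n)%N ->
    iter i T (c' + h) = iter i T x - ((t + 1) * beta ^- n.+1 - h) * beta ^+ i.
  move=> h0 hn i i_n.
  have xz : x - (c' + h) = (t + 1) * beta ^- n.+1 - h by rewrite /c'; ring.
  rewrite -xz; apply: (proj1 (iter_beta_map_below (n := n) x0 _ _ i_n)); rewrite xz.
    have := mulr_ge0 t0' (ltW (powV_gt0 n.+1)); lra.
  have : 0 <= h * beta ^+ n by rewrite mulr_ge0 // ltW // pow_gt0.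
  have : (t + 1) * beta ^- n.+1 * beta ^+ n = (t + 1) / beta.
    by rewrite exprS invfM -!mulrA powVK mulr1.
  have : (t + 1) / beta <= iter n T x by rewrite ler_pdivrMr ?beta_gt0 // mulrC; lra.
  lra.
have n0 : 0 < beta ^- n.+1 by exact: powV_gt0.
have below1 h : 0 <= h -> h < beta ^- n.+1 -> iter n.+1 T (c' + h) = h * beta ^+ n.+1.
  move=> h0 hn; rewrite iterS.
  have e : beta * iter n T (c' + h) = (d - 1)%:~R + h * beta ^+ n.+1.
    rewrite below // intrD.
    have : beta * (beta ^- n.+1 * beta ^+ n) = 1 by rewrite mulrA -powVS powVK.
    rewrite tE; move: (beta ^- n.+1) => P e.
    transitivity (beta * iter n T x - (beta * iter n T x - d%:~R + 1) *
       (beta * (P * beta ^+ n)) + h * (beta * beta ^+ n)); first by ring.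
    by rewrite e (exprS beta n); ring.
  have : h * beta ^+ n.+1 < 1 by rewrite -(powVK n.+1) ltr_pM2r ?pow_gt0.
  have : 0 <= h * beta ^+ n.+1 by rewrite mulr_ge0 // ltW // pow_gt0.
  move=> *; rewrite (beta_mapE (k := d - 1) _).2 e; first by ring.
  by apply/andP; split; lra.
have c'E i : (i <= n)%N -> iter i T c' = iter i T x - (t + 1) * beta ^- n.+1 * beta ^+ i.
  by move=> i_n; have := below _ (lexx 0) n0 i i_n; rewrite addr0 subr0.
have fc' : full n.+1 c'.
  split.
  - rewrite subr_ge0 ler_pdivrMr ?pow_gt0 // mulrC exprS.
    apply: le_trans (_ : beta * iter n T x <= _); first by lra.
    by rewrite -mulrA ler_pM2l ?beta_gt0 // iter_beta_map_le.
  - have := mulr_ge0 t0' (ltW n0); rewrite /c'; lra.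
  - by have := below1 _ (lexx 0) n0; rewrite addr0 mul0r.
  move=> h h0 hn i; rewrite leq_eqVlt => /predU1P[->|].
    by rewrite below1 // -[in RHS](addr0 c') below1 // mul0r add0r.
  by rewrite ltnS => i_n; rewrite below // c'E //; ring.
exists c', n.+1; split => //; first by rewrite /c' mul1r; ring.
rewrite (eq_big_nat _ _ (F2 := fun i => (t + 1) * beta ^- n.+1 * beta ^+ i)); last first.
  move=> i /andP[_]; rewrite ltnS => i_n; rewrite c'E // opprB addrC subrK.
  by rewrite ger0_norm // !mulr_ge0 ?addr_ge0 ?ler01 ?(ltW n0) ?(ltW (pow_gt0 _)).
rewrite -mulr_sumr big_mkord ler_pdivlMr //.
rewrite (_ : _ * (beta - 1) =
  (t + 1) * beta ^- n.+1 * ((beta - 1) * \sum_(i < n.+1) beta ^+ i)); last by ring.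
have := mulr_ge0 t0' (ltW n0).
by rewrite -subrX1 mulrBr mulr1 -mulrA powVK; lra.
Qed.

End full_cylinders.

(** * Comparison of finite sums over lists *)

Section sums_over_sequences.
Context {R : realType}.

Lemma ler_sum_subset {I : eqType} (r s : seq I) (F : I -> R) :
  uniq r -> {subset r <= s} -> (forall i, 0 <= F i) ->
  \sum_(i <- r) F i <= \sum_(i <- s) F i.
Proof.
move=> ur rs F0; elim: r s ur rs => [|i r IHr] s /=.
  by move=> _ _; rewrite big_nil sumr_ge0.
move=> /andP[ir ur] rs; rewrite big_cons.
have si : i \in s by rewrite rs ?mem_head.
rewrite (perm_big _ (perm_to_rem si)) big_cons lerD2l IHr // => j jr.
have : j \in s by rewrite rs // inE jr orbT.
have ji : j != i by apply: contraNneq ir => <-.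
by rewrite (perm_mem (perm_to_rem si)) inE (negbTE ji).
Qed.

Lemma ler_sum_injective {I J : eqType} (r : seq I) (s : seq J) (F : I -> R)
    (G : J -> R) (f : I -> J) : uniq r ->
  {in r &, injective f} -> (forall i, i \in r -> f i \in s /\ F i <= G (f i)) ->
  (forall j, 0 <= G j) -> \sum_(i <- r) F i <= \sum_(j <- s) G j.
Proof.
move=> ur fI fs G0; rewrite big_seq.
apply: le_trans (_ : \sum_(i <- r) G (f i) <= _).
  by rewrite [leRHS]big_seq ler_sum // => i /fs[].
rewrite -(big_map f xpredT G) ler_sum_subset // ?map_inj_in_uniq //.
by move=> j /mapP[i /fs[fis _] ->].
Qed.

Lemma size_sum {I : Type} (r : seq I) : \sum_(i <- r) 1 = (size r)%:R :> R.
Proof. by rewrite big_const_seq count_predT; elim: size => //= n ->; rewrite mulrS. Qed.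

End sums_over_sequences.

(** * Uniform continuity in additive form *)

Section tame_functions.
Context {R : realType}.
Implicit Types (h k : R -> R) (e C x y : R).

(* Uniform continuity on [0, 1] in additive form, so that it can be summed
   along orbits. *)
Definition tame h := forall e, 0 < e -> exists2 C, 0 <= C &
  forall x y, 0 <= x <= 1 -> 0 <= y <= 1 -> `|h x - h y| <= e + C * `|x - y|.

Lemma tame_bounded h : tame h -> exists2 M, 0 <= M &
  forall x, 0 <= x <= 1 -> `|h x| <= M.
Proof.
move=> /(_ 1 ltr01)[C C0 hC]; exists (`|h 0| + 1 + C) => [|x x01].
  by rewrite !addr_ge0.
have := hC x 0 x01; rewrite lexx ler01 subr0 => /(_ erefl).
have := ler_normD (h 0) (h x - h 0); rewrite addrC subrK.
move: x01 => /andP[x0 x1]; rewrite (ger0_norm x0) => A B.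
have : C * x <= C by rewrite ler_piMr.
lra.
Qed.

Lemma tameD h k : tame h -> tame k -> tame (fun x => h x + k x).
Proof.
move=> th tk e e0; have e2 : 0 < e / 2 by rewrite divr_gt0.
have [C C0 hC] := th _ e2; have [D D0 kD] := tk _ e2.
exists (C + D) => [|x y x01 y01]; first exact: addr_ge0.
rewrite (_ : _ - _ = (h x - h y) + (k x - k y)); last by ring.
apply: le_trans (ler_normD _ _) _; have := hC x y x01 y01.
have := kD x y x01 y01; lra.
Qed.

Lemma tameZ a h : tame h -> tame (fun x => a * h x).
Proof.
move=> th e e0; have a0 : 0 < `|a| + 1 by rewrite ltr_wpDl.
have [C C0 hC] := th (e / (`|a| + 1)) (divr_gt0 e0 a0).
exists (`|a| * C) => [|x y x01 y01]; first by rewrite mulr_ge0.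
rewrite -mulrBr normrM; apply: le_trans (ler_wpM2l (normr_ge0 _) (hC x y x01 y01)) _.
by rewrite mulrDr [X in _ + X]mulrA lerD2r mulrA ler_pdivrMr // mulrC ler_pM2l // lerDl.
Qed.

Lemma tame_cst a : tame (fun=> a).
Proof. by move=> e e0; exists 0 => // x y _ _; rewrite subrr normr0 mul0r addr0 ltW. Qed.

Lemma eq_tame h k : tame h -> h =1 k -> tame k.
Proof. by move=> th hk; rewrite (_ : k = h) //; apply/funext => x; rewrite hk. Qed.

(** Near a point continuity gives the error [e]; pairs at a definite distance are handled by
    boundedness and a large constant. Compactness, used as a near-covering property with the
    constant tending to infinity, makes the constant uniform. *)
Lemma continuous_tame h : {within `[0, 1], continuous h} -> tame h.
Proof.
move=> hc e e0.
have [M hM] : exists M, forall x, x \in `[0, 1] -> `|h x| <= M.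
  have hc' : {within `[0, 1], continuous (fun x => - h x)}.
    by move=> x; apply: cvgN; exact: hc.
  have [a _ ha] := EVT_max (@ler01 R) hc; have [b _ hb] := EVT_max (@ler01 R) hc'.
  exists (`|h a| + `|h b|) => x x01; have := ha x x01; have := hb x x01.
  have := ler_norm (h a); have := ler_norm (- h b); rewrite normrN.
  have := normr_ge0 (h a); have := normr_ge0 (h b).
  by rewrite ler_norml => *; apply/andP; split; lra.
have M0 : 0 <= M by apply: le_trans (hM 0 _); rewrite // in_itv /= lexx ler01.
have hx : forall x, 0 <= x <= 1 -> exists2 d, 0 < d & forall y, 0 <= y <= 1 ->
    `|x - y| < d -> `|h x - h y| < e / 2.
  move=> x x01; have e2 : 0 < e / 2 by rewrite divr_gt0.
  have x01' : x \in `[0, 1]%classic by rewrite inE /= in_itv.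
  have /subspace_continuousP/(_ x (set_mem x01'))/(@cvgrPdist_lt _ R^o)/(_ _ e2) := hc.
  rewrite near_withinE => -[d /= d0 dP]; exists d => // y y01 xy.
  by apply: dP => //=; rewrite in_itv.
have := @segment_compact R 0 1 => /compact_near_coveringP.
move=> /(_ R +oo_R (fun C x => 0 <= x <= 1 -> forall y, 0 <= y <= 1 ->
   `|h x - h y| <= e + C * `|x - y|) _) [].
  move=> x; rewrite /= in_itv /= => x01; have [d d0 dP] := hx x x01.
  (* For [y] at distance at least [d] from [x], one has [|x' - y| >= d / 2], so a constant at least
     [4 * M / d] contributes at least [2 * M], which dominates any difference of values. *)
  exists (ball x (d / 2), [set C | 4 * M / d <= C]) => /=.
    split; first by apply: nbhsx_ballx; rewrite divr_gt0.
    by exists (4 * M / d); split; [rewrite num_real | move=> C /ltW].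
  move=> [x' C] /= [] xx' MC x'01 y y01.
  have C0 : 0 <= C by apply: le_trans MC; rewrite divr_ge0 ?(ltW d0) // mulr_ge0.
  have [xy|xy] := ltP `|x - y| d.
    have := dP y y01 xy; have : `|x - x'| < d by move: xx'; rewrite /ball /=; lra.
    move=> /(dP x' x'01) A B; have : 0 <= C * `|x' - y| by rewrite mulr_ge0.
    have := ler_normD (h x' - h x) (h x - h y); rewrite addrA subrK.
    rewrite distrC in A; lra.
  have x'y : d / 2 <= `|x' - y|.
    have := ler_normD (x - x') (x' - y); rewrite addrA subrK.
    move: xx'; rewrite /ball /=; lra.
  have : 4 * M / d * (d / 2) <= C * `|x' - y| by rewrite ler_pM // divr_ge0 ?mulr_ge0 ?(ltW d0).
  rewrite (_ : 4 * M / d * (d / 2) = 2 * M); last by field; rewrite gt_eqF.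
  have := hM x'; rewrite in_itv => /(_ x'01); have := hM y; rewrite in_itv => /(_ y01).
  have := ler_normB (h x') (h y); lra.
move=> C [_ CP]; pose D := `|C| + 1.
exists D; first by rewrite addr_ge0.
move=> x y x01 y01; have CD : C < D by have := ler_norm C; rewrite /D; lra.
by apply: (CP D CD) => //=; rewrite in_itv.
Qed.

End tame_functions.

(** * Counting full cylinders *)

Section counting.
Context {R : realType} (beta : R) (beta_gt1 : 1 < beta).
Local Notation T := (beta_map beta).
Local Notation full := (full beta).
Local Notation pow_gt0 := (pow_gt0 beta_gt1).
Local Notation powV_gt0 := (powV_gt0 beta_gt1).
Implicit Types (x y z c d h r : R) (n m i j : nat) (A B : seq R).

Definition count_ball A x r := count (fun c => `|c - x| <= r) A.

Lemma full_truncn_inj n x c d : full n c -> full n d -> x <= c -> x <= d ->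
  Num.truncn ((c - x) * beta ^+ n) = Num.truncn ((d - x) * beta ^+ n) -> c = d.
Proof.
move=> fc fd xc xd.
wlog cd : c d fc fd xc xd / c < d => [H E|].
  by have [cd|cd|//] := ltgtP c d; [apply: H | apply/esym/H].
have /truncn_itv/andP[ec _] : 0 <= (c - x) * beta ^+ n.
  by rewrite mulr_ge0 ?subr_ge0 // ltW // pow_gt0.
have /truncn_itv/andP[_ ed] : 0 <= (d - x) * beta ^+ n.
  by rewrite mulr_ge0 ?subr_ge0 // ltW // pow_gt0.
move=> E; rewrite E in ec.
have := full_sep beta_gt1 fc fd cd; rewrite -(ler_pM2r (pow_gt0 n)) mulrDl powVK // => H.
move: ec ed; by rewrite -natr1 !mulrBl; lra.
Qed.

(** Points of full cylinders of order [n] are separated by [beta ^- n], so the integer parts of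
    their rescaled positions in an interval of length [2 * r] are distinct. *)
Lemma count_full n A x r : uniq A -> {in A, forall c, full n c} -> 0 <= r ->
  (count_ball A x r)%:R <= 2 * r * beta ^+ n + 2.
Proof.
move=> uA fA r0; rewrite /count_ball -size_filter.
pose K := Num.truncn (2 * r * beta ^+ n).
have K0 : 0 <= 2 * r * beta ^+ n by rewrite !mulr_ge0 // ltW // pow_gt0.
pose f c := Num.truncn ((c - (x - r)) * beta ^+ n).
have inA c : c \in [seq c <- A | `|c - x| <= r] ->
    [/\ full n c, x - r <= c & c <= x + r].
  rewrite mem_filter ler_norml => /andP[/andP[h1 h2] /fA fc].
  by split => //; lra.
have : (size [seq c <- A | (`|c - x| <= r)%R] <= K.+1)%N.
  rewrite -(size_map f) -(size_iota 0 K.+1); apply: uniq_leq_size.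
    rewrite map_inj_in_uniq ?filter_uniq // => c d /inA[fc hc _] /inA[fd hd _].
    exact: full_truncn_inj.
  move=> _ /mapP[c /inA[fc hc hc'] ->].
  rewrite mem_iota /= add0n ltnS truncn_le_nat; apply: (le_lt_trans (y := 2 * r * beta ^+ n)).
    by rewrite ler_pM2r ?pow_gt0 //; lra.
  by case/andP: (truncn_itv K0).
rewrite -(ler_nat R) => /le_trans; apply; rewrite -natr1.
have : K%:R <= 2 * r * beta ^+ n by rewrite truncn_le.
lra.
Qed.

Lemma finite_full n : finite_set [set c | full n c].
Proof.
pose f c := Num.truncn ((c - 0) * beta ^+ n).
have fI : {in [set c | full n c] &, injective f}.
  move=> c d; rewrite !inE /= => fc fd; apply: (full_truncn_inj fc fd).
    by case: fc.
  by case: fd.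
rewrite -(eq_finite_set (inj_card_eq fI)).
apply: (@sub_finite_set _ _ `I_(Num.truncn (beta ^+ n)).+1); last exact: finite_II.
move=> _ [c fc <-] /=; rewrite ltnS /f le_truncn //.
have /andP[_ c1] := full_itv beta_gt1 fc.
by rewrite subr0 ler_piMl ?(ltW c1) // ltW // pow_gt0.
Qed.

Definition full_seq n : seq R := finmap.enum_fset (fset_set [set c | full n c]).

Lemma full_seq_uniq n : uniq (full_seq n).
Proof. exact: finmap.fset_uniq. Qed.

Lemma full_seqP n c : c \in full_seq n <-> full n c.
Proof.
by split; rewrite /full_seq (in_fset_set (finite_full n)) inE.
Qed.

Lemma size_full_seq_le n : (size (full_seq n))%:R <= 4 * beta ^+ n.
Proof.
have fA : {in full_seq n, forall c, full n c} by move=> c /full_seqP.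
have := count_full 0 (full_seq_uniq n) fA (@ler01 R).
rewrite /count_ball (eq_in_count (a2 := xpredT)); last first.
  move=> c /full_seqP/(full_itv beta_gt1)/andP[c0 /ltW c1] /=.
  by rewrite subr0 ger0_norm // c1.
rewrite count_predT => /le_trans; apply.
have : 1 <= beta ^+ n by rewrite exprn_ege1 // ltW.
lra.
Qed.

(** The data of [full_near_orbit] chosen as a function, so that its injectivity can be discussed. *)
Lemma full_near_fun : exists F : nat -> R -> R * nat, forall n x, 0 <= x <= 1 ->
  [/\ ((F n x).2 <= n)%N, full (F n x).2 (F n x).1,
  x = (F n x).1 + (0 < (F n x).2)%:R * beta ^- (F n x).2 + iter n T x * beta ^- n &
  \sum_(0 <= i < n) `|iter i T x - iter i T (F n x).1| <= 3 / (beta - 1)].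
Proof.
have /choice[F FP] (nx : nat * R) : exists cj : R * nat, 0 <= nx.2 <= 1 ->
  [/\ (cj.2 <= nx.1)%N, full cj.2 cj.1,
  nx.2 = cj.1 + (0 < cj.2)%:R * beta ^- cj.2 + iter nx.1 T nx.2 * beta ^- nx.1 &
  \sum_(0 <= i < nx.1) `|iter i T nx.2 - iter i T cj.1| <= 3 / (beta - 1)].
  case: nx => n x; have [x01|x01] := boolP (0 <= x <= 1); last by exists (0, 0%N).
  by have [c [j H]] := full_near_orbit beta_gt1 n x01; exists (c, j).
by exists (fun n x => F (n, x)) => n x /(FP (n, x)).
Qed.

(** The points [2 * i * beta ^- n] of [0, 1] have distinct pairs (c, j), since two points with the
    same pair are at distance at most [beta ^- n]. There are more than [beta ^+ n / 2] such points,
    and [n.+1] values of [j] for each [c]. *)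
Lemma size_full_seq_ge n : beta ^+ n <= 2 * n.+1%:R * (size (full_seq n))%:R.
Proof.
have [F FP] := full_near_fun.
pose K := Num.truncn (beta ^+ n / 2).
pose x i : R := 2 * i%:R * beta ^- n.
have half0 : 0 <= beta ^+ n / 2 by rewrite divr_ge0 // ltW // pow_gt0.
have x01 i : i \in iota 0 K.+1 -> 0 <= x i <= 1.
  rewrite mem_iota /= add0n ltnS => iK; rewrite /x !mulr_ge0 ?(ltW (powV_gt0 n)) //=.
  rewrite ler_pdivrMr ?pow_gt0 // mul1r.
  have : i%:R <= beta ^+ n / 2.
    by apply: le_trans (_ : K%:R <= _); rewrite ?ler_nat // truncn_le.
  lra.
have : \sum_(i <- iota 0 K.+1) 1 <=
    \sum_(cj <- [seq (c, j) | c <- full_seq n, j <- iota 0 n.+1]) 1 :> R.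
  apply: (ler_sum_injective (f := fun i => F n (x i))) => //.
  - exact: iota_uniq.
  - move=> i k /x01 xi /x01 xk E; have [_ _ ei _] := FP n _ xi; have [_ _ ek _] := FP n _ xk.
    rewrite E in ei; have /andP[ti0 ti1] := iter_beta_map_itv beta n xi.
    have /andP[tk0 tk1] := iter_beta_map_itv beta n xk.
    have : x i - x k =
        (iter n T (x i) - iter n T (x k)) * beta ^- n by lra.
    move: (iter n T (x i)) (iter n T (x k)) ti0 ti1 tk0 tk1 => u v u0 u1 v0 v1.
    move=> /(congr1 (fun z => z * beta ^+ n)).
    rewrite -[in RHS]mulrA powVK // mulr1 /x mulrBl -!mulrA powVK // !mulr1 => e.
    have [ik|ki|//] := ltngtP i k; exfalso.
      have : i%:R + 1 <= k%:R :> R by rewrite natr1 ler_nat.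
      lra.
    have : k%:R + 1 <= i%:R :> R by rewrite natr1 ler_nat.
    lra.
  - move=> i /x01 xi; have [jn fc _ _] := FP n _ xi; split=> //.
    apply/allpairsP; exists (F n (x i)); split; last by case: (F n _).
      by apply/full_seqP; exact: full_ext jn fc.
    by rewrite mem_iota.
rewrite !size_sum size_iota size_allpairs size_iota natrM.
have /andP[_] := truncn_itv half0; rewrite -/K; lra.
Qed.

End counting.

(** * Concatenation of full words and bounded distortion *)

Section concatenation.
Context {R : realType} (beta : R) (beta_gt1 : 1 < beta).
Local Notation T := (beta_map beta).
Local Notation full := (full beta).
Local Notation S := (birkhoff beta).
Local Notation pow_gt0 := (pow_gt0 beta_gt1).
Local Notation powV_gt0 := (powV_gt0 beta_gt1).
Implicit Types (x y z c d h r : R) (n m i j : nat) (A B : seq R).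

Definition compseq n A B : seq R := [seq a + b * beta ^- n | a <- A, b <- B].

Lemma size_compseq n A B : size (compseq n A B) = (size A * size B)%N.
Proof. exact: size_allpairs. Qed.

Lemma mem_compseq n A B c : c \in compseq n A B ->
  exists a b, [/\ a \in A, b \in B & c = a + b * beta ^- n].
Proof. by move=> /allpairsP[[a b] [/= aA bB ->]]; exists a, b. Qed.

Lemma compseq_full n m A B : {in A, forall c, full n c} ->
  {in B, forall c, full m c} -> {in compseq n A B, forall c, full (n + m) c}.
Proof.
move=> fA fB _ /mem_compseq[a [b [/fA fa /fB fb ->]]].
exact: full_comp.
Qed.

(** T^n recovers [b] from [a + b * beta ^- n], and then [a] is determined. *)
Lemma compseq_uniq n A B : uniq A -> uniq B -> {in A, forall c, full n c} ->
  {in B, forall b, 0 <= b < 1} -> uniq (compseq n A B).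
Proof.
move=> uA uB fA B01; apply: allpairs_uniq => // -[a b] [a' b'].
move=> /allpairsP[[? ?] /= [aA bB [-> ->]]] /allpairsP[[? ?] /= [aA' bB' [-> ->]]] E.
have := full_iter (n := n) beta_gt1 0 (fA _ aA) (B01 _ bB); rewrite E.
rewrite (full_iter (n := n) beta_gt1 0 (fA _ aA') (B01 _ bB')) /= => e.
by move: E; rewrite e => /addIr->.
Qed.

Lemma compseqA n m A B C :
  compseq n A (compseq m B C) = compseq (n + m) (compseq n A B) C.
Proof.
rewrite /compseq; elim: A => //= a A IHA; rewrite map_cat flatten_cat IHA; congr (_ ++ _).
elim: B {IHA} => //= b B IHB; rewrite map_cat IHB; congr (_ ++ _).
rewrite -map_comp; apply: eq_map => c /=.
by rewrite powVD mulrDl addrA; ring.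
Qed.

Lemma compseq01 A : compseq 0 [:: 0] A = A.
Proof.
rewrite /compseq /= cats0 -[RHS]map_id; apply: eq_map => c.
by rewrite add0r expr0 invr1 mulr1.
Qed.

(** A ball of radius at most [beta ^- n] only sees the cylinders of points of [A] within
    [2 * beta ^- n] of its centre. By [count_full] these number at most 2 * 2 + 2 = 6, and each
    contributes a rescaled ball count in [B]. *)
Lemma count_compseq n A B x r (D : nat) : uniq A -> {in A, forall c, full n c} ->
  {in B, forall b, 0 <= b <= 1} -> 0 <= r <= beta ^- n ->
  (forall y, count_ball B y (r * beta ^+ n) <= D)%N ->
  (count_ball (compseq n A B) x r <= 6 * D)%N.
Proof.
move=> uA fA B01 /andP[r0 rn] BD.
have : (count_ball (compseq n A B) x r <= count_ball A x (2 * beta ^- n) * D)%N.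
  elim: A {uA fA} => //= a A IHA; rewrite {1}/count_ball count_cat mulnDl leq_add //.
  rewrite count_map; case: (leP `|a - x| _) => ax /=.
    rewrite mul1n; apply: leq_trans (BD ((x - a) * beta ^+ n)).
    apply: sub_count => b /= H.
    have e : (a + b * beta ^- n - x) * beta ^+ n =
      b * (beta ^- n * beta ^+ n) - (x - a) * beta ^+ n by ring.
    rewrite powVK // mulr1 in e; rewrite -e normrM (ger0_norm (ltW (pow_gt0 n))).
    by rewrite ler_pM2r ?pow_gt0.
  rewrite mul0n leqn0 -leqn0 leqNgt -has_count; apply/negP => /hasP[b bB /= H].
  have /andP[b0 b1] := B01 b bB.
  have : 0 <= b * beta ^- n <= beta ^- n.
    by rewrite mulr_ge0 ?(ltW (powV_gt0 n)) //= ler_piMl // ltW ?powV_gt0.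
  by move: ax H rn; rewrite lter_norml ltr_normr => /orP[] *; lra.
move=> /leq_trans; apply; rewrite leq_mul2r; apply/orP; right.
rewrite -(ler_nat R); apply: le_trans (count_full beta_gt1 x uA fA _) _.
  by rewrite mulr_ge0 // ltW ?powV_gt0.
by rewrite -!mulrA powVK //; lra.
Qed.

(** By [full_near_orbit], [x] is within [beta ^- n] of the right end of a full cylinder of order [j]
    (of its left end if [j] is 0). That right end is the image of 1 under the inverse branch, so it
    suffices to approximate 1 by a full cylinder of the smaller order [n - j] and to compose. *)
Lemma full_dense n x : 0 <= x <= 1 ->
  exists2 c, full n c & `|x - c| <= n.+1%:R * beta ^- n.
Proof.
elim/ltn_ind: n x => n IHn x x01.
have [c [j [jn fc xE _]]] := full_near_orbit beta_gt1 n x01.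
have /andP[t0 t1] := iter_beta_map_itv beta n x01.
move: (iter n T x) t0 t1 xE => t t0 t1 xE; have n0 := powV_gt0 n.
have tn : 0 <= t * beta ^- n <= beta ^- n.
  by rewrite mulr_ge0 ?(ltW n0) //= ler_piMl // ltW.
have n1 : 1 <= n.+1%:R :> R by rewrite ler1n.
case: j jn fc xE => [|j] jn fc xE.
  exists c; first exact: full_ext fc.
  rewrite mul0r addr0 in xE; rewrite xE addrC addKr.
  have : beta ^- n <= n.+1%:R * beta ^- n by rewrite ler_peMl // ltW.
  by case/andP: tn => tn0 tn1; rewrite ger0_norm //; lra.
rewrite mul1r in xE.
have nj : (n - j.+1 < n)%N by rewrite ltn_subrL /= (leq_trans _ jn).
have [|d fd d1] := IHn _ nj 1; first by rewrite ler01 lexx.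
exists (c + d * beta ^- j.+1); first by rewrite -(subnKC jn); exact: full_comp.
rewrite (_ : x - _ = (1 - d) * beta ^- j.+1 + t * beta ^- n); last first.
  by rewrite {1}xE; ring.
apply: le_trans (ler_normD _ _) _; rewrite normrM (ger0_norm (ltW (powV_gt0 _))).
case/andP: tn => tn0 tn1; rewrite (ger0_norm tn0).
apply: le_trans (_ : (n - j.+1).+1%:R * beta ^- n + beta ^- n <= _).
  apply: lerD => //; rewrite -[X in _ * beta ^- X](subnK jn) powVD mulrA.
  by rewrite ler_pM2r // powV_gt0.
rewrite -[X in _ + X]mul1r -mulrDl ler_pM2r // natr1 ler_nat ltnS.
by rewrite ltn_subrL /= (leq_trans _ jn).
Qed.

(* c + beta^-n < 1 keeps the closed cylinder of c inside [0, 1) *)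
Lemma full_proper_dense n x : (0 < n)%N -> 0 <= x <= 1 ->
  exists c, [/\ full n c, c + beta ^- n < 1 & forall y, 0 <= y < 1 ->
    `|c + y * beta ^- n - x| <= beta * n.+1%:R * beta ^- n].
Proof.
case: n => // n _ x01; have [c fc xc] := full_dense n x01.
have n0 := powV_gt0 n.+1.
(* The point comes from the order one lower. The appended zero shortens the cylinder by the factor
   [beta], which leaves room before 1 and costs the factor [beta] in the distance. *)
exists c; split; first exact: full_ext fc.
  have [_ cn _ _] := fc; apply: lt_le_trans cn; rewrite ltrD2l.
  by rewrite (powVS beta_gt1 n) ltr_pMl.
move=> y /andP[y0 y1]; rewrite -addrA [_ - x]addrC addrA.
apply: le_trans (ler_normD _ _) _; rewrite [`|c - x|]distrC.
apply: le_trans (lerD xc (lexx _)) _; rewrite ger0_norm ?mulr_ge0 ?(ltW n0) //.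
have : y * beta ^- n.+1 <= beta * beta ^- n.+1.
  by rewrite ler_pM2r // ltW // (lt_trans y1).
by rewrite (powVS beta_gt1 n) -[n.+2%:R]natr1; lra.
Qed.

Lemma birkhoffD n m (h : R -> R) x : S (n + m) h x = S n h x + S m h (iter n T x).
Proof.
rewrite /birkhoff (@big_cat_nat _ _ _ n) ?leq_addr //=; congr (_ + _).
rewrite -{1}[n]add0n big_addn addKn; apply: eq_bigr => i _.
by rewrite iterD.
Qed.

Lemma birkhoff_bound n (h : R -> R) M x : (forall z, 0 <= z <= 1 -> `|h z| <= M) ->
  0 <= x <= 1 -> `|S n h x| <= n%:R * M.
Proof.
move=> hM x01; rewrite /birkhoff; elim: n => [|n IHn].
  by rewrite big_nil normr0 mul0r.
rewrite big_nat_recr //= -natr1 mulrDl mul1r.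
by apply: le_trans (ler_normD _ _) _; rewrite lerD // hM // iter_beta_map_itv.
Qed.

Lemma le_birkhoff n (h k : R -> R) x y : 0 <= x <= 1 -> 0 <= y <= 1 ->
  (forall a b, 0 <= a <= 1 -> 0 <= b <= 1 -> h a <= k b) -> S n h x <= S n k y.
Proof.
by move=> x01 y01 hk; apply: ler_sum => i _; apply: hk; exact: iter_beta_map_itv.
Qed.

(** Summing the tame inequality along two orbits adds up the errors [e] to [n%:R * e], while the
    Lipschitz-like part is controlled by the total distance of the orbits, independently of [n]. *)
Lemma birkhoff_distortion (h : R -> R) e : tame h -> 0 < e ->
  exists2 K, 0 <= K & forall n x y, 0 <= x <= 1 -> 0 <= y <= 1 ->
    \sum_(0 <= i < n) `|iter i T x - iter i T y| <= 3 / (beta - 1) ->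
    `|S n h x - S n h y| <= n%:R * e + K.
Proof.
move=> /[apply] -[C C0 hC]; exists (C * (3 / (beta - 1))).
  by rewrite mulr_ge0 // divr_ge0 // subr_ge0 ltW.
move=> n x y x01 y01 H.
apply: le_trans (_ : n%:R * e + C * \sum_(0 <= i < n) `|iter i T x - iter i T y| <= _); last first.
  by rewrite lerD2l ler_wpM2l.
rewrite /birkhoff; elim: n {H} => [|n IHn].
  by rewrite !big_nil subr0 normr0 mul0r mulr0 addr0.
rewrite !big_nat_recr //= -natr1 mulrDl mulrDr mul1r opprD addrACA.
apply: le_trans (ler_normD _ _) _; rewrite addrACA lerD // hC //.
  exact: iter_beta_map_itv.
exact: iter_beta_map_itv.
Qed.

(** The series is at most 1 / (beta - 1); the constant 3 only matches the hypothesis of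
    [birkhoff_distortion]. *)
Lemma sum_geo_le n d : 0 <= d -> d * beta ^+ n <= 1 ->
  \sum_(0 <= i < n) d * beta ^+ i <= 3 / (beta - 1).
Proof.
move=> d0 dn; have b1 : 0 < beta - 1 by rewrite subr_gt0.
rewrite -mulr_sumr big_mkord ler_pdivlMr //.
rewrite (_ : _ * (beta - 1) = d * ((beta - 1) * \sum_(i < n) beta ^+ i)); last by ring.
by rewrite -subrX1 mulrBr mulr1; lra.
Qed.

Lemma full_orbit_dist n c y : full n c -> 0 <= y < 1 ->
  \sum_(0 <= i < n) `|iter i T (c + y * beta ^- n) - iter i T c| <= 3 / (beta - 1).
Proof.
move=> [_ _ _ fc] /andP[y0 y1]; have n0 := powV_gt0 n.
have yn0 : 0 <= y * beta ^- n by rewrite mulr_ge0 // ltW.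
rewrite (eq_big_nat _ _ (F2 := fun i => y * beta ^- n * beta ^+ i)) ?sum_geo_le //.
  by rewrite -mulrA powVK // mulr1 ltW.
move=> i /andP[_ /ltnW i_n]; rewrite fc //; last by rewrite -[ltRHS]mul1r ltr_pM2r.
by rewrite addrC addKr ger0_norm // mulr_ge0 // ltW ?pow_gt0.
Qed.

Lemma full_point_itv n c y : full n c -> 0 <= y < 1 -> 0 <= c + y * beta ^- n < 1.
Proof.
move=> [c0 cn _ _] /andP[y0 y1]; have n0 := powV_gt0 n.
have : 0 <= y * beta ^- n by rewrite mulr_ge0 // ltW.
have : y * beta ^- n < beta ^- n by rewrite -[ltRHS]mul1r ltr_pM2r.
by move=> *; apply/andP; split; lra.
Qed.

End concatenation.

(** * Pressure as a growth rate over full cylinders *)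

Section growth.
Context {R : realType}.
Implicit Types (e C L : R) (a : nat -> R).

(** Squaring 1 + t <= exp t at t = e n / 2 gives quadratic growth on the right. *)
Lemma near_linear_le_expR C e : 0 < e ->
  \forall n \near \oo, C * n.+1%:R <= expR (e * n%:R).
Proof.
move=> e0; near=> n.
have ne : 8 * `|C| / (e * e) <= n%:R by near: n; exact: nbhs_infty_ger.
have n1 : 1 <= n%:R :> R by near: n; exact: nbhs_infty_ger.
have ee : 0 < e * e by rewrite mulr_gt0.
have : 8 * `|C| <= n%:R * (e * e) by rewrite -ler_pdivrMr.
rewrite (_ : e * n%:R = e * n%:R / 2 + e * n%:R / 2); last by field.
have en : 0 <= e * n%:R / 2 by rewrite divr_ge0 // mulr_ge0 // ltW.
have E := expR_ge1Dx (e * n%:R / 2); rewrite expRD.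
move=> /(ler_wpM2r (ler0n R n)) H.
have E2 : e * n%:R / 2 * (e * n%:R / 2) <= expR (e * n%:R / 2) * expR (e * n%:R / 2).
  by apply: ler_pM => //; lra.
have : C * n.+1%:R <= `|C| * n.+1%:R by rewrite ler_wpM2r // ler_norm.
have : 0 <= `|C| * (n%:R - 1) by rewrite mulr_ge0 // subr_ge0.
rewrite -natr1; lra.
Unshelve. all: by end_near.
Qed.

(** A version of Fekete's lemma with an error linear in the first index. One block length [N] whose
    slope is almost the upper limit is repeated; it is taken so large that the constant [K] costs
    little per block. *)
Lemma almost_superadditive_cvg a B : (forall n, `|a n| <= B * n.+1%:R) ->
  (forall e, 0 < e -> exists K, forall n m, a n + a m - n%:R * e - K <= a (n + m)%N) ->
  exists L, forall e, 0 < e -> \forall n \near \oo, `|a n - n%:R * L| <= n%:R * e.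
Proof.
(* [A] collects the eventual upper slopes, so its infimum is the upper limit of [a n / n]. *)
move=> aB aS; pose A := [set l | \forall n \near \oo, a n <= n%:R * l].
have B0 : 0 <= B by have := aB 0%N; rewrite mulr1; apply: le_trans.
have A0 : A !=set0.
  exists (2 * B); near=> n; have n1 : 1 <= n%:R :> R by near: n; exact: nbhs_infty_ger.
  have := aB n; have := ler_norm (a n); have : 0 <= B * (n%:R - 1).
    by rewrite mulr_ge0 // subr_ge0.
  rewrite -natr1; lra.
have Alb : lbound A (- (2 * B)).
  move=> l /= lA; rewrite leNgt; apply/negP => lB.
  suff : \forall n \near \oo, False by move=> /filter_ex[].
  near=> n; have n1 : 1 <= n%:R :> R by near: n; exact: nbhs_infty_ger.
  have : a n <= n%:R * l by near: n.
  have := aB n; have := ler_norm (- a n); rewrite normrN; have : 0 <= B * (n%:R - 1).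
    by rewrite mulr_ge0 // subr_ge0.
  have : n%:R * l < n%:R * (- (2 * B)) by rewrite ltr_pM2l //; lra.
  rewrite -natr1; lra.
exists (inf A) => e e0; set L := inf A.
have hA : has_inf A by split=> //; exists (- (2 * B)).
have [l lA lL] := inf_adherent e0 hA.
have e4 : 0 < e / 4 by rewrite divr_gt0.
have nA : ~ A (L - e / 4).
  by move=> H; have := ge_inf (ex_intro _ _ Alb) H; rewrite -/L; lra.
have [K KS] := aS _ e4.
have [N [N1 NK aN]] : exists N, [/\ 1 <= N%:R :> R, K <= N%:R * (e / 4) &
    N%:R * (L - e / 4) < a N].
  apply: contrapT => H; apply: nA; near=> n; rewrite leNgt; apply/negP => an.
  apply: H; exists n; split => //; first by near: n; exact: nbhs_infty_ger.
  by rewrite -ler_pdivrMr //; near: n; exact: nbhs_infty_ger.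
(* Each block loses three times [N%:R * (e / 4)]: from the choice of [N], from the linear error, and
   from [K]. *)
have aq q r : q%:R * (N%:R * (L - 3 * (e / 4))) + a r <= a (q * N + r)%N.
  elim: q => [|q IHq]; first by rewrite mul0r add0r.
  rewrite mulSn -addnA -natr1 mulrDl; have := KS N (q * N + r)%N; lra.
pose c := N%:R * `|L - 3 * (e / 4)| + B * N.+1%:R.
near=> n.
have nc : c <= n%:R * (e / 4).
  by rewrite -ler_pdivrMr //; near: n; exact: nbhs_infty_ger.
have n0 : 0 <= n%:R :> R by [].
have an : a n <= n%:R * l by near: n.
have : n%:R * l <= n%:R * (L + e) by rewrite ler_wpM2l // ltW.
suff : n%:R * (L - e) <= a n by rewrite ler_norml => *; apply/andP; split; lra.
have N0 : (0 < N)%N by rewrite -(ler_nat R).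
have := aq (n %/ N)%N (n %% N)%N; rewrite -divn_eq; apply: le_trans.
have nE : n%:R = (n %/ N)%:R * N%:R + (n %% N)%:R :> R.
  by rewrite -natrM -natrD -divn_eq.
have rN : (n %% N)%:R <= N%:R :> R by rewrite ler_nat ltnW // ltn_mod.
set r := (n %% N)%N in nE rN *; set q := (n %/ N)%N in nE *.
have ar : - (B * N.+1%:R) <= a r.
  have : B * r.+1%:R <= B * N.+1%:R by rewrite ler_wpM2l // -!natr1 lerD2r.
  by have := ler_norm (- a r); rewrite normrN; have := aB r; lra.
have rL : r%:R * (L - 3 * (e / 4)) <= N%:R * `|L - 3 * (e / 4)|.
  by apply: le_trans (ler_wpM2l (ler0n _ _) (ler_norm _)) _; rewrite ler_wpM2r.
have qN : q%:R * (N%:R * (L - 3 * (e / 4))) = (n%:R - r%:R) * (L - 3 * (e / 4)).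
  by rewrite nE; ring.
rewrite qN; move: nc; rewrite /c; lra.
Unshelve. all: by end_near.
Qed.

End growth.

(** * Pressure computed from full cylinders only *)

Section pressure.
Context {R : realType} (beta : R) (beta_gt1 : 1 < beta).
Local Notation T := (beta_map beta).
Local Notation full := (full beta).
Local Notation S := (birkhoff beta).
Local Notation pow_gt0 := (pow_gt0 beta_gt1).
Local Notation powV_gt0 := (powV_gt0 beta_gt1).
Local Notation full_seq := (full_seq beta).
Implicit Types (x y z c d e : R) (h : R -> R) (n m i j : nat).

Definition full_sum n h : R := \sum_(c <- full_seq n) expR (S n h c).

Lemma full_seq_itv n c : c \in full_seq n -> 0 <= c <= 1.
Proof.
by move=> /(full_seqP beta_gt1)/(full_itv beta_gt1)/andP[-> /ltW ->].
Qed.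

Lemma full_sum_gt0 n h : 0 < full_sum n h.
Proof.
apply: lt_le_trans (_ : \sum_(c <- [:: 0 : R]) expR (S n h c) <= _).
  by rewrite big_seq1 expR_gt0.
apply: ler_sum_subset => [//|c|c]; last exact: expR_ge0.
by rewrite inE => /eqP->; apply/(full_seqP beta_gt1); exact: full_zero.
Qed.

(** Concatenation injects pairs of full words into full words of length [n + m], and Birkhoff sums
    add up to the distortion on the first [n] steps. *)
Lemma full_sum_superadditive h e : tame h -> 0 < e -> exists K, forall n m,
  ln (full_sum n h) + ln (full_sum m h) - n%:R * e - K <= ln (full_sum (n + m) h).
Proof.
move=> th e0; have [K K0 hK] := birkhoff_distortion beta_gt1 th e0.
exists K => n m.
rewrite -lnM ?posrE ?full_sum_gt0 // -addrA -opprD.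
rewrite -[X in _ + X <= _]expRK.
rewrite -lnM ?posrE ?mulr_gt0 ?full_sum_gt0 ?expR_gt0 //.
rewrite ler_ln ?posrE ?mulr_gt0 ?full_sum_gt0 ?expR_gt0 //.
rewrite /full_sum big_distrlr /= mulr_suml.
under [X in X <= _]eq_bigr => c _ do rewrite mulr_suml.
rewrite -(big_allpairs (F := fun cd : R * R =>
  expR (S n h cd.1) * expR (S m h cd.2) * expR (- (n%:R * e + K)))).
apply: (ler_sum_injective (f := fun cd : R * R => cd.1 + cd.2 * beta ^- n)).
- by apply: allpairs_uniq => [||[? ?] [? ?] //]; exact: full_seq_uniq.
- move=> [c d] [c' d'] /allpairsP[[? ?] /= [cn dm [-> ->]]].
  move=> /allpairsP[[? ?] /= [cn' dm' [-> ->]]] E.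
  move: cn cn' dm dm' => /(full_seqP beta_gt1) fc /(full_seqP beta_gt1) fc'.
  move=> /(full_seqP beta_gt1) fd /(full_seqP beta_gt1) fd'.
  have := full_iter beta_gt1 0 fc (full_itv beta_gt1 fd); rewrite E.
  rewrite (full_iter beta_gt1 0 fc' (full_itv beta_gt1 fd')) /= => e'.
  by move: E; rewrite e' => /addIr->.
- move=> [c d] /allpairsP[[? ?] /= [cn dm [-> ->]]].
  move: cn dm => /(full_seqP beta_gt1) fc /(full_seqP beta_gt1) fd.
  split; first by apply/(full_seqP beta_gt1)/full_comp.
  rewrite -!expRD ler_expR birkhoffD (full_iter beta_gt1 0 fc (full_itv beta_gt1 fd)) /=.
  have d01 := full_itv beta_gt1 fd.
  have /andP[c0 /ltW c1] := full_itv beta_gt1 fc.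
  have /andP[x0 /ltW x1] := full_point_itv beta_gt1 fc d01.
  have := hK n _ _ _ _ (full_orbit_dist beta_gt1 fc d01).
  rewrite x0 x1 c0 c1 => /(_ erefl erefl); rewrite ler_norml => /andP[+ _]; lra.
- by move=> c; exact: expR_ge0.
Qed.

Lemma ln_full_sum_bound h : tame h -> exists B, forall n, `|ln (full_sum n h)| <= B * n.+1%:R.
Proof.
move=> /tame_bounded[M M0 hM]; exists (ln 4 + ln beta + M) => n.
have l4 : 0 <= ln 4 :> R by rewrite ln_ge0 //; lra.
have lb : 0 <= ln beta by rewrite ln_ge0 // ltW.
have n0 : 0 <= n%:R :> R by [].
have H : 0 <= n%:R * ln 4 :> R by rewrite mulr_ge0.
have H' : 0 <= n%:R * ln beta :> R by rewrite mulr_ge0.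
have H'' : 0 <= n%:R * M by rewrite mulr_ge0.
have lo : expR (- (n%:R * M)) <= full_sum n h.
  apply: le_trans (_ : \sum_(c <- [:: 0 : R]) expR (S n h c) <= _).
    rewrite big_seq1 ler_expR; have : (0 <= 0 :> R) && (0 <= 1 :> R) by rewrite lexx ler01.
    by move=> /(birkhoff_bound beta n hM); rewrite ler_norml => /andP[].
  apply: ler_sum_subset => [//|c|c]; last exact: expR_ge0.
  by rewrite inE => /eqP->; apply/(full_seqP beta_gt1); exact: full_zero.
have up : full_sum n h <= expR (ln 4 + n%:R * ln beta + n%:R * M).
  apply: le_trans (_ : \sum_(c <- full_seq n) expR (n%:R * M) <= _).
    rewrite /full_sum big_seq [leRHS]big_seq; apply: ler_sum => c /full_seq_itv c01.
    rewrite ler_expR; have := birkhoff_bound beta n hM c01.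
    by rewrite ler_norml => /andP[].
  rewrite -[expR _]mulr1 -mulr_sumr size_sum expRD mulrC ler_pM2r ?expR_gt0 //.
  rewrite expRD lnK ?posrE // expRM_natl lnK ?posrE ?(lt_trans _ beta_gt1) //.
  exact: size_full_seq_le.
move: lo up; rewrite -ler_ln ?posrE ?full_sum_gt0 ?expR_gt0 // expRK => lo.
rewrite -ler_ln ?posrE ?full_sum_gt0 ?expR_gt0 // expRK => up.
by rewrite ler_norml -[n.+1%:R]natr1; apply/andP; split; lra.
Qed.

Lemma in_itvco01 x : (x \in `[0, 1[) = (0 <= x < 1).
Proof. by rewrite in_itv. Qed.

(** Two points with the same pair (c, j) differ by (T^n x - T^n z) beta^-n, so the lower one stays
    in the cylinder of the upper one by [iter_beta_map_below]. This is why a full word has few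
    preimages. *)
Lemma full_near_word n x z : 0 <= x < 1 -> 0 <= z < 1 -> forall c j,
  x = c + (0 < j)%:R * beta ^- j + iter n T x * beta ^- n ->
  z = c + (0 < j)%:R * beta ^- j + iter n T z * beta ^- n ->
  forall i, (i < n)%N -> Num.floor (beta * iter i T x) = Num.floor (beta * iter i T z).
Proof.
move=> + + c j; wlog xz : x z / iter n T z <= iter n T x => [H x01 z01 xE zE i i_n|].
  have [xz|/ltW xz] := leP (iter n T z) (iter n T x); first exact: H xz _ _ _ _ i i_n.
  by apply/esym; exact: (H _ _ xz z01 x01 zE xE i i_n).
move=> /andP[x0 x1] /andP[z0 z1] xE zE i i_n.
have E : x - z = (iter n T x - iter n T z) * beta ^- n.
  by move: xE zE; move: (iter n T x) (iter n T z) => u v ? ?; lra.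
apply/esym; apply: (proj2 (iter_beta_map_below beta_gt1 (n := n) x0 _ _ (ltnW i_n))) => //.
  by rewrite E mulr_ge0 ?subr_ge0 // ltW // powV_gt0.
by rewrite E -mulrA powVK // mulr1 gerBl iter_beta_map_ge0.
Qed.

Lemma same_word_dist n x z : 0 <= x < 1 -> 0 <= z < 1 ->
  (forall i, (i < n)%N -> Num.floor (beta * iter i T x) = Num.floor (beta * iter i T z)) ->
  (forall i, (i <= n)%N -> iter i T x - iter i T z = (x - z) * beta ^+ i) /\
  \sum_(0 <= i < n) `|iter i T x - iter i T z| <= 3 / (beta - 1).
Proof.
move=> /andP[x0 x1] /andP[z0 z1] xz.
have dist : forall i, (i <= n)%N -> iter i T x - iter i T z = (x - z) * beta ^+ i.
  elim=> [|i IHi] i_n; first by rewrite mulr1.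
  rewrite !iterS /beta_map xz // exprS; have := IHi (ltnW i_n).
  by move=> /(congr1 ( *%R beta)); rewrite mulrBr => E; rewrite opprB addrA subrK E; ring.
split => //.
rewrite (eq_big_nat _ _ (F2 := fun i => `|x - z| * beta ^+ i)); last first.
  move=> i /andP[_ /ltnW i_n]; rewrite dist // normrM [`|beta ^+ i|]ger0_norm //.
  by rewrite ltW // pow_gt0.
apply: sum_geo_le => //; rewrite -[beta ^+ n]ger0_norm ?(ltW (pow_gt0 _)) // -normrM -dist //.
have := iter_beta_map_ge0 beta n x0; have := iter_beta_map_lt1 beta n x1.
have := iter_beta_map_ge0 beta n z0; have := iter_beta_map_lt1 beta n z1.
by rewrite ler_norml => *; apply/andP; split; lra.
Qed.

Local Notation adm n := (@admissible R beta n).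

Definition word n x : n.-tuple int := [tuple digit beta j.+1 x | j < n].

Lemma cylinder_word n x : x \in `[0, 1[ -> cylinder beta (word n x) x.
Proof. by move=> x01; split => // j; rewrite tnth_mktuple. Qed.

Lemma cylinderP n (w : n.-tuple int) x z : cylinder beta w x -> cylinder beta w z ->
  [/\ 0 <= x < 1, 0 <= z < 1 & forall i, (i < n)%N ->
    Num.floor (beta * iter i T x) = Num.floor (beta * iter i T z)].
Proof.
move=> [x01 xw] [z01 zw]; split => [||i i_n]; [by rewrite in_itv in x01|by rewrite in_itv in z01|].
by have := xw (Ordinal i_n); rewrite -(zw (Ordinal i_n)).
Qed.

(** The partition function whose logarithm occurs in [pressure]. *)
Definition word_sum n h : R := \sum_(w \in adm n)
  sup [set expR (S n h y) | y in cylinder beta w].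

(** A word is sent to the pair (c, j) of a chosen point of its cylinder. Injectivity is
    [full_near_word], and since [j <= n] at most [n.+1] words share the same [c]. *)
Lemma admissible_near_fun n : exists f : n.-tuple int -> R * nat,
  (forall w, adm n w -> exists2 x, cylinder beta w x &
    [/\ ((f w).2 <= n)%N, full n (f w).1 &
     \sum_(0 <= i < n) `|iter i T x - iter i T (f w).1| <= 3 / (beta - 1)]) /\
  {in adm n &, injective f}.
Proof.
have [F FP] := full_near_fun beta_gt1.
have /choice[X XP] (w : n.-tuple int) : exists x, adm n w -> cylinder beta w x.
  have [[x wx]|nw] := pselect (adm n w); first by exists x.
  by exists 0.
exists (fun w => F n (X w)); split => [w /XP wX|w v].
  exists (X w) => //; have [/[!in_itvco01] /andP[x0 /ltW x1] _] := wX.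
  have [|jn fc _ H] := FP n (X w); first by rewrite x0 x1.
  by split => //; exact: full_ext fc.
rewrite !inE => /XP wX /XP vX E.
have [/[!in_itvco01] w01 _] := wX; have [/[!in_itvco01] v01 _] := vX.
have [|_ _ ew _] := FP n (X w); first by case/andP: w01 => -> /ltW.
have [|_ _ ev _] := FP n (X v); first by case/andP: v01 => -> /ltW.
rewrite E in ew; have H := full_near_word w01 v01 ew ev.
apply: eq_from_tnth => i; have [_ <-] := wX; have [_ <-] := vX.
exact: H (ltn_ord i).
Qed.

Lemma finite_admissible n : finite_set (adm n).
Proof.
have [f [fP fI]] := admissible_near_fun n.
rewrite -(eq_finite_set (inj_card_eq fI)).
apply: sub_finite_set (finite_seq [seq (c, j) | c <- full_seq n, j <- iota 0 n.+1]).
move=> _ [w /fP[x _ [jn fc _]] <-].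
rewrite /mkset; apply/allpairsP; exists (f w).
by split; [exact/(full_seqP beta_gt1)|rewrite mem_iota|case: (f w)].
Qed.

Lemma sup_ge0 (E : set R) : (forall x, E x -> 0 <= x) -> 0 <= sup E.
Proof.
move=> E0; have [[[x Ex] ubE]|nE] := pselect (has_sup E); last by rewrite sup_out.
by apply: le_trans (E0 _ Ex) _; exact: ub_le_sup.
Qed.

(** Distinct full cylinders have distinct words, and each supremum is at least the value at the left
    end point. *)
Lemma full_sum_le_word_sum n h : tame h -> full_sum n h <= word_sum n h.
Proof.
move=> /tame_bounded[M M0 hM].
rewrite /word_sum (fsbig_finite _ _ (finite_admissible n)).
apply: (ler_sum_injective (f := word n)).
- exact: full_seq_uniq.
- move=> c d /(full_seqP beta_gt1) fc /(full_seqP beta_gt1) fd E.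
  have c01 : c \in `[0, 1[ by rewrite in_itv; exact: full_itv fc.
  have d01 : d \in `[0, 1[ by rewrite in_itv; exact: full_itv fd.
  have := cylinder_word n d01; rewrite -E => /(cylinderP (cylinder_word n c01))[? ? H].
  have [/(_ n (leqnn n))] := same_word_dist (full_itv beta_gt1 fc) (full_itv beta_gt1 fd) H.
  case: fc fd => _ _ -> _ [_ _ -> _]; rewrite subr0 => /esym/eqP.
  by rewrite mulf_eq0 (gt_eqF (pow_gt0 n)) orbF subr_eq0 => /eqP.
- move=> c /(full_seqP beta_gt1) fc.
  have c01 : c \in `[0, 1[ by rewrite in_itv; exact: full_itv fc.
  split; first by rewrite (in_fset_set (finite_admissible n)) inE; exists c; exact: cylinder_word.
  apply: ub_le_sup; last by exists c => //; exact: cylinder_word.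
  exists (expR (n%:R * M)) => _ [y [/[!in_itvco01] /andP[y0 /ltW y1] _] <-].
  rewrite ler_expR; have := birkhoff_bound beta n hM (x := y).
  by rewrite y0 y1 => /(_ erefl); rewrite ler_norml => /andP[].
- by move=> w; apply: sup_ge0 => _ [y _ <-]; exact: expR_ge0.
Qed.

(** Distortion is paid twice with [e / 2]: from a point of the cylinder to the chosen one, then from
    the chosen one to its full word. *)
Lemma word_sum_le_full_sum h e : tame h -> 0 < e -> exists2 K, 0 <= K & forall n,
  word_sum n h <= n.+1%:R * expR (n%:R * e + K) * full_sum n h.
Proof.
move=> th e0; have e2 : 0 < e / 2 by rewrite divr_gt0.
have [K K0 hK] := birkhoff_distortion beta_gt1 th e2.
exists (K + K) => [|n]; first exact: addr_ge0.
have [f [fP fI]] := admissible_near_fun n.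
rewrite /word_sum (fsbig_finite _ _ (finite_admissible n)) /full_sum.
pose E := n%:R * e + (K + K).
apply: le_trans (_ : \sum_(cj <- [seq (c, j) | c <- full_seq n, j <- iota 0 n.+1])
   (expR (S n h cj.1) * expR E) <= _); last first.
  have : size (iota 0 n.+1) = n.+1 by rewrite size_iota.
  move: (iota 0 n.+1) => r rn; rewrite big_allpairs /= mulr_sumr le_eqVlt; apply/orP; left; apply/eqP.
  apply: eq_bigr => c _; rewrite big_const_seq count_predT rn.
  by rewrite iter_addr_0 -[LHS]mulr_natl; rewrite /E; ring.
apply: (ler_sum_injective (f := f)).
- exact: finmap.fset_uniq.
- move=> w v; rewrite !(in_fset_set (finite_admissible n)) => wa va; exact: fI.
- move=> w; rewrite (in_fset_set (finite_admissible n)) inE => /fP[x wx [jn fc dist]].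
  split.
    apply/allpairsP; exists (f w).
    by split; [exact/(full_seqP beta_gt1)|rewrite mem_iota|case: (f w)].
  apply: ge_sup; first by exists (expR (S n h x)); exists x.
  move=> _ [y wy <-]; rewrite -expRD ler_expR.
  have [y01 x01 H] := cylinderP wy wx; have [_ dist'] := same_word_dist y01 x01 H.
  have {}x01 : 0 <= x <= 1 by case/andP: x01 => -> /ltW.
  have {}y01 : 0 <= y <= 1 by case/andP: y01 => -> /ltW.
  have c01 : 0 <= (f w).1 <= 1 by case/andP: (full_itv beta_gt1 fc) => -> /ltW.
  have := hK n _ _ y01 x01 dist'; have := hK n _ _ x01 c01 dist.
  rewrite !ler_norml /E => /andP[_ +] /andP[_ +]; lra.
- by move=> cj; rewrite mulr_ge0 ?expR_ge0.
Qed.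

(** The growth rate of [full_sum] exists by almost superadditivity, and [word_sum] exceeds
    [full_sum] by a subexponential factor only. This is the form in which pressure enters both
    bounds on the dimension. *)
Lemma full_sum_pressure h e : tame h -> 0 < e -> \forall n \near \oo,
  expR (n%:R * (pressure beta h - e)) <= full_sum n h <= expR (n%:R * (pressure beta h + e)).
Proof.
move=> th; have [B hB] := ln_full_sum_bound th.
have [L LP] := almost_superadditive_cvg hB (fun e => @full_sum_superadditive h e th).
suff -> : pressure beta h = L.
  move=> /LP; apply: filterS => n; rewrite ler_norml => /andP[? ?].
  by rewrite -[full_sum n h]lnK ?posrE ?full_sum_gt0 // !ler_expR; apply/andP; split; lra.
apply/cvg_lim => //; apply/cvgrPdist_le => e' e'0.
have e4 : 0 < e' / 4 by rewrite divr_gt0.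
have [K K0 WF] := word_sum_le_full_sum th e4.
near=> n.
have n0 : 0 < n%:R :> R by near: n; exact: nbhs_infty_gtr.
have FL : `|ln (full_sum n h) - n%:R * L| <= n%:R * (e' / 4) by near: n; exact: LP.
have nK : expR K * n.+1%:R <= expR (e' / 4 * n%:R) by near: n; exact: near_linear_le_expR.
have F0 := full_sum_gt0 n h; have FW := full_sum_le_word_sum n th.
rewrite -/(word_sum n h).
have -> : L - n%:R^-1 * ln (word_sum n h) = (n%:R * L - ln (word_sum n h)) / n%:R.
  by field; rewrite lt0r_neq0.
rewrite normrM [`|_^-1|]ger0_norm ?invr_ge0 ?(ltW n0) // ler_pdivrMr // distrC.
have lnFW : ln (full_sum n h) <= ln (word_sum n h).
  by rewrite ler_ln ?posrE // (lt_le_trans F0).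
have : word_sum n h <= expR (n%:R * (e' / 2)) * full_sum n h.
  apply: le_trans (WF n) _; rewrite ler_pM2r // expRD mulrCA mulrA.
  rewrite (_ : n%:R * (e' / 2) = n%:R * (e' / 4) + e' / 4 * n%:R); last by field.
  by rewrite expRD -mulrA ler_pM2l ?expR_gt0 // [_ * expR K]mulrC.
rewrite -ler_ln ?posrE ?mulr_gt0 ?expR_gt0 ?(lt_le_trans F0) //.
rewrite lnM ?posrE ?expR_gt0 // expRK.
by move: FL; rewrite !ler_norml => /andP[? ?] ?; apply/andP; split; lra.
Unshelve. all: by end_near.
Qed.

End pressure.

(** * Hausdorff measure and the upper bound *)

Section hausdorff.
Context {R : realType} {V : normedModType R}.
Implicit Types (E U : set V) (s d a : R).

Lemma diam_ge0 U : U !=set0 -> (0%E <= diam U)%E.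
Proof.
move=> [x Ux]; apply: ereal_sup_ubound; exists (x, x) => //=.
by rewrite subrr normr0.
Qed.

Lemma gauge_ge0 s U : (0%E <= hausdorff_gauge s U)%E.
Proof. by rewrite /hausdorff_gauge; case: pselect => h /=; rewrite ?poweR_ge0. Qed.

Lemma gauge_le s d U : 0 <= s -> 0 <= d -> (diam U <= d%:E)%E ->
  (hausdorff_gauge s U <= (d `^ s)%:E)%E.
Proof.
move=> s0 d0 Ud; rewrite /hausdorff_gauge; case: pselect => [h|h] /=.
  by rewrite lee_fin powR_ge0.
have /set0P U0 : U != set0 by exact/eqP.
rewrite -poweR_EFin; apply: gt0_ler_poweR => //.
  by rewrite in_itv /= diam_ge0 // leey.
by rewrite in_itv /= lee_fin d0 leey.
Qed.

Lemma diam_ball_le (z : V) d : 0 <= d ->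
  (diam [set x | (`|x - z| <= d)%R] <= (2 * d)%:E)%E.
Proof.
move=> d0; apply: ge_ereal_sup => _ [[x y] [/= xz yz] <-]; rewrite lee_fin.
rewrite (_ : x - y = (x - z) - (y - z)); last by rewrite opprB addrA subrK.
by apply: le_trans (ler_normB _ _) _; lra.
Qed.

Lemma premeasure_ge0 s d E : (0%E <= hausdorff_premeasure s d E)%E.
Proof.
apply: le_ereal_inf_tmp => _ [U _ <-].
by apply: nneseries_ge0 => n _ _; exact: gauge_ge0.
Qed.

Lemma hausdorff_measure_eq0P s E : hausdorff_measure s E = 0%E <->
  forall d, 0 < d -> forall e, 0 < e -> exists U : (set V)^nat,
    [/\ E `<=` \bigcup_i U i, forall i, (diam (U i) <= d%:E)%E &
      (\sum_(0 <= i <oo) hausdorff_gauge s (U i) <= e%:E)%E].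
Proof.
split=> [H d d0 e e0|H].
  have : (hausdorff_premeasure s d E < e%:E)%E.
    apply: le_lt_trans (_ : (hausdorff_measure s E < _)%E); last by rewrite H lte_fin.
    by apply: ereal_sup_ubound; exists d.
  by move=> /ereal_inf_lt[_ [U [EU Ud] <-] /ltW Ue]; exists U.
apply/eqP; rewrite eq_le; apply/andP; split.
  apply: ge_ereal_sup => _ [d /= d0 <-]; apply/lee_addgt0Pr => e e0; rewrite add0e.
  have [U [EU Ud Ue]] := H d d0 e e0.
  by apply: le_trans Ue; apply: ereal_inf_lbound; exists U.
apply: le_trans (premeasure_ge0 s 1 E) _.
by apply: ereal_sup_ubound; exists 1 => /=.
Qed.

End hausdorff.

(** * A Borel-Cantelli lemma for limsup sets of balls *)

Section borel_cantelli.
Context {R : realType} {V : normedModType R}.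
Implicit Types (E : set V) (s d a : R) (B : nat -> seq (V * R)).

Let flat B K := flatten [seq B i | i <- iota 0 K].

Let flatS B K : flat B K.+1 = flat B K ++ B K.
Proof. by rewrite /flat -addn1 iotaD map_cat flatten_cat /= cats0. Qed.

(** The position of a ball does not depend on how many lists are concatenated, so [flat] enumerates
    the whole family as one sequence. *)
Let nth_flat b B K K' k : (k < size (flat B K))%N -> (k < size (flat B K'))%N ->
  nth b (flat B K) k = nth b (flat B K') k.
Proof.
have H N j : (k < size (flat B N))%N -> nth b (flat B (N + j)) k = nth b (flat B N) k.
  elim: j => [|j IHj] kN; first by rewrite addn0.
  rewrite addnS flatS nth_cat IHj // ifT //.
  elim: j {IHj} => [|j IHj]; first by rewrite addn0.
  by rewrite addnS flatS size_cat (leq_trans IHj) // leq_addr.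
move=> kK kK'; have [KK'|/ltnW KK'] := leqP K K'.
  by rewrite -(subnKC KK') H.
by rewrite -(subnKC KK') H.
Qed.

Let sum_geo_expR a K : 0 < a ->
  \sum_(i <- iota 0 K) expR (- (a * i%:R)) <= (1 - expR (- a))^-1.
Proof.
move=> a0; have e1 : expR (- a) < 1 by rewrite -[ltRHS]expR0 ltr_expR oppr_lt0.
rewrite (eq_bigr (fun i => expR (- a) ^+ i)); last first.
  by move=> i _; rewrite -mulNr mulrC expRM_natl.
have e1' : 0 < 1 - expR (- a) by rewrite subr_gt0.
rewrite -[X in \sum_(i <- X) _](_ : index_iota 0 K = _); last by rewrite /index_iota subn0.
rewrite big_mkord -[leRHS]mul1r ler_pdivlMr // mulrC.
have := subrX1 (expR (- a)) K; have : 0 <= expR (- a) ^+ K by rewrite exprn_ge0 ?expR_ge0.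
by move: (\sum_(i < K) _) => S; lra.
Qed.

(** Every tail of the family of balls covers [E], and the gauge sums of the tails are bounded by
    tails of a geometric series. *)
Lemma limsup_balls_null E s a B : 0 < s -> 0 < a ->
  (forall n b, b \in B n -> 0 <= b.2) ->
  (\forall n \near \oo, \sum_(b <- B n) (2 * b.2) `^ s <= expR (- (a * n%:R))) ->
  (forall z, E z -> forall m, exists2 n, (m <= n)%N &
     exists2 b, b \in B n & `|z - b.1| <= b.2) ->
  hausdorff_measure s E = 0%E.
Proof.
move=> s0 a0 B0 [N _ BN] EB; apply/hausdorff_measure_eq0P => d d0 e e0.
have e1 : 0 < 1 - expR (- a) by rewrite subr_gt0 -[ltRHS]expR0 ltr_expR oppr_lt0.
(* The first bound makes the total gauge at most [e], the second forces every diameter below [d]. *)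
pose eta := Num.min (e * (1 - expR (- a))) (d `^ s).
have eta0 : 0 < eta by rewrite lt_min mulr_gt0 // powR_gt0.
have [m [Nm m_eta]] : exists m, (N <= m)%N /\ expR (- (a * m%:R)) <= eta.
  near (\oo : set_system nat) => m; exists m; split; first by near: m; exact: nbhs_infty_ge.
  rewrite expRN invf_ple ?posrE ?expR_gt0 //.
  have : eta^-1 * m.+1%:R <= expR (a * m%:R) by near: m; exact: near_linear_le_expR.
  by apply: le_trans; rewrite ler_peMr ?invr_ge0 ?(ltW eta0) // ler1n.
(* A ball of radius 0 makes each list nonempty, so that the first [k.+1] lists always have a [k]-th
   entry. It costs nothing because [0 < s]. *)
pose B' n := rcons (B (m + n)%N) (0, 0).
have sB' K : (K <= size (flat B' K))%N.
  elim: K => // K IHK; rewrite flatS size_cat size_rcons addnS ltnS.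
  by rewrite (leq_trans IHK) // leq_addr.
pose b k := nth (0, 0) (flat B' k.+1) k.
have bP k : exists n, b k \in B' n.
  have /flattenP[_ /mapP[n _ ->] kn] : b k \in flat B' k.+1 by rewrite mem_nth.
  by exists n.
have sumB' n : \sum_(x <- B' n) (2 * x.2) `^ s <= expR (- (a * (m + n)%:R)).
  rewrite /B' -cats1 big_cat big_seq1 /= mulr0 powR0 ?gt_eqF // addr0.
  by apply: BN; rewrite /= (leq_trans Nm) // leq_addr.
have B'0 n x : x \in B' n -> 0 <= x.2 /\ (2 * x.2) `^ s <= eta.
  move=> xn; split.
    by move: xn; rewrite mem_rcons inE => /predU1P[->//|]; exact: B0.
  apply: le_trans m_eta; apply: le_trans (_ : expR (- (a * (m + n)%:R)) <= _); last first.
    by rewrite ler_expR lerN2 ler_pM2l // ler_nat leq_addr.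
  apply: le_trans (sumB' n); rewrite (perm_big _ (perm_to_rem xn)) big_cons lerDl.
  by apply: sumr_ge0 => y _; exact: powR_ge0.
have bdiam k : (diam [set x | (`|x - (b k).1| <= (b k).2)%R] <= (2 * (b k).2)%:E)%E.
  by have [n /B'0[b0 _]] := bP k; exact: diam_ball_le.
exists (fun k => [set x | `|x - (b k).1| <= (b k).2]); split.
- move=> z Ez; have [n mn [x xn zx]] := EB z Ez m.
  have xB : x \in flat B' (n - m).+1.
    rewrite flatS mem_cat; apply/orP; right; rewrite /B' mem_rcons inE subnKC // xn.
    by rewrite orbT.
  exists (index x (flat B' (n - m).+1)) => //=.
  rewrite /b (nth_flat _ (K' := (n - m).+1)) ?index_mem // ?nth_index //.
- move=> k; apply: le_trans (bdiam k) _; rewrite lee_fin.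
  have [n /B'0[b0 bs]] := bP k; rewrite leNgt; apply/negP => db.
  have : d `^ s < (2 * (b k).2) `^ s by apply: gt0_ltr_powR => //; rewrite nnegrE ltW // (lt_trans d0).
  by rewrite ltNge (le_trans bs) // ge_min lexx orbT.
apply: lime_le; first by apply: is_cvg_nneseries => n _ _; exact: gauge_ge0.
apply: nearW => K; apply: le_trans (_ : (\sum_(0 <= k < K) ((2 * (b k).2) `^ s)%:E)%E <= _)%E.
  apply: lee_sum => k _; have [n /B'0[b0 bs]] := bP k.
  by apply: gauge_le; rewrite ?(ltW s0) ?mulr_ge0.
rewrite sumEFin lee_fin.
apply: le_trans (_ : \sum_(x <- flat B' K) (2 * x.2) `^ s <= _).
  rewrite (big_nth (0, 0)) [leRHS](@big_cat_nat _ _ _ K) ?sB' //=.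
  rewrite -[leLHS]addr0 lerD //; last by apply: sumr_ge0 => k _; exact: powR_ge0.
  rewrite big_nat [leRHS]big_nat; apply: ler_sum => k /andP[_ kK].
  by rewrite /b (nth_flat _ (K' := K)) // (leq_trans kK).
rewrite /flat big_flatten big_map /=.
apply: le_trans (_ : \sum_(i <- iota 0 K) eta * expR (- (a * i%:R)) <= _).
  apply: ler_sum => i _; apply: le_trans (sumB' i) _.
  by rewrite natrD mulrDr opprD expRD ler_pM2r ?expR_gt0.
rewrite -mulr_sumr; apply: le_trans (ler_wpM2l (ltW eta0) (sum_geo_expR K a0)) _.
by rewrite ler_pdivrMr // ge_min lexx.
Unshelve. all: by end_near.
Qed.

End borel_cantelli.

Section birkhoff_sums.
Context {R : realType} (beta : R) (beta_gt1 : 1 < beta).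
Local Notation T := (beta_map beta).
Local Notation S := (birkhoff beta).
Implicit Types (x y z c d e s r : R) (f g h : R -> R) (n m i j : nat).

Lemma birkhoff0 h x : S 0 h x = 0.
Proof. by rewrite /birkhoff big_nil. Qed.

Lemma birkhoffS n h x : S n.+1 h x = S n h x + h (iter n T x).
Proof. by rewrite /birkhoff big_nat_recr. Qed.

Lemma birkhoffN n h x : S n (fun y => - h y) x = - S n h x.
Proof. by rewrite /birkhoff sumrN. Qed.

Lemma birkhoff_affine n a b h x : S n (fun y => a + b * h y) x = n%:R * a + b * S n h x.
Proof.
elim: n => [|n IHn]; first by rewrite !birkhoff0 mul0r mulr0 addr0.
by rewrite !birkhoffS IHn -natr1; ring.
Qed.

Lemma eq_birkhoff n h k x : h =1 k -> S n h x = S n k x.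
Proof. by move=> hk; apply: eq_bigr => i _; rewrite hk. Qed.

Lemma birkhoff_f n s f x : S n (fun y => f y - s * (ln beta + f y)) x =
  S n f x - s * (n%:R * ln beta + S n f x).
Proof.
rewrite (@eq_birkhoff n _ (fun y => - s * ln beta + (1 - s) * f y) x); last by move=> y; ring.
by rewrite birkhoff_affine; ring.
Qed.

Lemma birkhoff_g n s g x : S n (fun y => - (s * (ln beta + g y))) x =
  - (s * (n%:R * ln beta + S n g x)).
Proof.
rewrite (@eq_birkhoff n _ (fun y => - s * ln beta + - s * g y) x); last by move=> y; ring.
by rewrite birkhoff_affine; ring.
Qed.

Lemma birkhoff_ge0 n h x : (forall y, 0 <= y <= 1 -> 0 <= h y) -> 0 <= x <= 1 ->
  0 <= S n h x.
Proof.
by move=> h0 x01; apply: sumr_ge0 => i _; apply: h0; exact: iter_beta_map_itv.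
Qed.

End birkhoff_sums.

Lemma exists_slice (R : realType) (y c r q : R) : 0 < r -> `|y - c| <= r * q ->
  exists2 i, (i <= Num.truncn q)%N & `|y - (c - r * q + (2 * i%:R + 1) * r)| <= r.
Proof.
move=> r0; rewrite ler_norml => /andP[yc1 yc2].
have r2 : 0 < 2 * r by rewrite mulr_gt0.
pose t := (y - (c - r * q)) / (2 * r).
have tr : t * (2 * r) = y - (c - r * q) by rewrite /t divfK ?gt_eqF.
have tq : t <= q by rewrite -(ler_pM2r r2) tr; lra.
have t0 : 0 <= t by rewrite -(ler_pM2r r2) tr; lra.
exists (Num.truncn t); first exact: le_truncn.
have /andP[] := truncn_itv t0; rewrite -natr1; move: (Num.truncn t)%:R => i it ti.
rewrite (_ : y - _ = (2 * t - 2 * i - 1) * r); last by lra.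
rewrite normrM (ger0_norm (ltW r0)) -[leRHS]mul1r ler_pM2r // ler_norml.
by apply/andP; split; lra.
Qed.

(** * Covers of the limsup set *)

Section upper_bounds.
Context {R : realType} (beta x0 y0 : R) (f g : R -> R) (beta_gt1 : 1 < beta).
Local Notation T := (beta_map beta).
Local Notation S := (birkhoff beta).
Local Notation powV_gt0 := (powV_gt0 beta_gt1).
Local Notation full_seq := (full_seq beta).
Hypotheses (tf : tame f) (tg : tame g)
  (g0 : forall x : R, 0 <= x <= 1 -> 0 <= g x)
  (f0 : forall x : R, 0 <= x <= 1 -> 0 <= f x)
  (gf : forall x y : R, 0 <= x <= 1 -> 0 <= y <= 1 -> g y <= f x).
Implicit Types (x y z c d e s r eta : R) (n m i j : nat).

Let P n := [seq (c, j) | c <- full_seq n, j <- iota 0 n.+1].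

(** Where a point with data (c, j) would have to lie for T^n to send it to [x]; this position need
    not itself have these data. *)
Let center n x (cj : R * nat) := cj.1 + (0 < cj.2)%:R * beta ^- cj.2 + x * beta ^- n.

Let sum_P n (F : R -> R) :
  \sum_(cj <- P n) F cj.1 = n.+1%:R * \sum_(c <- full_seq n) F c.
Proof.
rewrite /P; have : size (iota 0 n.+1) = n.+1 by rewrite size_iota.
move: (iota 0 n.+1) => r rn; rewrite big_allpairs /= mulr_sumr.
apply: eq_bigr => c _; rewrite big_const_seq count_predT rn.
by rewrite iter_addr_0 -[LHS]mulr_natl.
Qed.

Let near_center h e : tame h -> 0 < e -> exists2 K, 0 <= K &
  forall n x z, 0 <= z <= 1 -> exists cj, [/\ cj \in P n, 0 <= cj.1 <= 1,
    `|z - center n x cj| = `|iter n T z - x| * beta ^- n &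
    - S n h z <= - S n h cj.1 + (n%:R * e + K)].
Proof.
move=> th e0; have [K K0 hK] := birkhoff_distortion beta_gt1 th e0.
exists K => // n x z z01; have [c [j [jn fc zE dist]]] := full_near_orbit beta_gt1 n z01.
have fn := full_ext beta_gt1 jn fc.
have c01 : 0 <= c <= 1 by case/andP: (full_itv beta_gt1 fn) => -> /ltW.
exists (c, j); split => //=.
- apply/allpairsP; exists (c, j).
  by split; [exact/(full_seqP beta_gt1)|rewrite mem_iota|].
- rewrite (_ : z - _ = (iter n T z - x) * beta ^- n).
    by rewrite normrM (ger0_norm (ltW (powV_gt0 n))).
  by rewrite /center /=; move: zE; move: (iter n T z) => t; lra.
- have := hK n _ _ z01 c01 dist; rewrite ler_norml => /andP[+ _]; lra.
Qed.

Let pair_le (p : R * R) r : `|p.1| <= r -> `|p.2| <= r -> `|p| <= r.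
Proof. by move=> p1 p2; rewrite prod_normE ge_max p1 p2. Qed.

Let near_final (C a : R) : 0 < a -> \forall n \near \oo,
  C * (n.+1%:R * n.+1%:R) * expR (a * n%:R) * expR (- (4 * a * n%:R)) <= expR (- (a * n%:R)).
Proof.
move=> a0; near=> n.
have C1 : `|C| * n.+1%:R <= expR (a * n%:R) by near: n; exact: near_linear_le_expR.
have C2 : 1 * n.+1%:R <= expR (a * n%:R) by near: n; exact: near_linear_le_expR.
apply: le_trans (_ : expR (a * n%:R) * expR (a * n%:R) * expR (a * n%:R) *
  expR (- (4 * a * n%:R)) <= _); last by rewrite -!expRD ler_expR; lra.
rewrite ler_pM2r ?expR_gt0 // ler_pM2r ?expR_gt0 //.
apply: le_trans (_ : `|C| * (n.+1%:R * n.+1%:R) <= _).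
  by rewrite ler_wpM2r ?mulr_ge0 // ler_norm.
by rewrite mulrA ler_pM // ?mulr_ge0 // -[X in X <= _]mul1r.
Unshelve. all: by end_near.
Qed.

Let ln_beta_gt0 : 0 < ln beta.
Proof. exact: ln_gt0. Qed.

Let expR_ln2 n u s : (2 * (beta ^- n * expR u)) `^ s =
  expR (s * (ln 2 - n%:R * ln beta + u)).
Proof.
rewrite [s * _]mulrC expRM; congr (_ `^ _); rewrite !expRD lnK ?posrE // expRN expRM_natl.
by rewrite lnK ?posrE ?(beta_gt0 beta_gt1) // mulrA.
Qed.

(** One square of the larger side is used for each pair of words. Its size depends on the second
    word only, so summing over the first word merely counts full words, and this produces the term
    [ln beta]. *)
Lemma upper_bound_g s eta : 0 <= s -> 0 < eta ->
  pressure beta (fun x => - (s * (ln beta + g x))) + ln beta <= 0 ->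
  hausdorff_measure (s + eta) (shrinking_set beta x0 y0 f g) = 0%E.
Proof.
move=> s0 eta0 Ps; set s' := s + eta; set phi := fun x => _ in Ps.
(* As [g] is nonnegative, the surplus [eta] in the exponent gains at least exp(- eta n ln beta) =
   exp(- 4 a n). One [a] is spent below on [e], two on polynomial factors, and one is left for
   convergence. *)
have lb := ln_beta_gt0; pose a := eta * ln beta / 4.
have a0 : 0 < a by rewrite divr_gt0 // mulr_gt0.
have s'0 : 0 < s' by rewrite /s'; lra.
(* The distortion costs [s' * e] and the pressure estimate [e], together [a]. *)
pose e := a / (s' + 1); have e0 : 0 < e by rewrite divr_gt0 //; lra.
have [K K0 hK] := near_center tg e0.
have tphi : tame phi.
  apply: (eq_tame (h := fun x => - s * ln beta + - s * g x)); last by move=> x; rewrite /phi; ring.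
  by apply: tameD; [exact: tame_cst|exact: tameZ].
pose r n d := beta ^- n * expR (- S n g d + (n%:R * e + K)).
pose B n := [seq ((center n x0 cj, center n y0 dk), r n dk.1) | cj <- P n, dk <- P n].
apply: (limsup_balls_null (a := a) (B := B)) => //.
- move=> n b /allpairsP[[cj dk] [_ _ ->]] /=.
  by rewrite /r mulr_ge0 ?expR_ge0 ?(ltW (powV_gt0 n)).
- near=> n.
  have /andP[_ Fn] : expR (n%:R * (pressure beta phi - e)) <= full_sum beta n phi <=
      expR (n%:R * (pressure beta phi + e)) by near: n; exact: full_sum_pressure.
  rewrite /B big_allpairs_dep /=.
  rewrite (sum_P n (fun=> \sum_(dk <- P n) (2 * r n dk.1) `^ s')).
  rewrite (sum_P n (fun d => (2 * r n d) `^ s')).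
  have -> : forall G : R, \sum_(c <- full_seq n) G = (size (full_seq n))%:R * G.
    by move=> G; rewrite -size_sum mulr_suml; apply: eq_bigr => ? _; rewrite mul1r.
  pose C := 4 * expR (s' * (ln 2 + K)).
  have sumr : \sum_(d <- full_seq n) (2 * r n d) `^ s' <=
      expR (s' * (ln 2 + K)) * expR (n%:R * (s' * e)) * expR (- (4 * a * n%:R)) * full_sum beta n phi.
    rewrite /full_sum mulr_sumr big_seq [leRHS]big_seq; apply: ler_sum => d /full_seq_itv d01.
    rewrite expR_ln2 -!expRD ler_expR /phi birkhoff_g /a /s'.
    have : 0 <= eta * S n g d by rewrite mulr_ge0 ?(ltW eta0) // birkhoff_ge0 // d01.
    by move=> H; lra.
  apply: le_trans (_ : C * (n.+1%:R * n.+1%:R) * expR (a * n%:R) * expR (- (4 * a * n%:R)) <= _).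
    apply: le_trans (_ : n.+1%:R * (4 * expR (n%:R * ln beta) * (n.+1%:R *
      (expR (s' * (ln 2 + K)) * expR (n%:R * (s' * e)) * expR (- (4 * a * n%:R)) *
       expR (n%:R * (pressure beta phi + e))))) <= _).
      rewrite ler_wpM2l // ler_pM ?mulr_ge0 // ?sumr_ge0 // => [d _||].
      + exact: powR_ge0.
      + by rewrite expRM_natl lnK ?posrE ?(beta_gt0 beta_gt1) // size_full_seq_le.
      + rewrite ler_wpM2l // (le_trans sumr) // ler_wpM2l // !mulr_ge0 ?expR_ge0 //.
    rewrite (_ : _ * _ = C * (n.+1%:R * n.+1%:R) * expR (- (4 * a * n%:R)) *
      (expR (n%:R * ln beta) * expR (n%:R * (s' * e)) * expR (n%:R * (pressure beta phi + e)))); last first.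
      by rewrite /C; ring.
    rewrite [leRHS]mulrAC ler_wpM2l ?mulr_ge0 ?expR_ge0 // -!expRD ler_expR.
    rewrite -!mulrDr mulrC ler_wpM2r //.
    have : s' * e + e = a by rewrite /e; field; lra.
    by lra.
  by near: n; exact: near_final.
- move=> [x y] [/= /[!in_itv] /= x01 y01 inf] m.
  have [n [[hx hy] mn]] : exists n, (`|iter n T x - x0| < expR (- S n f x) /\
      `|iter n T y - y0| < expR (- S n g y)) /\ (m <= n)%N.
    apply: contrapT => H; apply: inf; apply: (sub_finite_set _ (finite_II m)).
    by move=> n nP /=; rewrite ltnNge; apply/negP => mn; apply: H; exists n.
  have [cj [cP _ cE _]] := hK n x0 x x01; have [dk [dP d01 dE dS]] := hK n y0 y y01.
  exists n => //; exists ((center n x0 cj, center n y0 dk), r n dk.1).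
    by apply/allpairsP; exists (cj, dk).
  (* Since [f] dominates [g], the first coordinate is within the radius given by the second one. *)
  have n0 := powV_gt0 n; have gfn := @le_birkhoff _ beta n g f y x y01 x01 (fun a b ha hb => gf hb ha).
  apply: pair_le => /=; rewrite ?cE ?dE mulrC /r ler_pM2l //.
    by apply: le_trans (ltW hx) _; rewrite ler_expR; lra.
  by apply: le_trans (ltW hy) _; rewrite ler_expR; lra.
Unshelve. all: by end_near.
Qed.

(** A rectangle is cut into about exp(S_n f - S_n g) squares of the smaller side. The exponents then
    separate into a term in [f] and the term - S_n g, and the double sum factors into two partition
    functions. *)
Lemma upper_bound_f s eta : 0 <= s -> 0 < eta ->
  pressure beta (fun x => f x - s * (ln beta + f x))
    + pressure beta (fun x => - g x) <= 0 ->
  hausdorff_measure (s + eta) (shrinking_set beta x0 y0 f g) = 0%E.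
Proof.
move=> s0 eta0 Ps; set s' := s + eta.
set phi := fun x => _ in Ps; set psi := fun x => - g x in Ps.
have tphi : tame phi.
  apply: (eq_tame (h := fun x => - s * ln beta + (1 - s) * f x)); last by move=> x; rewrite /phi; ring.
  by apply: tameD; [exact: tame_cst|exact: tameZ].
have tpsi : tame psi.
  by apply: (eq_tame (h := fun x => - 1 * g x)); [exact: tameZ|move=> x; rewrite /psi mulN1r].
have Fphi := fun e (e0 : 0 < e) => full_sum_pressure beta_gt1 tphi e0.
have Fpsi := fun e (e0 : 0 < e) => full_sum_pressure beta_gt1 tpsi e0.
move: (pressure beta phi) (pressure beta psi) Ps Fphi Fpsi => p1 p2 Ps Fphi Fpsi.
have lb := ln_beta_gt0; pose a := eta * ln beta / 4.
have a0 : 0 < a by rewrite divr_gt0 // mulr_gt0.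
have s'0 : 0 < s' by rewrite /s'; lra.
(* Two pressure estimates are used here, whence 2 instead of 1. *)
pose e := a / (s' + 2); have e0 : 0 < e by rewrite divr_gt0 //; lra.
have [K1 K10 hK1] := near_center tf e0; have [K2 K20 hK2] := near_center tg e0.
pose K := K1 + K2.
pose r n c := beta ^- n * expR (- S n f c + (n%:R * e + K)).
pose q n c d := expR (S n f c - S n g d).
have r0 n c : 0 < r n c by rewrite /r mulr_gt0 ?expR_gt0 ?powV_gt0.
(* Slice the rectangle around (cj, dk) into squares of side twice its width. *)
pose N n (cd : (R * nat) * (R * nat)) := (Num.truncn (q n cd.1.1 cd.2.1)).+1.
pose B n := [seq ((center n x0 cd.1,
    center n y0 cd.2 - r n cd.1.1 * q n cd.1.1 cd.2.1 + (2 * i%:R + 1) * r n cd.1.1), r n cd.1.1) |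
  cd <- [seq (cj, dk) | cj <- P n, dk <- P n], i <- iota 0 (N n cd)].
have PitvP n cj : cj \in P n -> 0 <= cj.1 <= 1.
  by move=> /allpairsP[[c j] [/= /full_seq_itv c01 _ ->]]; exact: c01.
have q1 n c d : 0 <= c <= 1 -> 0 <= d <= 1 -> 1 <= q n c d.
  move=> c01 d01; rewrite -[leLHS]expR0 ler_expR subr_ge0.
  exact: (@le_birkhoff _ beta n g f d c d01 c01 (fun a b ha hb => gf hb ha)).
apply: (limsup_balls_null (a := a) (B := B)) => //.
- by move=> n b /allpairsPdep[cd [i [_ _ ->]]]; exact/ltW/r0.
- near=> n.
  have /andP[_ F1] : expR (n%:R * (p1 - e)) <= full_sum beta n phi <=
      expR (n%:R * (p1 + e)) by near: n; exact: Fphi.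
  have /andP[_ F2] : expR (n%:R * (p2 - e)) <= full_sum beta n psi <=
      expR (n%:R * (p2 + e)) by near: n; exact: Fpsi.
  pose C := 2 * expR (s' * (ln 2 + K)).
  pose D := expR (s' * (ln 2 + K)) * expR (n%:R * (s' * e)) * expR (- (4 * a * n%:R)).
  have D0 : 0 <= D by rewrite !mulr_ge0 ?expR_ge0.
  apply: le_trans (_ : \sum_(cj <- P n) \sum_(dk <- P n)
      2 * D * (expR (S n phi cj.1) * expR (S n psi dk.1)) <= _).
    rewrite /B big_allpairs_dep big_allpairs big_seq [leRHS]big_seq.
    apply: ler_sum => cj /PitvP c01; rewrite big_seq [leRHS]big_seq.
    apply: ler_sum => dk /PitvP d01.
    rewrite (eq_bigr (fun=> (2 * r n cj.1) `^ s')); last by [].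
    rewrite (_ : \sum_(i <- _) _ = (N n (cj, dk))%:R * (2 * r n cj.1) `^ s'); last first.
      by rewrite -[N n _ in RHS](size_iota 0) -size_sum mulr_suml; apply: eq_bigr => ? _; rewrite mul1r.
    have Nq : (N n (cj, dk))%:R <= 2 * q n cj.1 dk.1.
      have := q1 n _ _ c01 d01; have := truncn_le (q n cj.1 dk.1).
      rewrite /N /= -natr1 expR_ge0; lra.
    apply: le_trans (ler_wpM2r (powR_ge0 _ _) Nq) _.
    rewrite -!mulrA ler_pM2l // /q /D expR_ln2 -!expRD ler_expR /phi birkhoff_f /psi birkhoffN.
    have : 0 <= eta * S n f cj.1 by rewrite mulr_ge0 ?(ltW eta0) // birkhoff_ge0.
    by rewrite /a /s'; lra.
  have -> : \sum_(cj <- P n) \sum_(dk <- P n)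
      2 * D * (expR (S n phi cj.1) * expR (S n psi dk.1)) =
      2 * D * ((n.+1%:R * full_sum beta n phi) * (n.+1%:R * full_sum beta n psi)).
    rewrite /full_sum -(sum_P n (fun c => expR (S n phi c))) -(sum_P n (fun c => expR (S n psi c))).
    rewrite mulr_suml mulr_sumr; apply: eq_bigr => cj _.
    by rewrite !mulr_sumr.
  apply: le_trans (_ : 2 * D * ((n.+1%:R * expR (n%:R * (p1 + e))) *
      (n.+1%:R * expR (n%:R * (p2 + e)))) <= _).
    rewrite ler_wpM2l ?mulr_ge0 // ler_pM ?mulr_ge0 ?ler_wpM2l //.
      exact/ltW/full_sum_gt0.
    exact/ltW/full_sum_gt0.
  apply: le_trans (_ : C * (n.+1%:R * n.+1%:R) * expR (a * n%:R) * expR (- (4 * a * n%:R)) <= _); last first.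
    by near: n; exact: near_final.
  rewrite (_ : 2 * D * _ = C * (n.+1%:R * n.+1%:R) * expR (- (4 * a * n%:R)) *
      (expR (n%:R * (s' * e)) * expR (n%:R * (p1 + e)) *
       expR (n%:R * (p2 + e)))); last by rewrite /C /D; ring.
  rewrite [leRHS]mulrAC ler_wpM2l ?mulr_ge0 ?expR_ge0 // -!expRD ler_expR.
  rewrite -!mulrDr mulrC ler_wpM2r //.
  have : s' * e + 2 * e = a by rewrite /e; field; lra.
  by lra.
- move=> [x y] [/= /[!in_itv] /= x01 y01 inf] m.
  have [n [[hx hy] mn]] : exists n, (`|iter n T x - x0| < expR (- S n f x) /\
      `|iter n T y - y0| < expR (- S n g y)) /\ (m <= n)%N.
    apply: contrapT => H; apply: inf; apply: (sub_finite_set _ (finite_II m)).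
    by move=> n nP /=; rewrite ltnNge; apply/negP => mn; apply: H; exists n.
  have [cj [cP c01 cE cS]] := hK1 n x0 x x01; have [dk [dP d01 dE dS]] := hK2 n y0 y y01.
  have n0 := powV_gt0 n; pose rc := r n cj.1; pose Q := q n cj.1 dk.1.
  have rc0 : 0 < rc by exact: r0.
  have yd : `|y - center n y0 dk| <= rc * Q.
    rewrite dE mulrC /rc /r -mulrA ler_pM2l //; apply: le_trans (ltW hy) _.
    by rewrite /Q /q -expRD ler_expR /K; lra.
  have [i iQ yi] := exists_slice rc0 yd.
  exists n => //; exists ((center n x0 cj, center n y0 dk - rc * Q + (2 * i%:R + 1) * rc), rc).
    apply/allpairsPdep; exists (cj, dk), i; split => //.
      by apply/allpairsP; exists (cj, dk).
    by rewrite mem_iota add0n /N /= ltnS.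
  apply: pair_le => //=.
  rewrite cE mulrC /rc /r ler_pM2l //.
  by apply: le_trans (ltW hx) _; rewrite ler_expR /K; lra.
Unshelve. all: by end_near.
Qed.

End upper_bounds.

(** * Products of homogeneous Moran sets *)

Section moran_sets.
Context {R : realType} (beta : R) (beta_gt1 : 1 < beta).
Local Notation T := (beta_map beta).
Local Notation full := (full beta).
Local Notation pow_gt0 := (pow_gt0 beta_gt1).
Local Notation powV_gt0 := (powV_gt0 beta_gt1).
Implicit Types (x y z c d r a b e : R) (n m i j k : nat) (A B : seq R) (u v : nat -> R).

Lemma powV_small e : 0 < e -> exists N, forall n, (N <= n)%N -> beta ^- n < e.
Proof.
move=> e0; have lb : 0 < ln beta by exact: ln_gt0.
have [N _ NP] : \forall n \near \oo, (2 * e^-1) * n.+1%:R <= expR (ln beta * n%:R).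
  exact: near_linear_le_expR.
exists N => n /NP; rewrite mulrC expRM_natr lnK ?posrE ?(beta_gt0 beta_gt1) // => H.
rewrite invf_plt ?posrE ?pow_gt0 //; apply: lt_le_trans H.
have n1 : 1 <= n.+1%:R :> R by rewrite ler1n.
have : 0 < e^-1 by rewrite invr_gt0.
by move=> ei; have := ler_wpM2l (ltW ei) n1; lra.
Qed.

(** At radii above the size of the cylinders, every cylinder meeting the ball is counted with all
    its points; doubling the radius captures its left end point. *)
Lemma count_compseq_size n A B x r : {in B, forall b, 0 <= b <= 1} -> beta ^- n <= r ->
  (count_ball (compseq beta n A B) x r <= count_ball A x (2 * r) * size B)%N.
Proof.
move=> B01 nr; elim: A => //= a A IHA; rewrite {1}/count_ball count_cat mulnDl leq_add //.
have n0 := powV_gt0 n.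
case: (leP `|a - x| _) => ax; first by rewrite mul1n -(size_map (fun b => a + b * beta ^- n)) count_size.
rewrite count_map mul0n leqn0 -leqn0 leqNgt -has_count; apply/negP => /hasP[b bB /= H].
have /andP[b0 b1] := B01 b bB.
have : 0 <= b * beta ^- n <= beta ^- n.
  by rewrite mulr_ge0 ?(ltW n0) //= ler_piMl // ltW.
by move: ax H; rewrite lter_norml ltr_normr => /orP[] *; lra.
Qed.

Variables (L : nat -> nat) (X : nat -> seq R).
Hypothesis L_gt0 : forall j, (0 < L j)%N.

Definition depth n := (\sum_(i < n) L i)%N.

Lemma depth0 : depth 0 = 0%N. Proof. by rewrite /depth big_ord0. Qed.

Lemma depthS n : depth n.+1 = (depth n + L n)%N.
Proof. by rewrite /depth big_ord_recr. Qed.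

Lemma leq_depth n : (n <= depth n)%N.
Proof. by elim: n => // n IHn; rewrite depthS -addn1 leq_add. Qed.

Definition base u n : R := \sum_(j < n) u j * beta ^- depth j.

Lemma base0 u : base u 0 = 0. Proof. by rewrite /base big_ord0. Qed.

Lemma baseS u n : base u n.+1 = base u n + u n * beta ^- depth n.
Proof. by rewrite /base big_ord_recr. Qed.

(** Nested closed intervals, so that each sequence of offsets codes some point. *)
Definition coded u x := forall n,
  u n \in X n /\ base u n <= x <= base u n + beta ^- depth n.

(* nodes n consists of the left end points of generation n, and rest j k of the
   offsets of generation j + k inside a node of generation j, rescaled to [0, 1]. *)
Fixpoint nodes n : seq R :=
  if n is m.+1 then compseq beta (depth m) (nodes m) (X m) else [:: 0].

Fixpoint rest j k : seq R :=
  if k is k'.+1 then compseq beta (L j) (X j) (rest j.+1 k') else [:: 0].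

Lemma nodes_rest j k : nodes (j + k) = compseq beta (depth j) (nodes j) (rest j k).
Proof.
elim: k j => [|k IHk] j; last by rewrite -addSnnS IHk /= depthS compseqA.
rewrite addn0 /compseq /=; elim: (nodes j) => //= a A <-.
by rewrite mul0r addr0.
Qed.

Hypothesis X_uniq : forall j, uniq (X j).
Hypothesis X_full : forall j, {in X j, forall c, full (L j) c}.

Lemma X_itv j c : c \in X j -> 0 <= c < 1.
Proof. by move=> /X_full/(full_itv beta_gt1). Qed.

Lemma nodes_full n : {in nodes n, forall c, full (depth n) c}.
Proof.
elim: n => [|n IHn] /=; first by move=> c; rewrite inE depth0 => /eqP->; exact: full0.
by rewrite depthS; exact: compseq_full.
Qed.

Lemma nodes_uniq n : uniq (nodes n).
Proof.
elim: n => //= n IHn; apply: compseq_uniq => //; first exact: nodes_full.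
by move=> c /X_itv.
Qed.

Lemma rest_itv j k : {in rest j k, forall b, 0 <= b <= 1}.
Proof.
elim: k j => [|k IHk] j c /=; first by rewrite inE => /eqP->; rewrite lexx ler01.
move=> /mem_compseq[a [b [/X_full fa /IHk /andP[b0 b1] ->]]].
have [a0 an _ _] := fa; have n0 := powV_gt0 (L j).
have : 0 <= b * beta ^- L j <= beta ^- L j.
  by rewrite mulr_ge0 ?(ltW n0) //= ler_piMl // ltW.
by move=> /andP[? ?]; apply/andP; split; lra.
Qed.

(** For a radius between the scales of generations [j + 1] and [j], the ball meets few nodes of
    generation [j] and, in each, at most [D] of the next offsets; all descendants of these are
    counted. *)
Lemma count_nodes j n x r (D : nat) : (j < n)%N ->
  beta ^- depth j.+1 <= r <= beta ^- depth j ->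
  (forall y, count_ball (X j) y (2 * (r * beta ^+ depth j)) <= D)%N ->
  (count_ball (nodes n) x r <= 6 * (D * size (rest j.+1 (n - j.+1))))%N.
Proof.
move=> jn /andP[rj1 rj] XD; have -> : nodes n = nodes (j + (n - j.+1).+1) by rewrite -addSnnS subnKC.
rewrite nodes_rest /=.
apply: count_compseq.
- exact: beta_gt1.
- exact: nodes_uniq.
- exact: nodes_full.
- by move=> b bB; exact: (@rest_itv j (n - j.+1).+1).
- by rewrite rj andbT; apply: le_trans rj1; exact/ltW/powV_gt0.
- move=> y; apply: leq_trans (count_compseq_size _ _ _ _) _.
  + exact: rest_itv.
  + by rewrite -ler_pdivrMr ?pow_gt0 // -invfM mulrC -exprD -depthS.
  + by rewrite leq_mul2r XD orbT.
Qed.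

Lemma size_nodes j n : (j < n)%N ->
  size (nodes n) = (size (nodes j) * size (X j) * size (rest j.+1 (n - j.+1)))%N.
Proof.
move=> jn; have -> : nodes n = nodes (j + (n - j.+1).+1) by rewrite -addSnnS subnKC.
by rewrite nodes_rest /= !size_compseq mulnA.
Qed.

Hypothesis X_neq0 : forall j, (0 < size (X j))%N.

Lemma base_le u n k : (forall j, u j \in X j) ->
  base u n <= base u (n + k) /\
  base u (n + k) + beta ^- depth (n + k) <= base u n + beta ^- depth n.
Proof.
move=> uX; elim: k => [|k [IH1 IH2]]; first by rewrite addn0.
rewrite addnS baseS depthS powVD; have n0 := powV_gt0 (depth (n + k)).
have [u0 u1 _ _] := X_full (uX (n + k)%N); split.
  by apply: le_trans IH1 _; rewrite lerDl mulr_ge0 // ltW.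
apply: le_trans IH2; rewrite -addrA lerD2l [X in _ + X]mulrC -mulrDl.
by rewrite ler_piMl // ltW.
Qed.

Lemma coded_exists u : (forall j, u j \in X j) -> exists x, coded u x.
Proof.
move=> uX; pose S := [set base u n | n in [set: nat]].
have ubn n : ubound S (base u n + beta ^- depth n).
  move=> _ [m _ <-]; have [nm|/ltnW nm] := leqP n m.
    have [_] := base_le n (m - n) uX; rewrite subnKC //; apply: le_trans.
    by rewrite lerDl ltW ?powV_gt0.
  have [+ _] := base_le m (n - m) uX; rewrite subnKC // => /le_trans; apply.
  by rewrite lerDl ltW ?powV_gt0.
exists (sup S) => n; split => //; apply/andP; split.
  by apply: ub_le_sup; [exists (base u 0 + beta ^- depth 0); exact: ubn|exists n].
by apply: ge_sup; [exists (base u 0); exists 0%N|exact: ubn].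
Qed.

Lemma nodes_base n a : a \in nodes n -> exists2 u, (forall j, u j \in X j) & base u n = a.
Proof.
elim: n a => [|n IHn] a /=.
  rewrite inE => /eqP->; exists (fun j => nth 0 (X j) 0); last exact: base0.
  by move=> j; rewrite mem_nth.
move=> /mem_compseq[c [d [/IHn[u uX <-] dX ->]]].
exists (fun j => if j == n then d else u j) => [j|].
  by case: eqP => // ->.
rewrite baseS eqxx /base; congr (_ + _); apply: eq_bigr => i _.
by rewrite ltn_eqF.
Qed.

Lemma base_nodes u n : (forall j, u j \in X j) -> base u n \in nodes n.
Proof.
move=> uX; elim: n => [|n IHn]; first by rewrite base0 mem_head.
by rewrite baseS /=; apply/allpairsP; exists (base u n, u n); split; [|exact: uX|].
Qed.

Lemma coded_dist u x u' x' n : coded u x -> coded u' x' -> base u n = base u' n ->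
  `|x - x'| <= beta ^- depth n.
Proof.
move=> /(_ n)[_ /andP[? ?]] /(_ n)[_ /andP[+ +]] E; rewrite -E => ? ?.
by rewrite ler_norml; apply/andP; split; lra.
Qed.

Hypothesis X_proper : forall j, {in X j, forall c, c + beta ^- L j < 1}.

(** A limit of left end points might be the right end of a cylinder, where T^n jumps. Since
    [X_proper] makes each interval end before its parent does, the coded point stays inside
    half-open cylinders, on which T^n is affine. *)
Lemma coded_orbit u x n : coded u x ->
  exists2 y, 0 <= y < 1 & x = base u n + y * beta ^- depth n /\
    [/\ iter (depth n) T x = y, 0 <= x < 1 &
     exists2 y', 0 <= y' < 1 & y = u n + y' * beta ^- L n].
Proof.
move=> ux; have uX j : u j \in X j by have [] := ux j.
have half m : base u m <= x < base u m + beta ^- depth m.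
  have [_ /andP[-> _]] := ux m; have [_ /andP[_]] := ux m.+1.
  move=> /le_lt_trans; apply; rewrite baseS depthS powVD -addrA ltrD2l.
  rewrite [X in _ + X]mulrC -mulrDl -[ltRHS]mul1r ltr_pM2r ?powV_gt0 //.
  exact: X_proper.
pose y m := (x - base u m) * beta ^+ depth m.
have y01 m : 0 <= y m < 1.
  have /andP[h1 h2] := half m; rewrite mulr_ge0 ?subr_ge0 ?(ltW (pow_gt0 _)) //=.
  by rewrite -ltr_pdivlMr ?pow_gt0 // mul1r ltrBlDl.
have xE m : x = base u m + y m * beta ^- depth m.
  rewrite /y -[(x - _) * _ * _]mulrA [beta ^+ _ * _]mulrC powVK // mulr1.
  by rewrite addrC subrK.
have fb := nodes_full (base_nodes n uX).
exists (y n) => //; split => //; split.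
- by rewrite (xE n) -[depth n]add0n (full_iter beta_gt1 0 fb (y01 n)).
- by have := half 0; rewrite base0 depth0 expr0 invr1 add0r.
exists (y n.+1) => //.
have := xE n.+1; rewrite baseS depthS powVD; move: (y n.+1) => y' E.
rewrite /y (_ : x - base u n = (u n + y' * beta ^- L n) * beta ^- depth n).
  by rewrite -mulrA powVK // mulr1.
by rewrite E; ring.
Qed.

End moran_sets.

Lemma count_allpairs_pair {I J : eqType} (P : pred I) (Q : pred J) (r : seq I) (s : seq J) :
  count (fun p : I * J => P p.1 && Q p.2) [seq (i, j) | i <- r, j <- s] =
  (count P r * count Q s)%N.
Proof.
elim: r => //= i r IHr; rewrite count_cat IHr mulnDl count_map; congr (_ + _)%N.
rewrite (@eq_count _ _ (fun j => P i && Q j)) //; case: (P i); rewrite ?mul1n ?mul0n //.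
exact: count_pred0.
Qed.

Lemma size_le_sum_count {I : eqType} (M : nat) (P : nat -> pred I) (r : seq I) :
  (forall x, x \in r -> exists2 i, (i < M)%N & P i x) ->
  (size r <= \sum_(0 <= i < M) count (P i) r)%N.
Proof.
elim: r => [|x r IHr] H; first by [].
rewrite /= big_split /= -add1n leq_add //; last by apply: IHr => y yr; apply: H; rewrite inE yr orbT.
have [i iM Pi] := H x (mem_head _ _).
by rewrite (bigD1_seq i) ?mem_index_iota ?iota_uniq //= Pi.
Qed.

Section cover_enlargement.
Context {R : realType} {V : normedModType R}.
Implicit Types (U : set V) (s e d : R).

(* Doubling the diameter and adding a term depending on e makes the radius
   positive even for singletons. *)
Lemma ball_of_cover s e U : 0 <= s -> 0 < e -> (diam U <= 1)%E -> U !=set0 ->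
  exists z rho, [/\ 0 < rho, forall y, U y -> `|y - z| < rho &
   ((rho `^ s)%:E <= (2 `^ s)%:E * hausdorff_gauge s U + e%:E)%E].
Proof.
move=> s0 e0 U1 U0; have dU0 := diam_ge0 U0.
have dfin : diam U \is a fin_num by rewrite ge0_fin_numE // (le_lt_trans U1) // ltry.
have [d dE] : exists d : R, diam U = d%:E by exists (fine (diam U)); rewrite fineK.
have d0 : 0 <= d by rewrite dE lee_fin in dU0.
case: (U0) => z Uz.
have Ud y : U y -> `|y - z| <= d.
  move=> Uy; rewrite -lee_fin -dE; apply: ereal_sup_ubound.
  by exists (y, z).
have gE : hausdorff_gauge s U = (d `^ s)%:E.
  rewrite /hausdorff_gauge; case: pselect => h /=; last by rewrite dE poweR_EFin.
  by rewrite h in Uz.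
have [s_eq0|s_neq0] := eqVneq s 0.
  exists z, (d + 1); split; first by lra.
    by move=> y /Ud; lra.
  by rewrite gE s_eq0 !powRr0 mule1 -EFinD lee_fin lerDl ltW.
have sgt0 : 0 < s by rewrite lt_def s_neq0.
have t0 : 0 < e `^ s^-1 by rewrite powR_gt0.
exists z, (Num.max (2 * d) (e `^ s^-1)); split.
- by rewrite lt_max t0 orbT.
- move=> y /Ud yz; rewrite lt_max; have [d_eq0|d_neq0] := eqVneq d 0.
    by apply/orP; right; apply: le_lt_trans t0; rewrite -d_eq0.
  apply/orP; left; have d_gt0 : 0 < d by rewrite lt_def d_neq0.
  by lra.
rewrite gE -EFinM -EFinD lee_fin -powRM //.
case: (leP (2 * d) _) => _; last by rewrite lerDl ltW.
by rewrite -powRrM mulVf // powRr1 ?(ltW e0) // lerDr powR_ge0.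
Qed.

End cover_enlargement.

(** * The mass distribution principle in combinatorial form *)

Section mass_distribution.
Context {R : realType} (beta : R) (beta_gt1 : 1 < beta) (s C : R).
Local Notation full := (full beta).
Local Notation pow_gt0 := (pow_gt0 beta_gt1).
Local Notation powV_gt0 := (powV_gt0 beta_gt1).
Implicit Types (x y z c d r a b e rho : R) (n m i j k : nat).

(** A Frostman condition: the uniform measure on the product of [X] and [Y] gives mass at most C r^s
    to squares of radius [r], for [r] above the resolution of the level. *)
Definition level_bound L (X Y : seq R) := forall r, beta ^- L <= r ->
  exists DX DY : nat, [/\ forall y, (count_ball X y r <= DX)%N,
    forall y, (count_ball Y y r <= DY)%N &
    DX%:R * DY%:R <= C * r `^ s * ((size X)%:R * (size Y)%:R)].

Variables (L : nat -> nat) (X Y : nat -> seq R).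
Hypotheses (s_ge0 : 0 <= s) (C_ge1 : 1 <= C) (L_gt0 : forall j, (0 < L j)%N)
  (X_uniq : forall j, uniq (X j)) (Y_uniq : forall j, uniq (Y j))
  (X_full : forall j, {in X j, forall c, full (L j) c})
  (Y_full : forall j, {in Y j, forall c, full (L j) c})
  (XY_bound : forall j, level_bound (L j) (X j) (Y j))
  (XY_size : forall j, (beta ^+ L j) `^ s <= (size (X j))%:R * (size (Y j))%:R).

Local Notation nX := (nodes beta L X).
Local Notation nY := (nodes beta L Y).
Local Notation p := (depth L).

Let XY_neq0 j : (0 < size (X j))%N /\ (0 < size (Y j))%N.
Proof.
have : 0 < (size (X j))%:R * (size (Y j))%:R :> R.
  by apply: lt_le_trans (XY_size j); rewrite powR_gt0 // pow_gt0.
by rewrite -natrM ltr0n muln_gt0 => /andP.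
Qed.

Let X_neq0 j : (0 < size (X j))%N. Proof. by have [] := XY_neq0 j. Qed.
Let Y_neq0 j : (0 < size (Y j))%N. Proof. by have [] := XY_neq0 j. Qed.

(** The earlier generations enter only through this estimate, so that the constant [C] does not
    accumulate over the levels. *)
Let size_nodes_ge n : (beta ^+ p n) `^ s <= (size (nX n))%:R * (size (nY n))%:R.
Proof.
elim: n => [|n IHn]; first by rewrite depth0 expr0 powR1 /= mulr1.
rewrite depthS exprD powRM ?(ltW (pow_gt0 _)) //= !size_compseq !natrM.
by rewrite mulrACA ler_pM ?powR_ge0.
Qed.

(** The Frostman condition is applied in the single generation [j] whose scales enclose [2 * rho].
    The factor 36 = 6 * 6 comes from [count_nodes] in each coordinate, and [4 * rho] from the
    doubled radius there. *)
Lemma count_nodes_pair n rho x y : beta ^- p n <= rho ->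
  (count_ball (nX n) x (2 * rho))%:R * (count_ball (nY n) y (2 * rho))%:R <=
  36 * C * (4 * rho) `^ s * ((size (nX n))%:R * (size (nY n))%:R).
Proof.
move=> n_rho; have n0 := powV_gt0 (p n); have rho0 : 0 < rho by exact: lt_le_trans n_rho.
have [r1|r1] := leP 1 (2 * rho).
  apply: le_trans (_ : (size (nX n))%:R * (size (nY n))%:R <= _).
    by rewrite ler_pM // ler_nat count_size.
  rewrite ler_peMl ?mulr_ge0 //.
  have : 1 <= (4 * rho) `^ s.
    by rewrite -[leLHS](powRr0 (4 * rho)) ler_powR //; lra.
  have : 1 <= 36 * C by have := C_ge1; lra.
  by move=> H1 H2; rewrite -[leLHS]mulr1 ler_pM.
have [j [jn j1 j2]] : exists j, [/\ (j < n)%N, beta ^- p j.+1 < 2 * rho & 2 * rho <= beta ^- p j].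
  have ex : exists k, beta ^- p k < 2 * rho by exists n; lra.
  case: (ex_minnP ex) => -[|j] Pj jmin.
    by move: Pj; rewrite depth0 expr0 invr1; lra.
  exists j; split => //; first by apply: jmin; lra.
  by rewrite leNgt; apply/negP => /jmin; rewrite ltnn.
pose Q := beta ^+ p j; have Q0 : 0 < Q by exact: pow_gt0.
have rL : beta ^- L j <= 2 * (2 * rho * Q).
  have rQ : 0 < 2 * rho * Q by rewrite !mulr_gt0.
  apply: le_trans (_ : 2 * rho * Q <= _); last by lra.
  by rewrite -ler_pdivrMr // /Q -invfM mulrC -exprD -depthS ltW.
have [DX [DY [XD YD DXY]]] := XY_bound rL.
have j12 : beta ^- p j.+1 <= 2 * rho <= beta ^- p j by rewrite ltW.
have cX := count_nodes beta_gt1 X_uniq X_full x jn j12 XD.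
have cY := count_nodes beta_gt1 Y_uniq Y_full y jn j12 YD.
rewrite !(size_nodes _ _ _ jn) -natrM.
apply: le_trans (_ : (6 * (DX * size (rest beta L X j.+1 (n - j.+1))) *
   (6 * (DY * size (rest beta L Y j.+1 (n - j.+1)))))%:R <= _).
  by rewrite ler_nat leq_mul.
move: (size (rest _ _ X _ _)) (size (rest _ _ Y _ _)) => sX sY.
rewrite !natrM (_ : _ * _ = 36 * (sX%:R * sY%:R) * (DX%:R * DY%:R)); last by ring.
apply: le_trans (ler_wpM2l _ DXY) _; first by rewrite !mulr_ge0.
rewrite (_ : 2 * (2 * rho * Q) = (4 * rho) * Q); last by ring.
rewrite powRM ?(ltW Q0) //; last by lra.
have := size_nodes_ge j; rewrite -/Q.
move: (size (nX j))%:R (size (nY j))%:R (size (X j)) (size (Y j)) => u v a b H.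
rewrite [leLHS](_ : _ = 36 * C * (4 * rho) `^ s * (sX%:R * sY%:R * (a%:R * b%:R)) * Q `^ s); last by ring.
apply: le_trans (ler_wpM2l _ H) _.
  by rewrite !mulr_ge0 ?powR_ge0 //; have := C_ge1; lra.
by rewrite le_eqVlt; apply/orP; left; apply/eqP; ring.
Qed.

Let pV_small e : 0 < e -> exists N, forall n, (N <= n)%N -> beta ^- p n < e.
Proof.
move=> /(powV_small beta_gt1)[N NP]; exists N => n Nn; apply: NP.
exact: leq_trans Nn (leq_depth L_gt0 n).
Qed.

(* Compactness of the coding space, in the form of Koenig's lemma. *)
Lemma finite_subcover (O : nat -> set (R * R)) :
  (forall i x y, O i (x, y) -> exists2 e, 0 < e &
     forall x' y', `|x - x'| <= e -> `|y - y'| <= e -> O i (x', y')) ->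
  (forall u x v y, coded beta L X u x -> coded beta L Y v y -> exists i, O i (x, y)) ->
  exists M, forall u x v y, coded beta L X u x -> coded beta L Y v y ->
    exists2 i, (i < M)%N & O i (x, y).
Proof.
move=> Oopen Ocov.
(* A pair of nodes is good when finitely many of the sets cover everything coded through it. A bad
   pair has a bad child, as there are finitely many children; a branch of bad pairs ends at a point
   of some open [O i], which contains a whole node of that branch. *)
pose good n a b := exists M, forall u x v y, coded beta L X u x -> coded beta L Y v y ->
  base beta L u n = a -> base beta L v n = b -> exists2 i, (i < M)%N & O i (x, y).
suff [M HM] : good 0%N 0 0.
  by exists M => u x v y ux vy; apply: HM ux vy _ _; exact: base0.
apply: contrapT => bad0.
have bad_step (nab : nat * (R * R)) : exists cd : R * R, ~ good nab.1 nab.2.1 nab.2.2 ->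
    [/\ cd.1 \in X nab.1, cd.2 \in Y nab.1 &
      ~ good nab.1.+1 (nab.2.1 + cd.1 * beta ^- p nab.1) (nab.2.2 + cd.2 * beta ^- p nab.1)].
  case: nab => n [a b] /=.
  have [gd|bd] := pselect (good n a b); first by exists (0, 0).
  apply: contrapT => H; apply: bd.
  have /choice[M MP] (cd : R * R) : exists M, cd.1 \in X n -> cd.2 \in Y n ->
      forall u x v y, coded beta L X u x -> coded beta L Y v y ->
      base beta L u n.+1 = a + cd.1 * beta ^- p n -> base beta L v n.+1 = b + cd.2 * beta ^- p n ->
      exists2 i, (i < M)%N & O i (x, y).
    have [cX|] := boolP (cd.1 \in X n); last by exists 0%N.
    have [dY|] := boolP (cd.2 \in Y n); last by exists 0%N.
    have [[M MP]|nM] := pselect (good n.+1 (a + cd.1 * beta ^- p n) (b + cd.2 * beta ^- p n)).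
      by exists M.
    by exfalso; apply: H; exists cd.
  exists (\max_(cd <- [seq (c, d) | c <- X n, d <- Y n]) M cd) => u x v y ux vy ua vb.
  have [uX _] := ux n; have [vY _] := vy n.
  have ua' : base beta L u n.+1 = a + u n * beta ^- p n by rewrite baseS ua.
  have vb' : base beta L v n.+1 = b + v n * beta ^- p n by rewrite baseS vb.
  have [i iM Oi] := MP (u n, v n) uX vY u x v y ux vy ua' vb'.
  exists i => //; apply: leq_trans iM _; apply: leq_bigmax_seq => //.
  by apply/allpairsP; exists (u n, v n).
have {bad_step} [F FP] := choice bad_step.
pose st := fix st n : R * R := if n is m.+1 then
  ((st m).1 + (F (m, st m)).1 * beta ^- p m, (st m).2 + (F (m, st m)).2 * beta ^- p m) else (0, 0).
have st_bad n : ~ good n (st n).1 (st n).2.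
  by elim: n => [//|n IHn]; have [_ _] := FP (n, st n) IHn.
pose u n := (F (n, st n)).1; pose v n := (F (n, st n)).2.
have uX n : u n \in X n by have [] := FP (n, st n) (st_bad n).
have vY n : v n \in Y n by have [] := FP (n, st n) (st_bad n).
have ub n : base beta L u n = (st n).1.
  by elim: n => [|n IHn]; [rewrite base0|rewrite baseS IHn].
have vb n : base beta L v n = (st n).2.
  by elim: n => [|n IHn]; [rewrite base0|rewrite baseS IHn].
have [x ux] := coded_exists beta_gt1 X_full uX; have [y vy] := coded_exists beta_gt1 Y_full vY.
have [i Oi] := Ocov _ _ _ _ ux vy; have [e e0 eP] := Oopen i x y Oi.
have [n /(_ n (leqnn n)) ne] := pV_small e0.
apply: (st_bad n); exists i.+1 => u' x' v' y' ux' vy' ub' vb'; exists i => //.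
apply: eP; apply: le_trans (ltW ne).
  by apply: coded_dist ux ux' _; rewrite ub ub'.
by apply: coded_dist vy vy' _; rewrite vb vb'.
Qed.

(** A cover with small gauge sum is enlarged to open balls and made finite. At a generation finer
    than all radii, each pair of nodes lies in some doubled ball, and counting all pairs by
    [count_nodes_pair] would give 1 <= 1/2. *)
Lemma mass_distribution (E : set (R * R)) :
  (forall u x v y, coded beta L X u x -> coded beta L Y v y -> E (x, y)) ->
  hausdorff_measure s E <> 0%E.
Proof.
move=> HE /hausdorff_measure_eq0P H.
pose c := 36 * C * 4 `^ s; have c0 : 0 < c by rewrite !mulr_gt0 ?powR_gt0 //; have := C_ge1; lra.
have t0 : 0 < 2 `^ s + 1 :> R by rewrite addr_gt0 // powR_gt0.
pose e := (2 * c * (2 `^ s + 1))^-1; have e0 : 0 < e by rewrite /e invr_gt0 mulr_gt0 // mulr_gt0.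
have [U [EU U1 sumU]] := H 1 ltr01 e e0.
have e2 i : 0 < e / 2 ^+ i.+1 by rewrite divr_gt0 // exprn_gt0.
have /choice[zr zrP] i : exists zr : (R * R) * R, U i !=set0 ->
    [/\ 0 < zr.2, forall y : R * R, U i y -> `|y - zr.1| < zr.2 &
    ((zr.2 `^ s)%:E <= (2 `^ s)%:E * hausdorff_gauge s (U i) + (e / 2 ^+ i.+1)%:E)%E].
  have [U0|nU] := pselect (U i !=set0); last by exists (0, 0).
  by have [z [rho HH]] := ball_of_cover s_ge0 (e2 i) (U1 i) U0; exists (z, rho).
pose O i := [set z : R * R | U i !=set0 /\ `|z - (zr i).1| < (zr i).2].
have [||M MP] := finite_subcover (O := O).
- move=> i x y [U0 /= xy]; pose d := (zr i).2 - `|(x, y) - (zr i).1|.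
  have d0 : 0 < d by rewrite subr_gt0.
  exists (d / 2); first by rewrite divr_gt0.
  move=> x' y' xx' yy'; split => //=.
  have -> : (x', y') - (zr i).1 = ((x, y) - (zr i).1) - ((x, y) - (x', y')).
    by rewrite opprB [RHS]addrC addrA subrK.
  apply: le_lt_trans (ler_normB _ _) _.
  have : `|(x, y) - (x', y')| <= d / 2 by rewrite prod_normE ge_max /= xx' yy'.
  by rewrite /d; lra.
- move=> u x v y ux vy; have [i _ Ui] := EU _ (HE _ _ _ _ ux vy).
  by exists i; split; [exists (x, y)|have [|_ + _] := zrP i; [exists (x, y)|apply]].
(* For an empty [U i] the chosen radius is arbitrary, so such indices are discarded. *)
pose active i := `[< U i !=set0 >].
have [n nP] : exists n, forall i, (i < M)%N -> active i -> beta ^- p n <= (zr i).2.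
  elim: M {MP} => [|M [N NP]]; first by exists 0%N.
  have [aM|naM] := boolP (active M); last first.
    exists N => i; rewrite ltnS leq_eqVlt => /predU1P[->|iM]; first by rewrite (negbTE naM).
    exact: NP.
  have [r0 _ _] := zrP M (asboolW aM); have [N' N'P] := pV_small r0.
  exists (maxn N N') => i; rewrite ltnS leq_eqVlt => /predU1P[-> _|iM ai].
    by apply/ltW/N'P; rewrite leq_maxr.
  apply: le_trans (NP i iM ai); rewrite lef_pV2 ?posrE ?pow_gt0 // ler_eXn2l //.
  have : forall n m, (n <= m)%N -> (p n <= p m)%N.
    by move=> n m /subnKC<-; elim: (m - n)%N => [|k IHk]; rewrite ?addn0 // addnS depthS (leq_trans IHk) // leq_addr.
  by apply; rewrite leq_maxl.
pose P i (ab : R * R) := active i && ((`|ab.1 - (zr i).1.1| <= 2 * (zr i).2) &&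
   (`|ab.2 - (zr i).1.2| <= 2 * (zr i).2)).
have /size_le_sum_count : forall ab, ab \in [seq (a, b) | a <- nX n, b <- nY n] ->
    exists2 i, (i < M)%N & P i ab.
  move=> _ /allpairsP[[a b] [/= an bn ->]].
  have [u uX ua] := nodes_base X_neq0 an; have [v vY vb] := nodes_base Y_neq0 bn.
  have [x ux] := coded_exists beta_gt1 X_full uX; have [y vy] := coded_exists beta_gt1 Y_full vY.
  have [i iM [U0 /= Oi]] := MP _ _ _ _ ux vy.
  exists i => //; have ai : active i by exact/asboolP.
  rewrite /P ai /=; have ni := nP i iM ai.
  have [_ /andP[a1 a2]] := ux n; have [_ /andP[b1 b2]] := vy n; rewrite ua in a1 a2; rewrite vb in b1 b2.
  have : `|x - (zr i).1.1| < (zr i).2 /\ `|y - (zr i).1.2| < (zr i).2.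
    by move: Oi; rewrite prod_normE gt_max => /andP[].
  by rewrite !ltr_norml => -[/andP[? ?] /andP[? ?]]; apply/andP; split;
    rewrite ler_norml; apply/andP; split; lra.
rewrite size_allpairs.
have nXY : 0 < (size (nX n))%:R * (size (nY n))%:R :> R.
  by apply: lt_le_trans (size_nodes_ge n); rewrite powR_gt0 // pow_gt0.
rewrite -(ler_nat R) natrM natr_sum.
have sumR : \sum_(0 <= i < M) ((count (P i) [seq (a, b) | a <- nX n, b <- nY n])%:R : R) <=
   \sum_(0 <= i < M | active i) c * (zr i).2 `^ s * ((size (nX n))%:R * (size (nY n))%:R).
  rewrite [leRHS]big_mkcond /= big_nat [leRHS]big_nat; apply: ler_sum => i /andP[_ iM].
  case: ifP => ai; last by rewrite /P ai count_pred0.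
  have -> : count (P i) [seq (a, b) | a <- nX n, b <- nY n] =
      (count_ball (nX n) (zr i).1.1 (2 * (zr i).2) * count_ball (nY n) (zr i).1.2 (2 * (zr i).2))%N.
    by rewrite /count_ball -count_allpairs_pair; apply: eq_count => ab; rewrite /P ai.
  have [r0 _ _] := zrP i (asboolW ai).
  rewrite natrM; apply: le_trans (count_nodes_pair _ _ (nP i iM ai)) _.
  by rewrite powRM ?(ltW r0) // /c !mulrA.
move=> /le_trans/(_ sumR); rewrite -mulr_suml -{1}[X in X <= _]mul1r ler_pM2r //.
rewrite -mulr_sumr leNgt => /negP; apply.
have sumE : ((\sum_(0 <= i < M | active i) (zr i).2 `^ s)%:E <= ((2 `^ s + 1) * e)%:E)%E.
  rewrite -sumEFin mulrDl mul1r EFinD.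
  apply: le_trans (_ : (\sum_(0 <= i < M) ((2 `^ s)%:E * hausdorff_gauge s (U i) + (e / 2 ^+ i.+1)%:E))%E <= _)%E.
    rewrite big_mkcond /=; apply: lee_sum => i _; case: ifP => ai.
      by have [_ _] := zrP i (asboolW ai).
    by rewrite adde_ge0 ?mule_ge0 ?gauge_ge0 ?lee_fin ?powR_ge0 // ltW.
  rewrite big_split /=; apply: leeD.
    rewrite -ge0_sume_distrr; last by move=> i _; exact: gauge_ge0.
    rewrite EFinM; apply: lee_wpmul2l; first by rewrite lee_fin powR_ge0.
    apply: le_trans sumU; apply: nneseries_lim_ge => i _ _; exact: gauge_ge0.
  rewrite sumEFin lee_fin.
  have -> : \sum_(0 <= i < M) e / 2 ^+ i.+1 = e * (1 - 1 / 2 ^+ M).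
    elim: M {MP nP sumR} => [|M IHM]; first by rewrite big_nil expr0 divr1 subrr mulr0.
    by rewrite big_nat_recr //= IHM exprS; field; rewrite expf_neq0.
  by rewrite ler_piMr ?(ltW e0) // gerBl divr_ge0 // exprn_ge0.
rewrite lee_fin in sumE; apply: le_lt_trans (ler_wpM2l (ltW c0) sumE) _.
have -> : c * ((2 `^ s + 1) * e) = 2^-1.
  by rewrite /e; field; rewrite !gt_eqF.
by lra.
Qed.

End mass_distribution.

(** * The lower bound *)

Section powers.
Context {R : realType} (beta : R) (beta_gt1 : 1 < beta).
Local Notation T := (beta_map beta).
Local Notation S := (birkhoff beta).
Local Notation full := (full beta).
Local Notation pow_gt0 := (pow_gt0 beta_gt1).
Local Notation powV_gt0 := (powV_gt0 beta_gt1).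
Implicit Types (x y z c d r : R) (N n m i j k l : nat) (U B : seq R).

Definition powseq N U k B := iter k (compseq beta N U) B.

Lemma size_powseq N U k B : size (powseq N U k B) = (size U ^ k * size B)%N.
Proof. by elim: k => [|k IHk]; rewrite ?mul1n //= size_compseq IHk mulnA expnS. Qed.

Lemma powseqD N U i j B : powseq N U (i + j) B = powseq N U i (powseq N U j B).
Proof. exact: iterD. Qed.

Lemma powseqE N U k B :
  powseq N U k B = compseq beta (N * k) (powseq N U k [:: 0]) B.
Proof.
elim: k => [|k IHk] /=; first by rewrite muln0 compseq01.
by rewrite {1}IHk compseqA mulnS.
Qed.

Section blocks.
Variables (N : nat) (U : seq R).
Hypotheses (U_uniq : uniq U) (U_full : {in U, forall c, full N c}).

Lemma powseq_full k l B : {in B, forall c, full l c} ->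
  {in powseq N U k B, forall c, full (N * k + l) c}.
Proof.
move=> fB; elim: k => [|k IHk] /=; first by rewrite muln0.
by rewrite mulnS -addnA; exact: compseq_full.
Qed.

Lemma powseq_uniq k l B : uniq B -> {in B, forall c, full l c} -> uniq (powseq N U k B).
Proof.
move=> uB fB; elim: k => //= k IHk; apply: compseq_uniq => // b /(powseq_full fB).
exact: full_itv.
Qed.

Lemma powseq_proper k l B : {in B, forall c, c + beta ^- l < 1} ->
  {in powseq N U k B, forall c, c + beta ^- (N * k + l) < 1}.
Proof.
move=> pB; elim: k => [|k IHk] /=; first by rewrite muln0.
move=> _ /mem_compseq[u [b [/U_full[_ u1 _ _] /IHk b1 ->]]].
apply: lt_le_trans u1; rewrite mulnS -addnA powVD -addrA ltrD2l.
by rewrite [X in _ + X]mulrC -mulrDl -[ltRHS]mul1r ltr_pM2r ?powV_gt0.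
Qed.

(** The hypothesis bounds the Birkhoff sum on the whole cylinder of each block, whatever follows, so
    the bounds add without distortion. *)
Lemma powseq_orbit k l B c y (h : R -> R) a : {in B, forall c, full l c} ->
  (forall u y, u \in U -> 0 <= y < 1 -> S N h (u + y * beta ^- N) <= N%:R * a) ->
  c \in powseq N U k B -> 0 <= y < 1 ->
  (exists2 b, b \in B &
    iter (N * k) T (c + y * beta ^- (N * k + l)) = b + y * beta ^- l) /\
  S (N * k) h (c + y * beta ^- (N * k + l)) <= k%:R * (N%:R * a).
Proof.
move=> fB hU + y01; elim: k c => [|k IHk] c /=.
  move=> cB; rewrite muln0 birkhoff0 mul0r; split => //.
  by exists c; rewrite //= add0n.
move=> /mem_compseq[u [b [uU bk ->]]].
have [[b' b'B b'E] Sb] := IHk b bk.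
set w := b + y * beta ^- (N * k + l) in b'E Sb.
have w01 : 0 <= w < 1 by apply: full_point_itv y01 => //; exact: powseq_full fB _ bk.
have zE : u + b * beta ^- N + y * beta ^- (N * k.+1 + l) = u + w * beta ^- N.
  by rewrite mulnS -addnA powVD /w; ring.
have Tw : iter N T (u + w * beta ^- N) = w.
  by rewrite -[N in iter N]add0n (full_iter beta_gt1 0 (U_full uU) w01).
rewrite zE mulnS; split.
  by exists b' => //; rewrite addnC iterD Tw.
rewrite birkhoffD Tw (_ : k.+1%:R * _ = N%:R * a + k%:R * (N%:R * a)).
  by rewrite lerD // hU.
by rewrite -natr1; ring.
Qed.

Lemma count_powseq k l B x r (D : nat) : {in B, forall c, full l c} ->
  0 <= r <= beta ^- (N * k) ->
  (forall y, count_ball B y (r * beta ^+ (N * k)) <= D)%N ->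
  (count_ball (powseq N U k B) x r <= 6 * D)%N.
Proof.
move=> fB rk BD; rewrite powseqE; apply: count_compseq => //.
- apply: (@powseq_uniq k 0) => // c; rewrite inE => /eqP->; exact: full0.
- rewrite -[(N * k)%N]addn0; apply: powseq_full => c; rewrite inE => /eqP->; exact: full0.
- by move=> b /fB/(full_itv beta_gt1)/andP[-> /ltW->].
Qed.

(** The ball determines the first [i] blocks up to 6 choices and leaves the others free. *)
Lemma count_powseq_le k i l B x r : {in B, forall c, full l c} -> (i <= k)%N ->
  0 <= r <= beta ^- (N * i) ->
  (count_ball (powseq N U k B) x r <= 6 * (size U ^ (k - i) * size B))%N.
Proof.
move=> fB ik ri; rewrite -{1}(subnKC ik) powseqD.
apply: (@count_powseq i (N * (k - i) + l)) => //; first exact: powseq_full.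
by move=> y; rewrite -(size_powseq N); exact: count_size.
Qed.

End blocks.
End powers.

Section exponents.
Context {R : realType}.
Implicit Types (s K a b d tau Lam mu la rho kap : R).

(** Here K is the length of the block part and [mu], later [la], is ln beta times the length of the
    target word near y0, resp. x0. The rounding error [Lam] and the surplus over [b] cost [d / 4]
    each. *)
Lemma exponent_mu s K a b d tau Lam mu : 0 <= s -> 0 <= K -> s * b <= tau ->
  mu <= K * (b + d / (4 * (s + 1))) + Lam -> 0 <= d -> 0 <= Lam ->
  (s + 1) * Lam <= K * (d / 4) -> s * mu <= K * (tau + d / 2).
Proof.
move=> s0 K0 sb muL d0 L0 sL.
have sd : s * (d / (4 * (s + 1))) <= d / 4.
  rewrite mulrA ler_pdivrMr; last by lra.
  have : 0 <= s * d by rewrite mulr_ge0.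
  by lra.
have := ler_wpM2l s0 muL; have := ler_wpM2l K0 sb; have := ler_wpM2l K0 sd.
by lra.
Qed.

Lemma exponent_la s K a b d tau Lam mu la : 0 <= s -> 0 <= K ->
  (s - 1) * a + b <= tau ->
  mu <= K * (b + d / (4 * (s + 1))) + Lam ->
  K * (a + d / (4 * (s + 1))) <= la <= K * (a + d / (4 * (s + 1))) + Lam ->
  0 <= d -> 0 <= Lam ->
  (s + 1) * Lam <= K * (d / 4) -> (s - 1) * la + mu <= K * (tau + d / 2).
Proof.
move=> s0 K0 sab muL /andP[la1 la2] d0 L0 sL.
set d1 := d / (4 * (s + 1)) in muL la1 la2.
have d10 : 0 <= d1 by rewrite divr_ge0 //; lra.
have sd : s * d1 <= d / 4.
  rewrite mulrA ler_pdivrMr; last by lra.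
  have : 0 <= s * d by rewrite mulr_ge0.
  by lra.
have HK := ler_wpM2l K0 sab; have HS := ler_wpM2l K0 sd.
have [s1|s1] := leP 1 s.
  have s10 : 0 <= s - 1 by lra.
  have := ler_wpM2l s10 la2; lra.
have s10 : s - 1 <= 0 by lra.
have := ler_wnM2l s10 la1; have := mulr_ge0 s0 L0; lra.
Qed.

(** The left-hand side is affine in [rho], hence largest at an end of the range; the two ends are
    the two hypotheses on the exponents. *)
Lemma exponent_rho s K d tau kap mu la rho : kap + mu <= rho <= kap + la ->
  s * mu <= K * (tau + d / 2) -> (s - 1) * la + mu <= K * (tau + d / 2) ->
  (s - 1) * rho + kap + mu <= s * kap + K * (tau + d / 2).
Proof.
move=> /andP[r1 r2] E1 E2; have [s1|s1] := leP 1 s.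
  have s10 : 0 <= s - 1 by lra.
  have := ler_wpM2l s10 r2; lra.
have s10 : s - 1 <= 0 by lra.
have := ler_wnM2l s10 r1; lra.
Qed.

End exponents.

(** * Size and ball counts of one level *)

Section level_counting.
Context {R : realType} (beta : R) (beta_gt1 : 1 < beta).
Local Notation T := (beta_map beta).
Local Notation S := (birkhoff beta).
Local Notation full := (full beta).
Local Notation full_seq := (full_seq beta).
Local Notation pow_gt0 := (pow_gt0 beta_gt1).
Local Notation powV_gt0 := (powV_gt0 beta_gt1).
Local Notation Lam := (ln beta).

Lemma pow_expR n : beta ^+ n = expR (n%:R * Lam).
Proof. by rewrite expRM_natl lnK // posrE (beta_gt0 beta_gt1). Qed.

Lemma powV_expR n : beta ^- n = expR (- (n%:R * Lam)).
Proof. by rewrite expRN pow_expR. Qed.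

Lemma powR_pow n s : (beta ^+ n) `^ s = expR (s * (n%:R * Lam)).
Proof. by rewrite pow_expR -expRM mulrC. Qed.

Variables (s tau d : R) (N k l m : nat) (U V : seq R) (t t' : R).
Hypotheses (s_ge0 : 0 <= s) (U_uniq : uniq U) (V_uniq : uniq V)
  (U_full : {in U, forall c, full N c}) (V_full : {in V, forall c, full N c})
  (t_full : full l t) (t'_full : full m t') (ml : (m <= l)%N)
  (sizeUV1 : (beta ^+ N) `^ s <= (size U)%:R * (size V)%:R)
  (sizeUV : expR ((N * k)%:R * (s * Lam + tau + d)) <= ((size U)%:R * (size V)%:R) ^+ k)
  (E1 : s * (m%:R * Lam) <= (N * k)%:R * (tau + d / 2))
  (E2 : (s - 1) * (l%:R * Lam) + m%:R * Lam <= (N * k)%:R * (tau + d / 2))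
  (E3 : 1728 * l.+1%:R <= expR ((N * k)%:R * (d / 4)))
  (d_ge0 : 0 <= d).

Let B := compseq beta m [:: t'] (full_seq (l - m)).
Definition level_X := powseq beta N U k [:: t].
Definition level_Y := powseq beta N V k B.
(* 36 = 6 * 6 comes from count_compseq, and the other factor from the radii
   between two consecutive block scales. *)
Let C := 36 * (beta ^+ N) `^ s.

Let fX : {in [:: t], forall c, full l c}.
Proof. by move=> c; rewrite inE => /eqP->. Qed.

Let ft' : {in [:: t'], forall c, full m c}.
Proof. by move=> c; rewrite inE => /eqP->. Qed.

Let fY : {in B, forall c, full l c}.
Proof.
have fF : {in full_seq (l - m), forall c, full (l - m) c}.
  by move=> c /(full_seqP beta_gt1).
by have := compseq_full beta_gt1 ft' fF; rewrite subnKC.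
Qed.

Let sizeB : size B = size (full_seq (l - m)).
Proof. by rewrite /B size_compseq mul1n. Qed.

Let Nk1 : 1 <= (beta ^+ N) `^ s.
Proof. by rewrite powR_pow -expR0 ler_expR mulr_ge0 // mulr_ge0 // ltW // ln_gt0. Qed.

(** At these radii only the free completion of the word [t'] is resolved; [count_full] bounds it by
    2 u + 2, at most 4 u as u >= 1. *)
Let countB y r : beta ^- l <= r * beta ^+ (N * k) <= beta ^- m ->
  (count_ball B y (r * beta ^+ (N * k)) <=
    6 * Num.truncn (4 * (r * beta ^+ (N * k + l))))%N.
Proof.
move=> /andP[r1 r2]; have r0 : 0 < r * beta ^+ (N * k) by exact: lt_le_trans (powV_gt0 l) r1.
apply: count_compseq => //.
- by move=> b /full_seq_itv; apply.
- by rewrite ltW.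
move=> z; rewrite truncn_ge_nat; last first.
  have r_gt0 : 0 < r by move: r0; rewrite pmulr_lgt0 ?pow_gt0.
  by rewrite !mulr_ge0 ?(ltW r_gt0) ?(ltW (pow_gt0 _)).
apply: le_trans (count_full beta_gt1 _ _ _ _) _.
- exact: full_seq_uniq.
- by move=> c /(full_seqP beta_gt1); exact.
- by rewrite mulr_ge0 // ltW // pow_gt0.
have E : r * beta ^+ (N * k) * beta ^+ m * beta ^+ (l - m) = r * beta ^+ (N * k + l).
  by rewrite -!mulrA -!exprD subnKC.
have : 1 <= r * beta ^+ (N * k + l).
  by rewrite exprD mulrA -ler_pdivrMr ?pow_gt0 // mul1r.
by lra.
Qed.

Let size_full_ge : (beta ^+ (l - m)) <= 2 * l.+1%:R * (size (full_seq (l - m)))%:R.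
Proof.
apply: le_trans (size_full_seq_ge beta_gt1 (l - m)) _.
by rewrite ler_wpM2r // ler_wpM2l // ler_nat ltnS leq_subr.
Qed.

(** The [l - m] free digits contribute beta^(l - m) up to a linear factor. By [E2] the gain
    [tau + d] per block step pays for the targets, which carry no other choice, with room left for
    [E3]. *)
Lemma level_size : (beta ^+ (N * k + l)) `^ s <= (size level_X)%:R * (size level_Y)%:R.
Proof.
rewrite !size_powseq muln1 sizeB !natrM !natrX mulrA -exprMn.
have : expR ((N * k)%:R * (s * Lam + tau + d)) * expR ((l - m)%:R * Lam) <=
   ((size U)%:R * (size V)%:R) ^+ k * (2 * l.+1%:R * (size (full_seq (l - m)))%:R).
  by rewrite ler_pM ?expR_ge0 // -pow_expR.
have l0 : 0 < 2 * l.+1%:R :> R by rewrite mulr_gt0.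
rewrite mulrCA -ler_pdivrMl // => /(le_trans _); apply.
rewrite ler_pdivlMl //.
have : 2 * l.+1%:R <= expR ((N * k)%:R * (d / 4)).
  by apply: le_trans E3; rewrite ler_wpM2r //; lra.
move=> /(ler_wpM2r (powR_ge0 (beta ^+ (N * k + l)) s)) /le_trans; apply.
rewrite powR_pow -!expRD ler_expR natrD natrB //.
have := mulr_ge0 (ler0n R (N * k)) d_ge0; have := E2.
lra.
Qed.

(** Four ranges of [r]: at least 1; among the blocks; between the blocks and the end of the target
    near y0, where [E1] suffices; and beyond it, where the free digits are counted and both ends of
    the range matter. *)
Lemma level_XY_bound : level_bound beta s C (N * k + l) level_X level_Y.
Proof.
move=> r rL; have r0 : 0 < r by exact: lt_le_trans (powV_gt0 _) rL.
have sX : size level_X = (size U ^ k)%N by rewrite size_powseq muln1.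
have sY : size level_Y = (size V ^ k * size B)%N by rewrite size_powseq.
have [r1|r1] := leP 1 r.
  exists (size level_X), (size level_Y); split; try by move=> y; exact: count_size.
  rewrite ler_peMl ?mulr_ge0 //.
  have rs : 1 <= r `^ s by rewrite -[leLHS](powRr0 r) ler_powR.
  have C1 : 1 <= C by rewrite /C; have := Nk1; lra.
  by rewrite -[leLHS]mulr1 ler_pM.
have uvk0 : 0 < ((size U)%:R * (size V)%:R) ^+ k :> R.
  by apply: lt_le_trans sizeUV; exact: expR_gt0.
have [rk|rk] := ltP (beta ^- (N * k)) r.
  have [i [ik i1 i2]] : exists i, [/\ (i < k)%N, beta ^- (N * i.+1) < r & r <= beta ^- (N * i)].
    have ex : exists i, beta ^- (N * i) < r by exists k.
    case: (ex_minnP ex) => -[|i] Pi imin.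
      by move: Pi; rewrite muln0 expr0 invr1 ltNge (ltW r1).
    exists i; split => //; first exact: imin.
    by rewrite leNgt; apply/negP => /imin; rewrite ltnn.
  exists (6 * (size U ^ (k - i) * 1))%N, (6 * (size V ^ (k - i) * size B))%N.
  have ri : 0 <= r <= beta ^- (N * i) by rewrite ltW.
  split=> [y|y|].
  - exact: (count_powseq_le beta_gt1 U_uniq U_full y fX (ltnW ik) ri).
  - exact: (count_powseq_le beta_gt1 V_uniq V_full y fY (ltnW ik) ri).
  rewrite sX sY !natrM !natrX mulr1.
  rewrite (_ : 6 * _ * _ = 36 * ((size U)%:R * (size V)%:R) ^+ (k - i) * (size B)%:R); last first.
    by rewrite exprMn; ring.
  rewrite (_ : C * _ * _ = C * r `^ s * ((size U)%:R * (size V)%:R) ^+ k * (size B)%:R); last first.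
    by rewrite exprMn; ring.
  rewrite ler_wpM2r // -{2}(subnK (ltnW ik)) exprD [_ ^+ (k - i) * _]mulrC mulrA.
  rewrite ler_wpM2r ?exprn_ge0 ?mulr_ge0 // /C.
  have : ((beta ^+ N) `^ s) ^+ i <= ((size U)%:R * (size V)%:R) ^+ i.
    by rewrite lerXn2r ?nnegrE ?powR_ge0 ?mulr_ge0.
  have : (beta ^- (N * i.+1)) `^ s <= r `^ s.
    by rewrite ge0_ler_powR ?nnegrE ?(ltW r0) ?(ltW (powV_gt0 _)) // ltW.
  have e1 : (beta ^+ N) `^ s * (beta ^- (N * i.+1)) `^ s * ((beta ^+ N) `^ s) ^+ i = 1.
    rewrite powR_pow powV_expR -expRM -expRM_natl -!expRD -[RHS]expR0; congr expR.
    by rewrite natrM -natr1; ring.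
  move=> h1 h2; rewrite -[leLHS]mulr1 -[X in 36 * X <= _]e1 -!mulrA !ler_pM2l ?powR_gt0 ?pow_gt0 //.
  by rewrite ler_pM ?powR_ge0 ?exprn_ge0 ?powR_ge0.
have rk' : 0 <= r <= beta ^- (N * k) by rewrite ltW.
have cX y : (count_ball level_X y r <= 6)%N.
  rewrite -[6%N]muln1; apply: (count_powseq beta_gt1 U_uniq U_full y fX rk') => z.
  by rewrite /count_ball /= addn0; case: (_ <= _).
pose rho := - ln r; have rE : r = expR (- rho) by rewrite /rho opprK lnK.
have rsE : r `^ s = expR (- (s * rho)) by rewrite rE -expRM mulNr mulrC.
pose K : R := (N * k)%:R; have K0 : 0 <= K by exact: ler0n.
have Kd := mulr_ge0 K0 d_ge0.
have uvE := sizeUV; rewrite -/K in uvE.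
have C36 : 36 <= C by rewrite /C; have := Nk1; lra.
have [rm|rm] := ltP (beta ^- m) (r * beta ^+ (N * k)).
  exists 6%N, (6 * size B)%N; split=> [//|y|].
    apply: (count_powseq beta_gt1 V_uniq V_full y fY rk') => z; exact: count_size.
  rewrite sX sY !natrM !natrX.
  rewrite (_ : 6 * _ = 36 * (size B)%:R); last by ring.
  rewrite (_ : C * _ * _ = C * r `^ s * ((size U)%:R * (size V)%:R) ^+ k * (size B)%:R); last first.
    by rewrite exprMn; ring.
  rewrite ler_wpM2r // -[leLHS]mulr1 -mulrA ler_pM //.
  apply: le_trans (ler_wpM2l (powR_ge0 _ _) uvE); rewrite rsE -expRD -expR0 ler_expR.
  have : rho <= K * Lam + m%:R * Lam.
    move: rm; rewrite rE powV_expR pow_expR -expRD ltr_expR -/K; lra.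
  move=> /(ler_wpM2l s_ge0); have := E1; rewrite -/K; lra.
have rL' : beta ^- l <= r * beta ^+ (N * k).
  by rewrite -ler_pdivrMr ?pow_gt0 // -invfM mulrC -exprD.
have rlm : beta ^- l <= r * beta ^+ (N * k) <= beta ^- m by rewrite rL'.
pose D := Num.truncn (4 * (r * beta ^+ (N * k + l))).
exists 6%N, (6 * (6 * D))%N; split=> [//|y|].
  by apply: (count_powseq beta_gt1 V_uniq V_full y fY rk') => z; exact: countB.
have DE : D%:R <= 4 * (r * beta ^+ (N * k + l)).
  by rewrite truncn_le !mulr_ge0 ?(ltW r0) ?(ltW (pow_gt0 _)).
rewrite sX sY !natrM !natrX sizeB.
have l0 : 0 < 2 * l.+1%:R :> R by rewrite mulr_gt0.
have FB : (2 * l.+1%:R)^-1 * beta ^+ (l - m) <= (size (full_seq (l - m)))%:R.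
  by rewrite ler_pdivrMl.
set F := (size (full_seq (l - m)))%:R in FB *.
rewrite (_ : 6 * _ = 216 * D%:R); last by ring.
rewrite (_ : C * _ * _ = C * r `^ s * ((size U)%:R * (size V)%:R) ^+ k * F); last first.
  by rewrite exprMn; ring.
apply: le_trans (_ : 216 * (4 * (r * beta ^+ (N * k + l))) <= _); first by rewrite ler_wpM2l.
apply: le_trans (_ : 36 * expR (- (s * rho)) * expR (K * (s * Lam + tau + d)) *
    ((2 * l.+1%:R)^-1 * beta ^+ (l - m)) <= _); last first.
  rewrite rsE ler_pM ?mulr_ge0 ?expR_ge0 ?invr_ge0 ?(ltW l0) ?(ltW (pow_gt0 _)) //.
  rewrite ler_pM ?mulr_ge0 ?expR_ge0 //.
  by rewrite ler_wpM2r ?expR_ge0.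
rewrite mulrA [leRHS]mulrCA ler_pdivlMl //.
(* 1728 = 2 * 216 * 4 gathers the numerical factors, which [E3] absorbs. *)
apply: le_trans (_ : 36 * ((1728 * l.+1%:R) * (r * beta ^+ (N * k + l))) <= _).
  have : 0 <= l.+1%:R * (r * beta ^+ (N * k + l)).
    by rewrite !mulr_ge0 ?(ltW r0) ?(ltW (pow_gt0 _)).
  lra.
rewrite -!mulrA ler_pM2l //.
apply: le_trans (_ : expR (K * (d / 4)) * (r * beta ^+ (N * k + l)) <= _).
  by rewrite [leLHS]mulrA ler_wpM2r // mulr_ge0 ?(ltW r0) ?(ltW (pow_gt0 _)).
rewrite rE !pow_expR -!expRD ler_expR.
have r12 : K * Lam + m%:R * Lam <= rho <= K * Lam + l%:R * Lam.
  move: rm rL'; rewrite rE !powV_expR pow_expR -expRD !ler_expR -/K => h1 h2.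
  by apply/andP; split; lra.
have := exponent_rho r12 E1 E2; rewrite -/K natrD natrB // -/K.
lra.
Qed.

End level_counting.

(** * Levels that hit both targets *)

Section levels.
Context {R : realType} (beta : R) (beta_gt1 : 1 < beta).
Local Notation T := (beta_map beta).
Local Notation S := (birkhoff beta).
Local Notation full := (full beta).
Local Notation full_seq := (full_seq beta).
Local Notation pow_gt0 := (pow_gt0 beta_gt1).
Local Notation powV_gt0 := (powV_gt0 beta_gt1).
Local Notation Lam := (ln beta).

Lemma target_cylinder (x0 : R) l (c : R) : (0 < l)%N -> 0 <= x0 <= 1 ->
  beta * l.+1%:R * expR c <= expR (l%:R * Lam) ->
  exists t, [/\ full l t, t + beta ^- l < 1 &
    forall y, 0 <= y < 1 -> `|t + y * beta ^- l - x0| <= expR (- c)].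
Proof.
move=> l0 x01 H; have [t [ft t1 tx]] := full_proper_dense beta_gt1 l0 x01.
exists t; split => // y /tx/le_trans; apply.
by rewrite powV_expR // !expRN ler_pdivrMr ?expR_gt0 // ler_pdivlMl ?expR_gt0 // mulrC.
Qed.

(* tau1 controls the scales down to the target around y0, and tau2 those between
   the targets around y0 and x0. *)
Variables (s tau d a b x0 y0 : R) (f g : R -> R) (N : nat) (U V : seq R).
Hypotheses (s_ge0 : 0 <= s) (d_gt0 : 0 < d) (N_gt0 : (0 < N)%N)
  (b_ge0 : 0 <= b) (ba : b <= a) (tau1 : s * b <= tau) (tau2 : (s - 1) * a + b <= tau)
  (x0_itv : 0 <= x0 <= 1) (y0_itv : 0 <= y0 <= 1)
  (U_uniq : uniq U) (V_uniq : uniq V)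
  (U_full : {in U, forall c, full N c}) (V_full : {in V, forall c, full N c})
  (U_f : forall u y, u \in U -> 0 <= y < 1 -> S N f (u + y * beta ^- N) <= N%:R * a)
  (V_g : forall v y, v \in V -> 0 <= y < 1 -> S N g (v + y * beta ^- N) <= N%:R * b)
  (sizeUV : expR (N%:R * (s * Lam + tau + d)) <= (size U)%:R * (size V)%:R).

(* p bounds the Birkhoff sums accumulated before the level. *)
Record level (p : R) (L n : nat) (X Y : seq R) : Prop := Level {
  level_gt0 : (0 < L)%N;
  level_uniqX : uniq X;
  level_uniqY : uniq Y;
  level_fullX : {in X, forall c, full L c};
  level_fullY : {in Y, forall c, full L c};
  level_properX : {in X, forall c, c + beta ^- L < 1};
  level_properY : {in Y, forall c, c + beta ^- L < 1};
  level_boundXY : level_bound beta s (36 * (beta ^+ N) `^ s) L X Y;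
  level_sizeXY : (beta ^+ L) `^ s <= (size X)%:R * (size Y)%:R;
  level_hitX : forall c y, c \in X -> 0 <= y < 1 ->
    `|iter n T (c + y * beta ^- L) - x0| < expR (- (p + S n f (c + y * beta ^- L)));
  level_hitY : forall c y, c \in Y -> 0 <= y < 1 ->
    `|iter n T (c + y * beta ^- L) - y0| < expR (- (p + S n g (c + y * beta ^- L))) }.

(** After [k] blocks the Birkhoff sums are at most N k a and N k b, so target words of lengths
    slightly above N k a / ln beta and N k b / ln beta hit at time N k. A large [k] absorbs [p] and
    all polynomial factors. *)
Lemma level_exists p : exists L n X Y, level p L n X Y.
Proof.
have Lam0 : 0 < Lam by exact: ln_gt0.
have s4 : 0 < 4 * (s + 1) by rewrite mulr_gt0 //; have := s_ge0; lra.
pose d1 := d / (4 * (s + 1)); have d10 : 0 < d1 by rewrite divr_gt0.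
have N0 : 0 < N%:R :> R by rewrite ltr0n.
have a0 : 0 <= a by exact: le_trans b_ge0 ba.
have tau0 : 0 <= tau by apply: le_trans tau1; rewrite mulr_ge0.
(* The successor makes the inequality strict and overshoots by at most [ln beta]. *)
pose len (z : R) k := (Num.truncn ((N * k)%:R * (z + d1) / Lam)).+1.
have lenP z k : 0 <= z -> (N * k)%:R * (z + d1) < (len z k)%:R * Lam /\
    (len z k)%:R * Lam <= (N * k)%:R * (z + d1) + Lam.
  move=> z0; have /truncn_itv/andP[h1 h2] : 0 <= (N * k)%:R * (z + d1) / Lam.
    by rewrite divr_ge0 ?(ltW Lam0) // mulr_ge0 // addr_ge0 // ltW.
  split; first by rewrite -ltr_pdivrMr.
  by move: h1; rewrite ler_pdivlMr // /len -[_.+1%:R]natr1; lra.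
pose c0 := N%:R * (a + d1) / Lam + 2.
have c00 : 0 <= c0 by rewrite addr_ge0 // divr_ge0 ?(ltW Lam0) // mulr_ge0 // addr_ge0 // ltW.
have len_le k : (len a k).+1%:R <= c0 * k.+1%:R.
  have [_ H] := lenP a k a0.
  have : (len a k)%:R <= (N * k)%:R * (a + d1) / Lam + 1.
    by rewrite -(ler_pM2r Lam0) mulrDl divfK ?gt_eqF // mul1r.
  rewrite /c0 natrM -!natr1.
  have : 0 <= N%:R * (a + d1) / Lam.
    by rewrite divr_ge0 ?(ltW Lam0) // mulr_ge0 // addr_ge0 // ltW.
  have -> : N%:R * k%:R * (a + d1) / Lam = N%:R * (a + d1) / Lam * k%:R by ring.
  by move: (N%:R * (a + d1) / Lam) => w w0; have := ler0n R k; lra.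
have Nd : 0 < N%:R * (d / 4) by rewrite mulr_gt0 // divr_gt0.
have Nd1 : 0 < N%:R * d1 by rewrite mulr_gt0.
have [k [k1 k2 k3]] : exists k, [/\ (s + 1) * Lam <= (N * k)%:R * (d / 4),
    1728 * c0 * k.+1%:R <= expR ((N * k)%:R * (d / 4)) &
    beta * expR (p + 1) * c0 * k.+1%:R <= expR ((N * k)%:R * d1)].
  near (\oo : set_system nat) => k; exists k; split.
  - have : (s + 1) * Lam / (N%:R * (d / 4)) <= k%:R by near: k; exact: nbhs_infty_ger.
    by rewrite ler_pdivrMr // natrM; lra.
  - rewrite natrM [_ * (d / 4)]mulrAC; near: k; exact: near_linear_le_expR.
  - rewrite natrM [_ * d1]mulrAC; near: k; exact: near_linear_le_expR.
have kNK (z : R) : k%:R * (N%:R * z) = (N * k)%:R * z by rewrite natrM; ring.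
pose K : R := (N * k)%:R; have K0 : 0 <= K by exact: ler0n.
have [l [m [[l0 m0 ml lk] [l1 l2 m1 m2]]]] : exists l m : nat,
    [/\ (0 < l)%N, (0 < m)%N, (m <= l)%N & l.+1%:R <= c0 * k.+1%:R] /\
    [/\ K * (a + d1) < l%:R * Lam, l%:R * Lam <= K * (a + d1) + Lam,
        K * (b + d1) < m%:R * Lam & m%:R * Lam <= K * (b + d1) + Lam].
  have [l1 l2] := lenP a k a0; have [m1 m2] := lenP b k b_ge0.
  exists (len a k), (len b k); split; split => //.
  rewrite ltnS; apply: le_truncn.
  by rewrite ler_pM2r ?invr_gt0 // ler_wpM2l // lerD2r.
have E1 : s * (m%:R * Lam) <= (N * k)%:R * (tau + d / 2).
  exact: exponent_mu s_ge0 K0 tau1 m2 (ltW d_gt0) (ltW Lam0) k1.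
have E2 : (s - 1) * (l%:R * Lam) + m%:R * Lam <= (N * k)%:R * (tau + d / 2).
  apply: exponent_la s_ge0 K0 tau2 m2 _ (ltW d_gt0) (ltW Lam0) k1.
  by rewrite (ltW l1).
have E3 : 1728 * l.+1%:R <= expR ((N * k)%:R * (d / 4)).
  apply: le_trans k2; rewrite -mulrA; exact: (ler_wpM2l (ler0n R 1728) lk).
have sizeUVk : expR ((N * k)%:R * (s * Lam + tau + d)) <= ((size U)%:R * (size V)%:R) ^+ k.
  rewrite natrM mulrAC mulrC expRM_natl lerXn2r ?nnegrE ?expR_ge0 ?mulr_ge0 //.
have sizeUV1 : (beta ^+ N) `^ s <= (size U)%:R * (size V)%:R.
  apply: le_trans sizeUV; rewrite powR_pow // ler_expR.
  have : 0 <= N%:R * (tau + d) by rewrite mulr_ge0 // addr_ge0 // ltW.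
  by lra.
(* The extra 1 yields a strict inequality in the hitting conditions. *)
have tgt z j : (j <= l)%N -> K * (z + d1) <= j%:R * Lam ->
    beta * j.+1%:R * expR (p + 1 + K * z) <= expR (j%:R * Lam).
  move=> jl jz; apply: le_trans (_ : expR (K * (z + d1)) <= _); last by rewrite ler_expR.
  rewrite mulrDr [leRHS]expRD [expR (p + 1 + _)]expRD.
  apply: le_trans (_ : beta * expR (p + 1) * c0 * k.+1%:R * expR (K * z) <= _); last first.
    by rewrite [leRHS]mulrC ler_wpM2r ?expR_ge0.
  rewrite mulrA ler_wpM2r ?expR_ge0 // mulrAC -[leRHS]mulrA ler_wpM2l //.
    by rewrite mulr_ge0 ?expR_ge0 // ltW // (beta_gt0 beta_gt1).
  by apply: le_trans lk; rewrite ler_nat.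
have [t [ft pt tx]] := target_cylinder l0 x0_itv (tgt a l (leqnn l) (ltW l1)).
have [t' [ft' pt' tx']] := target_cylinder m0 y0_itv (tgt b m ml (ltW m1)).
exists (N * k + l)%N, (N * k)%N, (level_X beta N k U t), (level_Y beta N k l m V t').
have fT : {in [:: t], forall c, full l c} by move=> c; rewrite inE => /eqP->.
have fT' : {in [:: t'], forall c, full m c} by move=> c; rewrite inE => /eqP->.
have fF : {in full_seq (l - m), forall c, full (l - m) c} by move=> c /(full_seqP beta_gt1).
have fB := compseq_full beta_gt1 fT' fF; rewrite subnKC // in fB.
have blm : beta ^- l = beta ^- m * beta ^- (l - m) by rewrite -powVD subnKC.
have pB : {in compseq beta m [:: t'] (full_seq (l - m)), forall c, c + beta ^- l < 1}.
  move=> _ /mem_compseq[u [v [+ /fF[v0 v1 _ _] ->]]]; rewrite inE => /eqP->.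
  apply: le_lt_trans pt'; rewrite blm -addrA lerD2l.
  by rewrite [X in _ + X]mulrC -mulrDl ler_piMl // ltW ?powV_gt0.
split.
- by rewrite addn_gt0 l0 orbT.
- exact: (powseq_uniq beta_gt1 U_uniq U_full _ _ fT).
- apply: (powseq_uniq beta_gt1 V_uniq V_full _ _ fB).
  apply: compseq_uniq => //; first exact: full_seq_uniq.
  by move=> c /fF/(full_itv beta_gt1).
- exact: powseq_full.
- exact: powseq_full.
- apply: powseq_proper => // c; by rewrite inE => /eqP->.
- exact: powseq_proper.
- exact: (@level_XY_bound _ _ beta_gt1 s tau d N k l m U V t t' s_ge0 U_uniq V_uniq U_full V_full ft ft'
    ml sizeUV1 sizeUVk E1 E2 E3 (ltW d_gt0)).
- exact: (@level_size _ _ beta_gt1 s tau d N k l m U V t t' ml sizeUVk E2 E3 (ltW d_gt0)).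
- move=> c y cX y01.
  have [[w + ->] Sf] := powseq_orbit beta_gt1 U_full fT U_f cX y01.
  rewrite inE => /eqP->; apply: le_lt_trans (tx y y01) _; rewrite ltr_expR.
  by rewrite kNK in Sf; move: (S _ _ _) Sf => u Sf; lra.
- move=> c y cY y01.
  have [[w + ->] Sg] := powseq_orbit beta_gt1 V_full fB V_g cY y01.
  move=> /mem_compseq[u [v [+ /fF fv ->]]]; rewrite inE => /eqP->.
  have -> : t' + v * beta ^- m + y * beta ^- l = t' + (v + y * beta ^- (l - m)) * beta ^- m.
    by rewrite blm; ring.
  apply: le_lt_trans (tx' _ (full_point_itv beta_gt1 fv y01)) _; rewrite ltr_expR.
  by rewrite kNK in Sg; move: (S _ _ _) Sg => w' Sg; lra.
Unshelve. all: by end_near.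
Qed.

Lemma infinite_set_nat_ge (A : set nat) : (forall j, exists2 n, A n & (j <= n)%N) ->
  infinite_set A.
Proof.
move=> H /finite_seqP[r Ar]; have [n An] := H (\max_(i <- r) i).+1.
rewrite ltnNge => /negP; apply; apply: (@leq_bigmax_seq _ _ xpredT id) => //.
by move: An; rewrite Ar.
Qed.

(** Each level is built for the bound [M] times the current depth on the Birkhoff sums already
    accumulated, so every coded pair hits both targets once in each level, at the same time. *)
Lemma blocks_lower_bound : tame f -> tame g ->
  hausdorff_measure s (shrinking_set beta x0 y0 f g) <> 0%E.
Proof.
move=> /tame_bounded[Mf Mf0 hMf] /tame_bounded[Mg Mg0 hMg]; pose M := Mf + Mg.
have hf x n : 0 <= x < 1 -> S n f x <= M * n%:R.
  move=> /andP[x0' /ltW x1]; have := birkhoff_bound beta n hMf (x := x).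
  rewrite x0' x1 ler_norml => /(_ erefl)/andP[_]; have := mulr_ge0 Mg0 (ler0n R n).
  by rewrite /M; lra.
have hg x n : 0 <= x < 1 -> S n g x <= M * n%:R.
  move=> /andP[x0' /ltW x1]; have := birkhoff_bound beta n hMg (x := x).
  rewrite x0' x1 ler_norml => /(_ erefl)/andP[_]; have := mulr_ge0 Mf0 (ler0n R n).
  by rewrite /M; lra.
have /choice[F FP] (p : nat) : exists q : (nat * nat) * (seq R * seq R),
    level (M * p%:R) q.1.1 q.1.2 q.2.1 q.2.2.
  by have [L [n [X [Y H]]]] := level_exists (M * p%:R); exists ((L, n), (X, Y)).
(* The depth is defined first, since the length of a level depends on the depth at which it
   starts. *)
pose D := fix D j := if j is i.+1 then (D i + (F (D i)).1.1)%N else 0%N.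
pose L j := (F (D j)).1.1; pose n j := (F (D j)).1.2.
pose X j := (F (D j)).2.1; pose Y j := (F (D j)).2.2.
have LP j : level (M * (D j)%:R) (L j) (n j) (X j) (Y j) by exact: FP.
have DE j : depth L j = D j.
  by elim: j => [|j IHj]; [rewrite depth0|rewrite depthS IHj].
have fX j := level_fullX (LP j); have fY j := level_fullY (LP j).
have pX j := level_properX (LP j); have pY j := level_properY (LP j).
apply: (@mass_distribution _ _ beta_gt1 s (36 * (beta ^+ N) `^ s) L X Y) => //.
- have : 1 <= (beta ^+ N) `^ s.
    by rewrite powR_pow // -expR0 ler_expR mulr_ge0 // mulr_ge0 // ltW // ln_gt0.
  by lra.
- by move=> j; exact: level_gt0 (LP j).
- by move=> j; exact: level_uniqX (LP j).
- by move=> j; exact: level_uniqY (LP j).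
- by move=> j; exact: level_boundXY (LP j).
- by move=> j; exact: level_sizeXY (LP j).
move=> u x v y ux vy.
have [_ _ [_ [_ /andP[x0' x1] _]]] := coded_orbit beta_gt1 fX pX 0 ux.
have [_ _ [_ [_ /andP[y0' y1] _]]] := coded_orbit beta_gt1 fY pY 0 vy.
split; rewrite /= ?in_itv /= ?x0' ?y0' ?ltW //.
apply: infinite_set_nat_ge => j; exists (D j + n j)%N; last first.
  by rewrite -DE (leq_trans (leq_depth (fun j => level_gt0 (LP j)) j)) // leq_addr.
have [wx wx01 [_ [Tx _ [wx' wx'01 wxE]]]] := coded_orbit beta_gt1 fX pX j ux.
have [wy wy01 [_ [Ty _ [wy' wy'01 wyE]]]] := coded_orbit beta_gt1 fY pY j vy.
rewrite DE in Tx Ty.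
have [uX _] := ux j; have [vY _] := vy j.
have := level_hitX (LP j) uX wx'01; have := level_hitY (LP j) vY wy'01.
rewrite -wxE -wyE => hy hx.
rewrite /= !birkhoffD [(D j + n j)%N]addnC !iterD Tx Ty; split.
  apply: lt_le_trans hx _; rewrite ler_expR lerN2 lerD2r; apply: hf.
  by rewrite x0' x1.
apply: lt_le_trans hy _; rewrite ler_expR lerN2 lerD2r; apply: hg.
by rewrite y0' y1.
Qed.

End levels.

Lemma ler_sum_bins {R : realType} {I : eqType} (r : seq I) (Q : nat) (bin : I -> nat)
    (F : I -> R) (G : nat -> R) :
  (forall i, i \in r -> (bin i < Q)%N /\ F i <= G (bin i)) ->
  \sum_(i <- r) F i <=
  \sum_(0 <= q < Q) (count (fun i => bin i == q) r)%:R * G q.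
Proof.
elim: r => [|i r IHr] H; first by rewrite big_nil big1 // => q _; rewrite mul0r.
rewrite big_cons /=; have [iQ Fi] := H i (mem_head _ _).
under [leRHS]eq_bigr do rewrite natrD mulrDl.
rewrite big_split /= lerD //; last by apply: IHr => j jr; apply: H; rewrite inE jr orbT.
rewrite (bigD1_seq (bin i)) ?mem_index_iota ?iota_uniq //= eqxx mul1r.
rewrite big1 ?addr0 // => q /negbTE; rewrite eq_sym => ->.
by rewrite mul0r.
Qed.

(** * Choice of the blocks and the lower bound *)

Section horseshoe.
Context {R : realType} (beta : R) (beta_gt1 : 1 < beta).
Local Notation S := (birkhoff beta).
Local Notation full := (full beta).
Local Notation full_seq := (full_seq beta).
Local Notation Lam := (ln beta).
Variables (f g : R -> R).
Hypotheses (tf : tame f) (tg : tame g)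
  (f0 : forall x : R, 0 <= x <= 1 -> 0 <= f x)
  (g0 : forall x : R, 0 <= x <= 1 -> 0 <= g x)
  (gf : forall x y : R, 0 <= x <= 1 -> 0 <= y <= 1 -> g y <= f x).

(* Pigeonhole: one pair of bins on which the Birkhoff sums are nearly constant
   carries an exponentially large part of the partition function. *)
Lemma blocks_exist (kap A B D : R) : 0 <= A -> 0 <= B -> 0 < D ->
  (\forall n \near \oo, expR (n%:R * (kap + D)) <=
     (\sum_(c <- full_seq n) expR (- (A * S n f c))) *
     (\sum_(c <- full_seq n) expR (- (B * S n g c)))) ->
  exists N U V a b,
    [/\ (0 < N)%N, uniq U, uniq V, {in U, forall c, full N c} & {in V, forall c, full N c}] /\
    [/\ 0 <= b, b <= a,
     forall u y, u \in U -> 0 <= y < 1 -> S N f (u + y * beta ^- N) <= N%:R * a,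
     forall v y, v \in V -> 0 <= y < 1 -> S N g (v + y * beta ^- N) <= N%:R * b &
     expR (N%:R * (kap + (A * a + B * b) + D / 2)) <= (size U)%:R * (size V)%:R].
Proof.
move=> A0 B0 D0 hsum.
(* The losses are [4 * A * e] and [3 * B * e] from the definitions of [a] and [b], and [e] from the
   number of pairs of bins; their sum is [D / 2]. *)
pose w := 4 * A + 3 * B + 1; have w0 : 0 < w by rewrite /w; lra.
pose e := D / (2 * w); have e0 : 0 < e by rewrite divr_gt0 // mulr_gt0.
have eD : w * e = D / 2 by rewrite /e; field; rewrite gt_eqF.
have [Mf Mf0 hMf] := tame_bounded tf; have [Mg Mg0 hMg] := tame_bounded tg.
pose M := Mf + Mg; have M0 : 0 <= M by exact: addr_ge0.
have [Kf Kf0 hKf] := birkhoff_distortion beta_gt1 tf e0.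
have [Kg Kg0 hKg] := birkhoff_distortion beta_gt1 tg e0.
pose Q := (Num.truncn (M / e)).+1.
have Q0 : 0 < Q%:R :> R by rewrite ltr0n.
have [N [N0 NK NQ Nsum]] : exists N, [/\ 0 < N%:R :> R, Kf + Kg <= N%:R * e,
    Q%:R * Q%:R <= expR (N%:R * e) & expR (N%:R * (kap + D)) <=
     (\sum_(c <- full_seq N) expR (- (A * S N f c))) *
     (\sum_(c <- full_seq N) expR (- (B * S N g c)))].
  near (\oo : set_system nat) => N; exists N; split.
  - by near: N; exact: nbhs_infty_gtr.
  - by rewrite -ler_pdivrMr //; near: N; exact: nbhs_infty_ger.
  - apply: le_trans (_ : Q%:R * Q%:R * N.+1%:R <= _).
      by rewrite ler_peMr ?mulr_ge0 // ler1n.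
    by rewrite [N%:R * e]mulrC; near: N; exact: near_linear_le_expR.
  - by near: N.
have Ne : 0 < N%:R * e by rewrite mulr_gt0.
pose bin (h : R -> R) c := Num.truncn (S N h c / (N%:R * e)).
have binP (h : R -> R) c : (forall x : R, 0 <= x <= 1 -> 0 <= h x) ->
    (forall x : R, 0 <= x <= 1 -> `|h x| <= M) -> c \in full_seq N ->
    [/\ (bin h c < Q)%N, (bin h c)%:R * (N%:R * e) <= S N h c &
      S N h c <= ((bin h c)%:R + 1) * (N%:R * e)].
  move=> h0 hM /(full_seq_itv beta_gt1) c01.
  have Sh0 := birkhoff_ge0 beta N h0 c01.
  have := birkhoff_bound beta N hM c01; rewrite ger0_norm // => ShM.
  have /truncn_itv/andP[b1 b2] : 0 <= S N h c / (N%:R * e) by rewrite divr_ge0 // ltW.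
  rewrite /bin; split.
  - rewrite ltnS le_truncn // ler_pdivrMr // mulrCA divfK ?gt_eqF //.
  - by rewrite -ler_pdivlMr.
  - by rewrite natr1 -ler_pdivrMr // ltW.
have hMf' (x : R) : 0 <= x <= 1 -> `|f x| <= M by move=> /hMf; rewrite /M; lra.
have hMg' (x : R) : 0 <= x <= 1 -> `|g x| <= M by move=> /hMg; rewrite /M; lra.
have sum_le (h : R -> R) E : 0 <= E -> (forall x : R, 0 <= x <= 1 -> 0 <= h x) ->
    (forall x : R, 0 <= x <= 1 -> `|h x| <= M) ->
    \sum_(c <- full_seq N) expR (- (E * S N h c)) <=
    \sum_(0 <= q < Q) (count (fun c => bin h c == q) (full_seq N))%:R *
      expR (- (E * (q%:R * (N%:R * e)))).
  move=> E0 h0 hM; apply: ler_sum_bins => c /(binP h c h0 hM)[bQ b1 _]; split => //.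
  by rewrite ler_expR lerN2 ler_wpM2l.
pose U q := [seq c <- full_seq N | bin f c == q].
pose V q := [seq c <- full_seq N | bin g c == q].
have [q [r [qQ rQ qr]]] : exists q r, [/\ (q < Q)%N, (r < Q)%N &
    expR (N%:R * (kap + D)) / (Q%:R * Q%:R) <=
    (size (U q))%:R * (size (V r))%:R *
      expR (- (A * (q%:R * (N%:R * e)) + B * (r%:R * (N%:R * e))))].
  apply: contrapT => H.
  have lt q r : (q < Q)%N -> (r < Q)%N ->
      (size (U q))%:R * (size (V r))%:R *
      expR (- (A * (q%:R * (N%:R * e)) + B * (r%:R * (N%:R * e)))) <
      expR (N%:R * (kap + D)) / (Q%:R * Q%:R).
    by move=> qQ rQ; rewrite ltNge; apply/negP => H'; apply: H; exists q, r.
  have : expR (N%:R * (kap + D)) < expR (N%:R * (kap + D)).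
    apply: le_lt_trans Nsum _.
    apply: le_lt_trans (ler_pM _ _ (sum_le f A A0 f0 hMf') (sum_le g B B0 g0 hMg')) _.
    - by apply: sumr_ge0 => c _; exact: expR_ge0.
    - by apply: sumr_ge0 => c _; exact: expR_ge0.
    rewrite big_distrlr /=.
    apply: lt_le_trans (_ : \sum_(0 <= q < Q) \sum_(0 <= r < Q)
       expR (N%:R * (kap + D)) / (Q%:R * Q%:R) <= _).
      apply: ltr_sum_nat => // q /andP[_ qQ]; apply: ltr_sum_nat => // r /andP[_ rQ].
      apply: le_lt_trans (lt q r qQ rQ); rewrite !size_filter opprD expRD.
      by rewrite le_eqVlt; apply/orP; left; apply/eqP; ring.
    rewrite !sumr_const_nat subn0 -mulrnA -[leLHS]mulr_natr natrM.
    by rewrite divfK // mulf_neq0 // gt_eqF.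
  by rewrite ltxx.
have Uf : {in U q, forall c, full N c /\ [/\ q%:R * (N%:R * e) <= S N f c & S N f c <= (q%:R + 1) * (N%:R * e)]}.
  move=> c; rewrite mem_filter => /andP[/eqP <- cN].
  by have [_ ? ?] := binP f c f0 hMf' cN; split; [exact/(full_seqP beta_gt1)|split].
have Vg : {in V r, forall c, full N c /\ [/\ r%:R * (N%:R * e) <= S N g c & S N g c <= (r%:R + 1) * (N%:R * e)]}.
  move=> c; rewrite mem_filter => /andP[/eqP <- cN].
  by have [_ ? ?] := binP g c g0 hMg' cN; split; [exact/(full_seqP beta_gt1)|split].
(* The bin gives q + 1, the distortion 1 and its constant 1, that is q + 3, and likewise r + 3. The
   additional 1 in [a] ensures [b <= a], as comparing the sums of [f] and [g] only gives r <= q +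
   1. *)
pose a := (q%:R + 4) * e; pose b := (r%:R + 3) * e.
have UV0 : 0 < (size (U q))%:R * (size (V r))%:R :> R.
  have : 0 < expR (N%:R * (kap + D)) / (Q%:R * Q%:R) by rewrite divr_gt0 ?expR_gt0 ?mulr_gt0.
  by move=> /lt_le_trans/(_ qr); rewrite pmulr_lgt0 // expR_gt0.
have [cU cV] : nth 0 (U q) 0 \in U q /\ nth 0 (V r) 0 \in V r.
  by move: UV0; rewrite -natrM ltr0n muln_gt0 => /andP[? ?]; rewrite !mem_nth.
have ba : b <= a.
  have [fc [_ c2]] := Uf _ cU; have [fd [d1 _]] := Vg _ cV.
  have c01 := full_itv beta_gt1 fc; have d01 := full_itv beta_gt1 fd.
  have {}c01 : 0 <= nth 0 (U q) 0 <= 1 by case/andP: c01 => -> /ltW.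
  have {}d01 : 0 <= nth 0 (V r) 0 <= 1 by case/andP: d01 => -> /ltW.
  have := @le_birkhoff _ beta N g f _ _ d01 c01 (fun a b ha hb => gf hb ha).
  move=> /(le_trans d1)/le_trans/(_ c2); rewrite ler_pM2r // => rq.
  by rewrite /a /b ler_pM2r //; lra.
have shift (h : R -> R) (K : R) u y : (forall n x y, 0 <= x <= 1 -> 0 <= y <= 1 ->
    \sum_(0 <= i < n) `|iter i (beta_map beta) x - iter i (beta_map beta) y| <= 3 / (beta - 1) ->
    `|S n h x - S n h y| <= n%:R * e + K) -> full N u -> 0 <= y < 1 ->
    S N h (u + y * beta ^- N) <= S N h u + N%:R * e + K.
  move=> hK fu y01; have := hK N _ _ _ _ (full_orbit_dist beta_gt1 fu y01).
  have /andP[-> /ltW ->] := full_point_itv beta_gt1 fu y01.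
  have /andP[-> /ltW ->] := full_itv beta_gt1 fu.
  by move=> /(_ isT isT); rewrite ler_norml => /andP[_]; lra.
exists N, (U q), (V r), a, b; split; split.
- by rewrite -(ltr_nat R).
- by rewrite filter_uniq // full_seq_uniq.
- by rewrite filter_uniq // full_seq_uniq.
- by move=> c /Uf[].
- by move=> c /Vg[].
- by rewrite mulr_ge0 ?(ltW e0) // addr_ge0.
- exact: ba.
- move=> u y /Uf[fu [_ u2]] y01; apply: le_trans (shift f Kf u y hKf fu y01) _.
  by rewrite /a; lra.
- move=> v y /Vg[fv [_ v2]] y01; apply: le_trans (shift g Kg v y hKg fv y01) _.
  by rewrite /b; lra.
rewrite -(ler_pM2r (expR_gt0 (- (A * (q%:R * (N%:R * e)) + B * (r%:R * (N%:R * e)))))).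
apply: le_trans qr; rewrite ler_pdivlMr ?mulr_gt0 //.
apply: le_trans (ler_wpM2l _ NQ) _; first by rewrite mulr_ge0 ?expR_ge0.
rewrite -!expRD ler_expR /a /b.
have : N%:R * (w * e) = N%:R * (D / 2) by rewrite eD.
by rewrite /w; lra.
Unshelve. all: by end_near.
Qed.

Lemma lower_bound (s x0 y0 : R) : 0 <= s -> 0 <= x0 <= 1 -> 0 <= y0 <= 1 ->
  0 < pressure beta (fun x => f x - s * (Lam + f x)) + pressure beta (fun x => - g x) ->
  0 < pressure beta (fun x => - (s * (Lam + g x))) + Lam ->
  hausdorff_measure s (shrinking_set beta x0 y0 f g) <> 0%E.
Proof.
move=> s0 x01 y01.
set phi := fun x => f x - _; set psi := fun x => - g x; set chi := fun x => - _.
have tphi : tame phi.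
  apply: (eq_tame (h := fun x => - s * Lam + (1 - s) * f x)); last by move=> x; rewrite /phi; ring.
  by apply: tameD; [exact: tame_cst|exact: tameZ].
have tpsi : tame psi.
  by apply: (eq_tame (h := fun x => - 1 * g x)); [exact: tameZ|move=> x; rewrite /psi mulN1r].
have tchi : tame chi.
  apply: (eq_tame (h := fun x => - s * Lam + - s * g x)); last by move=> x; rewrite /chi; ring.
  by apply: tameD; [exact: tame_cst|exact: tameZ].
have Fphi := fun e (e0 : 0 < e) => full_sum_pressure beta_gt1 tphi e0.
have Fpsi := fun e (e0 : 0 < e) => full_sum_pressure beta_gt1 tpsi e0.
have Fchi := fun e (e0 : 0 < e) => full_sum_pressure beta_gt1 tchi e0.
move: (pressure beta phi) (pressure beta psi) (pressure beta chi) Fphi Fpsi Fchi.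
move=> p1 p2 p3 Fphi Fpsi Fchi p12 p3L.
(* The exponent A a + B b must dominate both s b and (s - 1) a + b. Since b <= a, the second is
   larger when s >= 1 and the first when s < 1; in the latter case A = 0, and the sum in [f] just
   counts full words. *)
have [A [B [D [A0 B0 D0 hsum AB]]]] : exists A B D, [/\ 0 <= A, 0 <= B, 0 < D,
    (\forall n \near \oo, expR (n%:R * (s * Lam + D)) <=
     (\sum_(c <- full_seq n) expR (- (A * S n f c))) *
     (\sum_(c <- full_seq n) expR (- (B * S n g c)))) &
    forall a b, 0 <= b -> b <= a -> s * b <= A * a + B * b /\ (s - 1) * a + b <= A * a + B * b].
  have [s1|s1] := leP 1 s.
    exists (s - 1), 1, ((p1 + p2) / 2); split; [lra|lra|by rewrite divr_gt0| |].
      have e0 : 0 < (p1 + p2) / 4 by rewrite divr_gt0.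
      near=> n.
      have /andP[F1 _] : expR (n%:R * (p1 - (p1 + p2) / 4)) <= full_sum beta n phi <=
        expR (n%:R * (p1 + (p1 + p2) / 4)) by near: n; exact: Fphi.
      have /andP[F2 _] : expR (n%:R * (p2 - (p1 + p2) / 4)) <= full_sum beta n psi <=
        expR (n%:R * (p2 + (p1 + p2) / 4)) by near: n; exact: Fpsi.
      have -> : \sum_(c <- full_seq n) expR (- ((s - 1) * S n f c)) =
          expR (n%:R * (s * Lam)) * full_sum beta n phi.
        rewrite /full_sum mulr_sumr; apply: eq_bigr => c _.
        by rewrite -expRD /phi birkhoff_f; congr expR; ring.
      have -> : \sum_(c <- full_seq n) expR (- (1 * S n g c)) = full_sum beta n psi.
        by apply: eq_bigr => c _; rewrite mul1r /psi birkhoffN.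
      apply: le_trans (_ : expR (n%:R * (s * Lam)) * expR (n%:R * (p1 - (p1 + p2) / 4)) *
        expR (n%:R * (p2 - (p1 + p2) / 4)) <= _).
        by rewrite -!expRD ler_expR; lra.
      by rewrite ler_pM ?mulr_ge0 ?expR_ge0 // ler_wpM2l ?expR_ge0.
    move=> a b b0 ba; rewrite mul1r lexx; split => //.
    have : (s - 1) * b <= (s - 1) * a by rewrite ler_wpM2l //; lra.
    lra.
  exists 0, s, ((p3 + Lam) / 2); split; [exact: lexx|exact: s0|by rewrite divr_gt0| |].
    have e0 : 0 < (p3 + Lam) / 4 by rewrite divr_gt0.
    near=> n.
    have /andP[F3 _] : expR (n%:R * (p3 - (p3 + Lam) / 4)) <= full_sum beta n chi <=
      expR (n%:R * (p3 + (p3 + Lam) / 4)) by near: n; exact: Fchi.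
    have -> : \sum_(c <- full_seq n) expR (- (0 * S n f c)) = (size (full_seq n))%:R.
      by rewrite -size_sum; apply: eq_bigr => c _; rewrite mul0r oppr0 expR0.
    have -> : \sum_(c <- full_seq n) expR (- (s * S n g c)) =
        expR (n%:R * (s * Lam)) * full_sum beta n chi.
      rewrite /full_sum mulr_sumr; apply: eq_bigr => c _.
      by rewrite -expRD /chi birkhoff_g; congr expR; ring.
    have n2 : 2 * n.+1%:R <= expR ((p3 + Lam) / 4 * n%:R).
      by near: n; exact: near_linear_le_expR.
    have sz : expR (n%:R * Lam - (p3 + Lam) / 4 * n%:R) <= (size (full_seq n))%:R.
      rewrite expRD -pow_expR // expRN ler_pdivrMr ?expR_gt0 //.
      apply: le_trans (size_full_seq_ge beta_gt1 n) _.
      by rewrite mulrC ler_wpM2l.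
    apply: le_trans (_ : expR (n%:R * Lam - (p3 + Lam) / 4 * n%:R) *
       (expR (n%:R * (s * Lam)) * expR (n%:R * (p3 - (p3 + Lam) / 4))) <= _).
      by rewrite -!expRD ler_expR; lra.
    by rewrite ler_pM ?mulr_ge0 ?expR_ge0 // ler_wpM2l ?expR_ge0.
  move=> a b b0 ba; rewrite mul0r add0r lexx; split => //.
  have : (s - 1) * a <= (s - 1) * b by rewrite ler_wnM2l //; lra.
  lra.
have [N [U [V [a [b [[N0 uU uV fU fV] [b0 ba Uf Vg UV]]]]]]] := blocks_exist A0 B0 D0 hsum.
have [tau1 tau2] := AB a b b0 ba.
apply: (@blocks_lower_bound _ _ beta_gt1 s (A * a + B * b) (D / 2) a b x0 y0 f g N U V) => //.
by rewrite divr_gt0.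
Unshelve. all: by end_near.
Qed.

End horseshoe.

Theorem theorem1p1 (R : realType) (beta : R) (x0 y0 : R) (f g : R -> R)
  (beta_gt1 : 1 < beta)
  (x0_in : x0 \in `[0, 1]) (y0_in : y0 \in `[0, 1])
  (f_cont : {within `[0, 1], continuous f})
  (g_cont : {within `[0, 1], continuous g})
  (f_gt0 : forall x, x \in `[0, 1] -> 0 < f x)
  (g_gt0 : forall x, x \in `[0, 1] -> 0 < g x)
  (g_le_f : forall x y, x \in `[0, 1] -> y \in `[0, 1] -> g y <= f x) :
  hausdorff_dim (shrinking_set beta x0 y0 f g) =
    Order.min (s1 beta f g) (s2 beta g).
Proof.
have itv (x : R) : (x \in `[0, 1]) = (0 <= x <= 1) by rewrite in_itv.
have tf := continuous_tame f_cont; have tg := continuous_tame g_cont.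
have f0 (x : R) : 0 <= x <= 1 -> 0 <= f x by rewrite -itv => /f_gt0/ltW.
have g0 (x : R) : 0 <= x <= 1 -> 0 <= g x by rewrite -itv => /g_gt0/ltW.
have gf (x y : R) : 0 <= x <= 1 -> 0 <= y <= 1 -> g y <= f x.
  by rewrite -!itv; exact: g_le_f.
rewrite itv in x0_in; rewrite itv in y0_in.
have dim_le (s : R) : 0 <= s -> (forall e, 0 < e ->
    hausdorff_measure (s + e) (shrinking_set beta x0 y0 f g) = 0%E) ->
    (hausdorff_dim (shrinking_set beta x0 y0 f g) <= s%:E)%E.
  move=> s_ge0 H; apply/lee_addgt0Pr => e e0; rewrite -EFinD.
  apply: ereal_inf_lbound; exists (s + e) => //; split; last exact: H.
  by rewrite addr_ge0 // ltW.
apply/eqP; rewrite eq_le; apply/andP; split.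
  rewrite le_min; apply/andP; split; apply: le_ereal_inf_tmp => _ [s [s_ge0 Ps] <-].
    by apply: dim_le => // e e0; exact: upper_bound_f.
  by apply: dim_le => // e e0; exact: upper_bound_g.
(* An exponent of null measure below both infima would violate both pressure inequalities, contrary
   to [lower_bound]. *)
apply: le_ereal_inf_tmp => _ [s [s_ge0 Hs] <-]; rewrite leNgt; apply/negP.
rewrite lt_min => /andP[ss1 ss2]; apply: lower_bound Hs => //.
  rewrite ltNge; apply/negP => P1; move: ss1; rewrite ltNge => /negP; apply.
  by apply: ereal_inf_lbound; exists s.
rewrite ltNge; apply/negP => P2; move: ss2; rewrite ltNge => /negP; apply.
by apply: ereal_inf_lbound; exists s.
Qed.
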